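(* Let $s\in(s_0,1)$ with $s_0>0$, let $0<\lambda\le\Lambda$ and $L\in\mathcal L_s(\lambda,\Lambda;1)$. Let $\eta\in C^{1,1}(\mathbb R^n)$ be such that $\eta\ge0$, and let $|h|\le1/8$. Then there exists $\sigma_0=\sigma_0(n,s,\Lambda/\lambda,\|\eta\|_{C^{1,1}(\mathbb R^n)})>0$ such that for every $\sigma\ge\sigma_0$ and every $u,v\in C^{2s+\varepsilon}_{loc}(\mathbb R^n)\cap L^\infty(\mathbb R^n)$ $$L\big(\eta^2(D_hu)^2+\sigma u_h^2\big)\le2\eta^2L(D_hu)\,D_hu+2\sigma L(u_h)\,u_h,$$ $$L\big(\eta^2(D_hv)_+^2+\sigma v_h^2\big)\le2\eta^2L(D_hv)\,(D_hv)_++2\sigma L(v_h)\,v_h.$$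
   Context: The inequalities are pointwise in $\mathbb R^n$, and $\varepsilon>0$. For $h\in\mathbb R^n\setminus\{0\}$: $u_h(x):=\int_0^1u(x+th)\,dt$ and $D_hu(x):=\frac{u(x+h)-u(x)}{|h|}$; $t_+=\max\{t,0\}$, $u_h^2=(u_h)^2$. Operators: $Lu(x)=\mathrm{p.v.}\int_{\mathbb R^n}(u(x)-u(y))K(x-y)\,dy$ with $K:\mathbb R^n\to[0,\infty]$ symmetric, $K(y)=K(-y)$. One writes $L\in\mathcal L_s(\lambda,\Lambda;1)$ if for all $y\neq0$: $\lambda|y|^{-n-2s}\le K(y)\le\Lambda|y|^{-n-2s}$ and $|\nabla K(y)|\le\Lambda|y|^{-1}K(y)$.
   Formalization: σ₀ may depend also on max(1,λ): with Λ/λ fixed and Λ→∞ the bound |∇K|≤Λ|y|⁻¹K gives no control and oscillating kernels defeat any fixed σ₀(n,s,Λ/λ,‖η‖); for λ≤1 the dependence is as stated. Also h≠0. *)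

(* Defs.v *)
From HB Require Import structures.
From mathcomp Require Import all_boot all_order all_algebra.
From mathcomp Require Import all_classical all_reals all_analysis.

Set Implicit Arguments.
Unset Strict Implicit.
Unset Printing Implicit Defensive.

Import Order.TTheory GRing.Theory Num.Theory.
Import numFieldNormedType.Exports.

Local Open Scope classical_set_scope.
Local Open Scope ring_scope.

(* The library has no measurable structure and no Lebesgue measure on R^n.
   'rV[R]_n gets the sigma-algebra generated by the coordinates (as the
   library does for n.-tuple T), that is, the Borel sigma-algebra. *)
Section measurable_rV.
Context {R : realType} (n : nat).

Let coord (i : 'I_n) (x : 'rV[R]_n) : measurableTypeR R := x 0 i.

Let rV_set0 : g_sigma_preimage coord set0.
Proof. exact: sigma_algebra0. Qed.

Let rV_setC A : g_sigma_preimage coord A -> g_sigma_preimage coord (~` A).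
Proof. exact: sigma_algebraC. Qed.

Let rV_bigcup (F : (set 'rV[R]_n)^nat) :
  (forall i, g_sigma_preimage coord (F i)) ->
  g_sigma_preimage coord (\bigcup_i (F i)).
Proof. exact: sigma_algebra_bigcup. Qed.

HB.instance Definition _ := @isMeasurable.Build default_measure_display
  'rV[R]_n (g_sigma_preimage coord) rV_set0 rV_setC rV_bigcup.

Lemma measurable_coord_rV (i : 'I_n) :
  measurable_fun [set: 'rV[R]_n] (fun x => x 0 i : measurableTypeR R).
Proof.
move=> _ Y mY; rewrite setTI; apply: sub_sigma_algebra => /=.
rewrite -bigcup_seq/=; exists i => /=; first by rewrite mem_index_enum.
by exists Y => //; rewrite setTI.
Qed.

Lemma measurable_fun_rVP d (T : measurableType d) (f : T -> 'rV[R]_n) :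
  measurable_fun [set: T] f <->
  forall i, measurable_fun [set: T] (fun t => f t 0 i : measurableTypeR R).
Proof.
split=> [mf i|mf].
  exact: (measurableT_comp (measurable_coord_rV i) mf).
move=> _ A mA; rewrite setTI.
suff: g_sigma_preimage coord `<=` [set B | measurable (f @^-1` B)] by apply.
apply: smallest_sub.
- split=> [|B mB|F mF] /=.
  + by rewrite preimage_set0; exact: measurable0.
  + by rewrite setTD preimage_setC; exact: measurableC.
  + by rewrite preimage_bigcup; apply: bigcupT_measurable => i; exact: mF.
- rewrite -bigcup_seq => B [i _ [C mC <-]] /=; rewrite setTI.
  by rewrite -(setTI (_ @^-1` _)); exact: (mf i measurableT C mC).
Qed.

End measurable_rV.

Section lebesgue_rV.
Context {R : realType}.

Definition cons_rV n (p : measurableTypeR R * 'rV[R]_n) : 'rV[R]_n.+1 :=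
  row_mx (const_mx p.1 : 'rV[R]_1) p.2.

Lemma measurable_cons_rV n : measurable_fun setT (@cons_rV n).
Proof.
apply/measurable_fun_rVP => i.
rewrite (_ : (fun _ => _) = fun p => row_mx (const_mx p.1 : 'rV[R]_1) p.2 0 i)//.
case: (@split_ordP 1 n i) => j ->.
- under eq_fun do rewrite row_mxEl mxE.
  exact: measurable_fst.
- under eq_fun do rewrite row_mxEr.
  exact: (measurableT_comp (measurable_coord_rV j) measurable_snd).
Qed.

Section lebesgue_rV_step.
Variables (n : nat) (mu : {sigma_finite_measure set 'rV[R]_n -> \bar R}).

Definition lebesgue_rV_step : set 'rV[R]_n.+1 -> \bar R :=
  pushforward (lebesgue_measure \x mu)%E (@cons_rV n).

Let lebesgue_rV_step0 : lebesgue_rV_step set0 = 0%E.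
Proof. by rewrite /lebesgue_rV_step /pushforward preimage_set0 measure0. Qed.

Let lebesgue_rV_step_ge0 A : (0 <= lebesgue_rV_step A)%E.
Proof. by rewrite /lebesgue_rV_step /pushforward; exact: measure_ge0. Qed.

Let lebesgue_rV_step_additive : semi_sigma_additive lebesgue_rV_step.
Proof.
move=> F mF tF mUF; rewrite /lebesgue_rV_step /pushforward preimage_bigcup.
have mcons A : measurable A -> measurable (@cons_rV n @^-1` A).
  by move=> mA; rewrite -[X in measurable X]setTI; exact: measurable_cons_rV.
apply: measure_semi_sigma_additive.
- by move=> k; exact: mcons.
- apply/trivIsetP => /= i j _ _ ij; rewrite -preimage_setI.
  by move/trivIsetP : tF => /(_ _ _ _ _ ij) ->//; rewrite preimage_set0.
- by rewrite -preimage_bigcup; exact: mcons.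
Qed.

HB.instance Definition _ := isMeasure.Build _ _ _ lebesgue_rV_step
  lebesgue_rV_step0 lebesgue_rV_step_ge0 lebesgue_rV_step_additive.

Let uncons_rV (x : 'rV[R]_n.+1) : measurableTypeR R * 'rV[R]_n :=
  (x 0 0, \row_j x 0 (lift 0 j)).

Let cons_rVK : cancel (@cons_rV n) uncons_rV.
Proof.
move=> [a x]; congr pair => /=.
  rewrite /cons_rV (_ : 0 = lshift n (0 : 'I_1)); last exact/val_inj.
  by rewrite (row_mxEl (const_mx a : 'rV[R]_1) x) mxE.
apply/rowP => j; rewrite mxE /cons_rV.
rewrite (_ : lift 0 j = rshift 1 j); last exact/val_inj.
by rewrite (row_mxEr (const_mx a : 'rV[R]_1) x).
Qed.

Let measurable_uncons_rV : measurable_fun setT uncons_rV.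
Proof.
apply/measurable_fun_pairP; split; first exact: measurable_coord_rV.
apply/measurable_fun_rVP => i /=.
under eq_fun do rewrite mxE.
exact: measurable_coord_rV.
Qed.

Let lebesgue_rV_step_sigma_finite : sigma_finite setT lebesgue_rV_step.
Proof.
have /sigma_finiteP[F [TF ndF Foo]] := sigma_finiteT (@lebesgue_measure R).
have /sigma_finiteP[G [TG ndG Goo]] := sigma_finiteT mu.
exists (fun k => uncons_rV @^-1` (F k `*` G k)).
  apply/esym; rewrite -subTset => x _.
  have [i _ Fi] : (\bigcup_i F i) (uncons_rV x).1 by rewrite -TF.
  have [j _ Gj] : (\bigcup_i G i) (uncons_rV x).2 by rewrite -TG.
  exists (maxn i j) => //; split.
  - by move: Fi; exact/subsetPset/ndF/leq_maxl.
  - by move: Gj; exact/subsetPset/ndG/leq_maxr.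
move=> k; have [mF Fk] := Foo k; have [mG Gk] := Goo k; split.
  rewrite -[X in measurable X]setTI; apply: measurable_uncons_rV => //.
  exact: measurableX.
rewrite /lebesgue_rV_step /pushforward -comp_preimage.
rewrite (_ : uncons_rV \o _ = id); last first.
  by apply/funext => p /=; rewrite cons_rVK.
by rewrite preimage_id product_measure1E// lte_mul_pinfty// ge0_fin_numE.
Qed.

HB.instance Definition _ := Measure_isSigmaFinite.Build _ _ _ lebesgue_rV_step
  lebesgue_rV_step_sigma_finite.

End lebesgue_rV_step.

(* Lebesgue measure on R^n: the n-fold product of the Lebesgue measure on R,
   transported to row vectors. *)
Fixpoint lebesgue_rV (n : nat) : {sigma_finite_measure set 'rV[R]_n -> \bar R} :=
  match n with
  | 0 => \d_ (0 : 'rV[R]_0)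
  | m.+1 => lebesgue_rV_step (lebesgue_rV m)
  end.

End lebesgue_rV.

Section function_spaces.
Context {R : realType} (n : nat).
Implicit Types (u : 'rV[R]_n -> R) (x y : 'rV[R]_n).

(* Euclidean norm; the library's norm `|x| on 'rV[R]_n is the maximum norm. *)
Definition enorm x : R := Num.sqrt (\sum_i x 0 i ^+ 2).

Definition gradient u x : 'rV[R]_n := \row_i 'D_(delta_mx 0 i) u x.

(* ||u||_oo + ||grad u||_oo + Lipschitz seminorm of grad u, possibly +oo *)
Definition C11_norm u : \bar R :=
  (ereal_sup [set `|u x|%:E | x in setT]
   + ereal_sup [set (enorm (gradient u x))%:E | x in setT]
   + ereal_sup [set (enorm (gradient u p.1 - gradient u p.2)
                     / enorm (p.1 - p.2))%:E | p in [set p | p.1 <> p.2]])%E.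

Definition C11 u : Prop :=
  (forall x, differentiable u x) /\ (C11_norm u < +oo)%E.

(* C^{k,b}_loc(R^n): k times differentiable, and all partial derivatives of
   order k are b-Hoelder on every ball (for 0 < b this makes the lower-order
   ones continuous). *)
Fixpoint Ckb_loc (k : nat) (b : R) u : Prop :=
  match k with
  | 0 => forall r : R, exists C : R, forall x y, enorm x <= r -> enorm y <= r ->
           `|u x - u y| <= C * enorm (x - y) `^ b
  | k'.+1 => (forall x, differentiable u x) /\
             forall i, Ckb_loc k' b ('D_(delta_mx 0 i) u)
  end.

(* C^a_loc(R^n) for a real exponent a > 0: C^{k,b}_loc with a = k + b and
   0 < b <= 1; an integer a is thus read as C^{a-1,1}, which contains C^a. *)
Definition holder_loc (a : R) u : Prop :=
  exists k b, [/\ 0 < b, b <= 1, a = k%:R + b & Ckb_loc k b u].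

Definition Linfty u : Prop := u \in Lfun (lebesgue_rV n) +oo%E.

End function_spaces.

Section operators.
Context {R : realType} (n : nat).
Implicit Types (u : 'rV[R]_n -> R) (K : 'rV[R]_n -> \bar R) (h x y : 'rV[R]_n).

Definition seg_avg h u x : R :=
  \int[@lebesgue_measure R]_(t in `[0, 1]) u (x + t *: h).

Definition diff_quot h u x : R := (u (x + h) - u x) / enorm h.

Definition pos_part (t : R) : R := Num.max t 0.

(* The class L_s(lambda, Lambda; 1), in terms of the kernel; by the upper bound
   K is finite off the origin, so fine is harmless there. Pitfall: the gradient
   bound is invariant under K |-> c K while the two size bounds are not, so it
   is not controlled by the ratio Lambda / lambda when lambda > 1. *)
Definition kernel_class (s lam Lam : R) K : Prop :=
  [/\ forall y, (0 <= K y)%E,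
      forall y, K y = K (- y) &
      forall y, y != 0 ->
        [/\ ((lam * enorm y `^ (- n%:R - 2 * s))%:E <= K y)%E,
            (K y <= (Lam * enorm y `^ (- n%:R - 2 * s))%:E)%E,
            differentiable (fine \o K) y &
            enorm (gradient (fine \o K) y) <= Lam * (enorm y)^-1 * fine (K y)]].

Definition Lop K u x : R :=
  lim (fine (\int[lebesgue_rV n]_(y in [set y | (r < enorm (x - y))%R])
               ((u x - u y)%:E * K (x - y)%R))%E @[r --> 0^'+]).

End operators.

(* Main.v *)
(** Fix x and write w = D_h u, U = u_h, and P = w or P = w_+.  Since
    P(x) w(x) = P(x)^2, expanding the squares shows that the claim is
      int (E(z) - sigma (U(x-z) - U(x))^2) K(z) dz <= 0,
    where, with T = eta(x) and a = P(x),
      E(z) = -T^2 (P(x-z) - a)^2 - 2 T^2 a (P - w)(x-z) + (T^2 - eta(x-z)^2) P(x-z)^2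
    and a (P - w) >= 0.  If T = 0 then E <= 0.  Otherwise split at the scale
    rho = c sqrt(T).  Since eta >= 0 is C^{1,1}, |grad eta|^2 <= 4 N eta, so that
    for |z| <= rho, up to an odd term, E(z) is at most
    -(T^2/2) Q(z) + C N^2 T |z|^2 a^2 with Q(z) = (P(x-z) - a)^2 + a (P - w)(x-z).
    For larger |z|, E(z) <= 2 T a (T - eta(x-z)) w(x-z); here |h| w is the
    derivative of U in the direction h, and moving that derivative onto
    (T - eta(x-z)) K(z) and using Young's inequality leaves T^2 a^2 O(1) plus a
    multiple of (U(x-z) - U(x))^2 K(z).
    The remaining multiples of a^2 are absorbed by interpolation: testing
    a^2 <= a^2/4 + Q + a w(x-z) against a bump on the annulus of radius rho and
    integrating by parts once more bounds a^2 rho^{-2s} by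
    int (Q(z) + rho^{-2} (U(x-z) - U(x))^2) K(z) dz. *)

Require Import Defs.
From HB Require Import structures.
From mathcomp Require Import all_boot all_order all_algebra.
From mathcomp Require Import all_classical all_reals all_analysis.
From mathcomp Require Import measurable_realfun ess_sup_inf ring lra.

Set Implicit Arguments.
Unset Strict Implicit.
Unset Printing Implicit Defensive.

Import Order.TTheory GRing.Theory Num.Theory.
Import numFieldNormedType.Exports.

Local Open Scope classical_set_scope.
Local Open Scope ring_scope.

(** * Lebesgue measure on R^n *)

(** All estimates are made at a fixed truncation radius r of the kernel, with constants independent
    of r: K is C^1 only off the origin and L exists only as a limit, so r tends to 0 at the very
    end. Both integrations by parts use weights that vanish near the origin, hence produce no
    boundary term and are insensitive to r. The scale c sqrt(T) is dictated by homogeneity. For |z|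
    > rho/2 the gradient of eta at x is at most a multiple of |z|/c, so T - eta(x - z) is quadratic
    in z, and the far part costs T^2 a^2 times the integral of min(|z|,1)^2 K, a quantity free of
    rho. The near part costs T rho^(2-2s) a^2 = c^2 T^2 rho^(-2s) a^2. Interpolation pays for T^2
    rho^(-2s) a^2; relative to it the two costs are of order rho^(2s) and c^2, both small with c.
    The price is a factor T^2/rho^2 = rho^2/c^4 in front of the increments of U, whence the term
    1/c^4 in the threshold for sigma; its other term is the constant of Young's inequality in the
    far part. *)

Section borel_rV.
Context {R : realType} (n : nat).
Implicit Types (x y : 'rV[R]_n).

Let grid (k : nat) (x : 'rV[R]_n) : 'rV[int]_n :=
  \row_i Num.floor (x 0 i * k.+1%:R).

Let node (k : nat) (m : 'rV[int]_n) : 'rV[R]_n :=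
  \row_i ((m 0 i)%:~R / k.+1%:R).

Let grid_ball (k : nat) (x : 'rV[R]_n) :
  ball (node k (grid k x)) (2 / k.+1%:R) x.
Proof.
split=> [|i j]; first by rewrite divr_gt0.
rewrite !mxE (ord1 i) /ball /= ltr_norml.
have k0 : (0 : R) < k.+1%:R by [].
have h1 := floor_le_tmp (x 0 j * k.+1%:R).
have h2 := floorD1_gt (x 0 j * k.+1%:R).
rewrite intrD in h2.
set f := _%:~R in h1 h2 *.
rewrite ltrBlDr ltrBrDr; apply/andP; split.
  rewrite -mulNr -(ltr_pM2r k0) mulrDl !divfK ?gt_eqF//. lra.
rewrite -(ltr_pM2r k0) mulrDl !divfK ?gt_eqF//. lra.
Qed.

(** An open set is the countable union, over the mesh and the integer node, of the half-open grid
    cells whose surrounding ball lies inside it; a cell is a finite intersection of coordinate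
    conditions. *)
Lemma open_measurable_rV (U : set 'rV[R]_n) : open U -> measurable U.
Proof.
move=> oU.
pose C k := [set m | ball (node k m) (2 / k.+1%:R) `<=` U].
have -> : U = \bigcup_k \bigcup_m (if m \in C k then grid k @^-1` [set m] else set0).
  apply/seteqP; split=> x.
    move=> Ux; have /nbhs_ballP[e /= e0 eU] := open_nbhs_nbhs (conj oU Ux).
    have [k ke] : exists k : nat, 4 / k.+1%:R < e.
      exists (Num.truncn (4 / e)); rewrite ltr_pdivrMr// -ltr_pdivrMl// mulrC.
      exact: truncnS_gt.
    exists k => //; exists (grid k x) => //.
    rewrite mem_set// => y /= gy.
    apply: eU; apply: (@le_ball _ _ _ (2 / k.+1%:R + 2 / k.+1%:R)).
      by rewrite -mulrDl (_ : 2 + 2 = 4) ?ltW//; ring.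
    exact: (ball_triangle (ball_sym (grid_ball k x)) gy).
  move=> [k _ [m _]]; case: ifPn => //; rewrite inE => /= mC gm.
  by apply: mC; rewrite -[m]gm; exact: grid_ball.
rewrite /=; apply: bigcupT_measurable => k; apply: countable_bigcupT_measurable.
  exact: countableP.
move=> m; case: ifPn => // _.
rewrite (_ : _ @^-1` _ = \bigcap_(i in [set: 'I_n])
    (fun x => x 0 i) @^-1` [set t | m 0 i = Num.floor (t * k.+1%:R)]).
  apply: fin_bigcap_measurable => // i _; rewrite -[X in measurable X]setTI.
  apply: measurable_coord_rV => //.
  rewrite (_ : [set _ | _] = `[(m 0 i)%:~R / k.+1%:R, (m 0 i + 1)%:~R / k.+1%:R[%classic) //.
  apply/seteqP; split=> t /=; rewrite in_itv/= ler_pdivrMr// ltr_pdivlMr//.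
    by move=> ->; rewrite floor_le_tmp floorD1_gt.
  by move=> /floor_def ->.
apply/seteqP; split=> x /=.
  by move=> <- i _; rewrite mxE.
by move=> h; apply/rowP => i; rewrite mxE (h i).
Qed.

Lemma continuous_measurable_rV (D : set 'rV[R]_n) (f : 'rV[R]_n -> R) :
  open D -> {in D, continuous f} -> measurable_fun D f.
Proof.
move=> oD; rewrite -(continuous_open_subspace f oD) => /continuousP cf.
apply: (measurability _ (RGenOpens.measurableE R)).
move=> _ [_ [a [b ->] <-]].
have /open_subspaceP[V oV VD] := cf _ (@interval_open R (BRight a) (BLeft b) isT isT).
rewrite setIC -VD; apply: measurableI; exact: open_measurable_rV.
Qed.
End borel_rV.

Section lebesgue_rV_theory.
Context {R : realType}.

Let cons_rV0 n (p : R * 'rV[R]_n) : cons_rV p 0 ord0 = p.1.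
Proof.
have c0 : ord0 = lshift n (0 : 'I_1) by exact/val_inj.
by rewrite /cons_rV c0 (row_mxEl (const_mx p.1 : 'rV[R]_1)) mxE.
Qed.

Let cons_rVS n (p : R * 'rV[R]_n) j : cons_rV p 0 (lift ord0 j) = p.2 0 j.
Proof.
have cl : lift ord0 j = rshift 1 j by exact/val_inj.
by rewrite /cons_rV cl (row_mxEr (const_mx p.1 : 'rV[R]_1)).
Qed.

Local Open Scope ereal_scope.

Lemma measurable_reflect (c : R) :
  measurable_fun [set: R] ((fun t => c - t)%R : R -> R).
Proof. exact: measurable_funB. Qed.

(** By uniqueness of Lebesgue measure it is enough to compare half-open intervals; a reflection only
    exchanges the closed and the open end. *)
Lemma lebesgue_measure_reflect (c : R) (A : set (measurableTypeR R)) :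
  measurable A ->
  lebesgue_measure ((fun t : R => c - t)%R @^-1` A) = lebesgue_measure A.
Proof.
move=> mA.
pose f := (fun t : R => c - t)%R : measurableTypeR R -> measurableTypeR R.
pose f_mixin := isMeasurableFun.Build _ _ _ _ f (measurable_reflect c).
pose g : {mfun measurableTypeR R >-> measurableTypeR R} := HB.pack f f_mixin.
rewrite -[LHS]/(pushforward lebesgue_measure g A).
apply/esym/lebesgue_measure_unique => // _ [[a b]] _ <-.
rewrite [RHS](_ : _ = lebesgue_measure `[(c - b)%R, (c - a)%R[%classic).
  rewrite !lebesgue_measure_itv/= !lte_fin ltrD2l ltrN2.
  by case: ifPn => // _; rewrite -!EFinD; congr EFin; ring.
rewrite /= /pushforward; congr (lebesgue_measure _).
apply/seteqP; split=> t /=; rewrite !in_itv/= /f; lra.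
Qed.

Lemma ge0_integral_reflect (c : R) (f : R -> \bar R) :
  measurable_fun setT f -> (forall t, 0 <= f t) ->
  \int[lebesgue_measure]_t f (c - t)%R = \int[lebesgue_measure]_t f t.
Proof.
move=> mf f0.
rewrite -[LHS]/(\int[lebesgue_measure]_t (f \o (fun t => c - t)%R) t).
have h := @ge0_integral_pushforward _ _ (measurableTypeR R) (measurableTypeR R)
  R _ (measurable_reflect c) lebesgue_measure setT f measurableT mf.
rewrite preimage_setT in h; rewrite -h//.
apply: eq_measure_integral; first exact: measurable_reflect.
by move=> ? A mA _; exact: lebesgue_measure_reflect.
Qed.

Lemma measurable_rV_reflect n (c : 'rV[R]_n) :
  measurable_fun [set: 'rV[R]_n] (fun y => c - y)%R.
Proof.
apply/measurable_fun_rVP => i; under eq_fun do rewrite !mxE.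
apply: measurable_funB => //; exact: measurable_coord_rV.
Qed.

(** Reflections are the only change of variables that is proved directly: two of them compose to a
    translation, and c = 0 gives z -> - z. The induction holds because a section of the reflected
    set is the reflection of a section. *)
Lemma lebesgue_rV_reflect n (c : 'rV[R]_n) (A : set 'rV[R]_n) : measurable A ->
  lebesgue_rV n ((fun y => c - y)%R @^-1` A) = lebesgue_rV n A.
Proof.
elim: n c A => [|n IH] c A mA.
  rewrite (_ : _ @^-1` A = A)//; apply/funext => y /=.
  by rewrite (_ : c - y = y)%R//; apply/rowP => -[].
have mcons B : measurable B -> measurable (@cons_rV R n @^-1` B).
  by move=> mB; rewrite -[X in measurable X]setTI; exact: measurable_cons_rV.
have mpre : measurable ((fun y => c - y)%R @^-1` A).
  by rewrite -[X in measurable X]setTI; exact: measurable_rV_reflect.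
pose F t := lebesgue_rV n (xsection (@cons_rV R n @^-1` A) t).
rewrite -[RHS]/(\int[lebesgue_measure]_t F t).
rewrite -(@ge0_integral_reflect (c 0 ord0)%R); last 2 first.
- apply: measurable_fun_xsection; exact: mcons.
- by move=> t; exact: measure_ge0.
apply: eq_integral => t _; rewrite /F -(IH (\row_j c 0 (lift ord0 j))%R); last first.
  apply: measurable_xsection; exact: mcons.
congr (lebesgue_rV n _).
suff E v : (c - cons_rV (t, v) = cons_rV (c 0 ord0 - t, \row_j c 0 (lift ord0 j) - v))%R.
  by apply/seteqP; split=> v; rewrite /xsection /= !in_setE/= E.
apply/rowP => i; rewrite [LHS]mxE mxE.
by case: (unliftP ord0 i) => [j|] ->; rewrite ?cons_rV0 ?cons_rVS //= !mxE.
Qed.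

Lemma lebesgue_rV_box n (a b : 'I_n -> R) : (forall i, a i <= b i)%R ->
  lebesgue_rV n [set x | forall i, (a i < x 0 i <= b i)%R]
  = (\prod_i (b i - a i))%:E.
Proof.
elim: n a b => [|n IH] a b ab.
  rewrite big_ord0 /= diracE mem_set//=. by move=> [].
rewrite /= /lebesgue_rV_step /pushforward.
pose B := [set x : 'rV[R]_n | forall i, (a (lift ord0 i) < x 0 i <= b (lift ord0 i))%R].
transitivity ((lebesgue_measure \x lebesgue_rV n) (`](a ord0), (b ord0)]%classic `*` B)).
  congr (_ _); apply/seteqP; split=> -[t v] /=.
    move=> h; split=> [|i]; last by have := h (lift ord0 i); rewrite cons_rVS.
    by have := h ord0; rewrite cons_rV0 /= in_itv.
  move=> [h0 h1] i; case: (unliftP ord0 i) => [j|] -> /=; rewrite ?cons_rVS//.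
  by rewrite cons_rV0; rewrite in_itv in h0.
rewrite product_measure1E//; last first.
    rewrite (_ : B = \bigcap_(i in [set: 'I_n]) (fun x => x 0 i)%R @^-1`
      `](a (lift ord0 i)), (b (lift ord0 i))]%classic).
      apply: fin_bigcap_measurable => // i _; rewrite -[X in measurable X]setTI.
      exact: measurable_coord_rV.
    by apply/seteqP; split=> x /= h => [i _|i]; move: (h i); rewrite /= in_itv/=; [exact|apply].
  rewrite IH; last by move=> i; exact: ab.
  rewrite [X in X * _](_ : _ = lebesgue_measure `](a ord0), (b ord0)]%classic)//.
  rewrite lebesgue_measure_itv/= lte_fin big_ord_recl EFinM.
  move: (ab ord0); rewrite le_eqVlt => /predU1P[->|->]; last by rewrite EFinB.
  by rewrite ltxx subrr.
Qed.

End lebesgue_rV_theory.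

(** * Euclidean norm and integrable functions *)

Section enorm_theory.
Context {R : realType} {n : nat}.
Implicit Types (x y z : 'rV[R]_n).

Definition dotv x y : R := \sum_i x 0 i * y 0 i.

Lemma dotvDl x y z : dotv (x + y) z = dotv x z + dotv y z.
Proof. by rewrite -big_split; apply: eq_bigr => i _; rewrite mxE mulrDl. Qed.

Lemma dotvZl a x z : dotv (a *: x) z = a * dotv x z.
Proof. by rewrite /dotv mulr_sumr; apply: eq_bigr => i _; rewrite mxE mulrA. Qed.

Lemma dotvC x y : dotv x y = dotv y x.
Proof. by apply: eq_bigr => i _; rewrite mulrC. Qed.

Lemma dotvZr a x z : dotv x (a *: z) = a * dotv x z.
Proof. by rewrite dotvC dotvZl dotvC. Qed.

Lemma dotvNr x z : dotv x (- z) = - dotv x z.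
Proof. by rewrite -scaleN1r dotvZr mulN1r. Qed.

Lemma dotvBl x y z : dotv (x - y) z = dotv x z - dotv y z.
Proof. by rewrite -scaleN1r dotvDl dotvZl mulN1r. Qed.

Lemma dotvv_ge0 x : 0 <= dotv x x.
Proof. by apply: sumr_ge0 => i _; rewrite -expr2 sqr_ge0. Qed.

Lemma enormE x : enorm x = Num.sqrt (dotv x x).
Proof. by []. Qed.

Lemma enorm_ge0 x : 0 <= enorm x. Proof. exact: sqrtr_ge0. Qed.

Lemma enorm_sqr x : enorm x ^+ 2 = dotv x x.
Proof. by rewrite enormE sqr_sqrtr// dotvv_ge0. Qed.

Lemma enorm_eq0 x : (enorm x == 0) = (x == 0).
Proof.
rewrite enormE sqrtr_eq0 le_eqVlt ltNge dotvv_ge0 orbF psumr_eq0; last first.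
  by move=> i _; rewrite -expr2 sqr_ge0.
apply/allP/eqP => [h|-> i _]; last by rewrite mxE mulr0 eqxx.
apply/rowP => i; rewrite mxE; have := h i (mem_index_enum _).
by rewrite mulf_eq0 orbb => /eqP.
Qed.

Lemma enorm0 : enorm (0 : 'rV[R]_n) = 0. Proof. by apply/eqP; rewrite enorm_eq0. Qed.

Lemma enorm_gt0 x : (0 < enorm x) = (x != 0).
Proof. by rewrite lt_def enorm_ge0 andbT enorm_eq0. Qed.

Lemma enormZ a x : enorm (a *: x) = `|a| * enorm x.
Proof.
by rewrite enormE dotvZl dotvZr mulrA -expr2 sqrtrM ?sqr_ge0// sqrtr_sqr.
Qed.

Lemma enormN x : enorm (- x) = enorm x.
Proof. by rewrite -scaleN1r enormZ normrN1 mul1r. Qed.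

Lemma enormB x y : enorm (x - y) = enorm (y - x).
Proof. by rewrite -enormN opprB. Qed.

Lemma dotv_le x y : `|dotv x y| <= enorm x * enorm y.
Proof.
rewrite -ler_sqr ?nnegrE ?mulr_ge0 ?enorm_ge0// real_normK ?num_real// exprMn.
have [->|y0] := eqVneq y 0.
  by rewrite (_ : dotv x 0 = 0) ?enorm0 ?expr0n /= ?mulr0// /dotv big1// => i _; rewrite mxE mulr0.
have B0 : 0 < enorm y ^+ 2 by rewrite exprn_gt0// enorm_gt0.
have := dotvv_ge0 (enorm y ^+ 2 *: x - dotv x y *: y).
rewrite dotvBl dotvZl dotvZl ![dotv _ (_ - _)]dotvC !dotvBl !dotvZl.
rewrite (dotvC y x) -!enorm_sqr.
set A := enorm x ^+ 2; set B := enorm y ^+ 2 in B0 *; set C := dotv x y.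
move=> h; rewrite -(ler_pM2l B0) -subr_ge0; apply: le_trans h _.
by rewrite le_eqVlt; apply/orP; left; apply/eqP; ring.
Qed.

Lemma enormD x y : enorm (x + y) <= enorm x + enorm y.
Proof.
rewrite -ler_sqr ?nnegrE ?addr_ge0 ?enorm_ge0// enorm_sqr dotvDl.
rewrite ![dotv _ (_ + _)]dotvC !dotvDl (dotvC y x) -!enorm_sqr sqrrD.
have := ler_norm (dotv x y); have := dotv_le x y; lra.
Qed.

Lemma enorm_sub_le x y : `|enorm x - enorm y| <= enorm (x - y).
Proof.
have h1 := enormD (x - y) y; have h2 := enormD (y - x) x.
rewrite !subrK (enormB y) in h1 h2.
by rewrite ler_norml; apply/andP; split; lra.
Qed.

Lemma coord_le_enorm x i : `|x 0 i| <= enorm x.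
Proof.
rewrite -ler_sqr ?nnegrE ?enorm_ge0// real_normK ?num_real// enorm_sqr.
rewrite /dotv (bigD1 i)//= -expr2 lerDl sumr_ge0// => j _.
by rewrite -expr2 sqr_ge0.
Qed.

Lemma enorm_le_sqrt x M : 0 <= M -> (forall i, `|x 0 i| <= M) ->
  enorm x <= Num.sqrt n%:R * M.
Proof.
move=> M0 xM; rewrite -ler_sqr ?nnegrE ?mulr_ge0 ?sqrtr_ge0 ?enorm_ge0//.
rewrite enorm_sqr exprMn sqr_sqrtr ?ler0n// /dotv.
have -> : n%:R * M ^+ 2 = \sum_(i < n) M ^+ 2.
  by rewrite sumr_const card_ord mulr_natl.
apply: ler_sum => i _; rewrite -expr2 -real_normK ?num_real//.
by rewrite ler_sqr ?nnegrE.
Qed.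

Lemma coord_le_mxnorm x i : `|x 0 i| <= `|x|.
Proof.
rewrite [leRHS]/Num.Def.normr /= mx_normrE; apply/bigmax_geP; right.
by exists (0, i).
Qed.

Lemma mxnorm_le x M : 0 <= M -> (forall i, `|x 0 i| <= M) -> `|x| <= M.
Proof.
move=> M0 h; rewrite [leLHS]/Num.Def.normr /= mx_normrE; apply/bigmax_leP; split=> //.
by move=> [i j] _; rewrite (ord1 i); exact: h.
Qed.

Lemma mxnorm_le_enorm x : `|x| <= enorm x.
Proof. by apply: mxnorm_le (enorm_ge0 _) (coord_le_enorm x). Qed.

Lemma enorm_le_mxnorm x : enorm x <= Num.sqrt n%:R * `|x|.
Proof. exact: enorm_le_sqrt (normr_ge0 _) (coord_le_mxnorm x). Qed.

Lemma cvg_enormP (T : Type) (F : set_system T) {FF : Filter F} (f : T -> 'rV[R]_n) y :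
  (forall e, 0 < e -> \forall t \near F, enorm (y - f t) < e) <-> f @ F --> y.
Proof.
split=> [h|].
  apply/cvgrPdist_lt => e e0; near=> t.
  by apply: le_lt_trans (mxnorm_le_enorm _) _; near: t; exact: h.
move=> /cvgrPdist_lt h e e0.
(* The added 1 keeps the factor positive when n = 0. *)
have c0 : 0 < Num.sqrt n%:R + 1 :> R by rewrite ltr_wpDl// sqrtr_ge0.
near=> t; apply: le_lt_trans (enorm_le_mxnorm _) _.
apply: (@le_lt_trans _ _ ((Num.sqrt n%:R + 1) * `|y - f t|)).
  by rewrite ler_wpM2r// lerDl.
rewrite -ltr_pdivlMl// mulrC; near: t; apply: h.
by rewrite divr_gt0.
Unshelve. all: by end_near. Qed.

Lemma continuous_enorm : continuous (@enorm R n).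
Proof.
move=> x; apply/(cvgrPdist_lt (FF := nbhs_filter x)) => e e0.
have := (@cvg_enormP _ _ (nbhs_filter x) id x).2 cvg_id e e0.
by apply: (@filterS _ _ (nbhs_filter x)) => y; apply: le_lt_trans; exact: enorm_sub_le.
Qed.

Lemma measurable_enorm : measurable_fun [set: 'rV[R]_n] (@enorm R n).
Proof. by apply: continuous_measurable_rV openT _ => x _; exact: continuous_enorm. Qed.

End enorm_theory.

Section summable_rV.
Context {R : realType} {n : nat}.
Implicit Types (f g : 'rV[R]_n -> R) (c : 'rV[R]_n).
Local Notation mu := (@lebesgue_rV R n).

Definition summ f : Prop := mu.-integrable setT (EFin \o f).

Definition rint f : R := \int[mu]_z f z.

Lemma summ_measurable f : summ f -> measurable_fun setT f.
Proof. by move=> /integrableP[/measurable_EFinP]. Qed.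

Lemma summD f g : summ f -> summ g -> summ (fun z => f z + g z).
Proof.
move=> sf sg; rewrite /summ (_ : _ \o _ = (fun z => (f z)%:E + (g z)%:E)%E)//.
exact: (@integrableD _ _ _ mu setT measurableT (EFin \o f) (EFin \o g)).
Qed.

Lemma summZ a f : summ f -> summ (fun z => a * f z).
Proof.
move=> sf; rewrite /summ (_ : _ \o _ = fun z => (a%:E * (EFin \o f) z)%E)//.
exact: integrableZl.
Qed.

Lemma summN f : summ f -> summ (fun z => - f z).
Proof. by move=> /(summZ (-1)); under eq_fun do rewrite mulN1r. Qed.

Lemma summB f g : summ f -> summ g -> summ (fun z => f z - g z).
Proof. by move=> sf sg; apply: summD => //; exact: summN. Qed.

Lemma summ0 : summ (fun=> 0).
Proof. exact: integrable0. Qed.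

Lemma le_summ f g : measurable_fun setT f -> (forall z, `|f z| <= g z) ->
  summ g -> summ f.
Proof.
move=> mf fg sg; apply: le_integrable sg => //; first exact/measurable_EFinP.
by move=> z _ /=; rewrite lee_fin (le_trans (fg z))// ler_norm.
Qed.

Lemma summ_norm f : summ f -> summ (fun z => `|f z|).
Proof. exact: integrable_norm. Qed.

Lemma summM_bounded f g M : summ f -> measurable_fun setT g ->
  (forall z, `|g z| <= M) -> summ (fun z => g z * f z).
Proof.
move=> sf mg gM; apply: (@le_summ _ (fun z => M * `|f z|)).
- by apply: measurable_funM => //; exact: summ_measurable.
- by move=> z; rewrite normrM ler_wpM2r.
- exact/summZ/summ_norm.
Qed.

Lemma rintD f g : summ f -> summ g -> rint (fun z : 'rV[R]_n => f z + g z) = rint f + rint g.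
Proof. by move=> sf sg; exact: RintegralD. Qed.

Lemma rintB f g : summ f -> summ g -> rint (fun z : 'rV[R]_n => f z - g z) = rint f - rint g.
Proof. by move=> sf sg; exact: RintegralB. Qed.

Lemma rintZ a f : summ f -> rint (fun z => a * f z) = a * rint f.
Proof. by move=> sf; exact: RintegralZl. Qed.

Lemma rintN f : summ f -> rint (fun z => - f z) = - rint f.
Proof.
by move=> sf; rewrite -mulN1r -rintZ//; under [RHS]eq_Rintegral do rewrite mulN1r.
Qed.

Lemma le_rint f g : summ f -> summ g -> (forall z, f z <= g z) -> rint f <= rint g.
Proof. by move=> sf sg fg; apply: le_Rintegral => // z _. Qed.

Lemma rint_ge0 f : (forall z, 0 <= f z) -> 0 <= rint f.
Proof. by move=> f0; exact: Rintegral_ge0. Qed.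

Let reflect_pack (F : 'rV[R]_n -> \bar R) c : measurable_fun setT F ->
  (forall z, 0 <= F z)%E ->
  (\int[mu]_z F (c - z)%R = \int[mu]_z F z)%E.
Proof.
move=> mF F0.
have h := @ge0_integral_pushforward _ _ _ _ R _ (measurable_rV_reflect c) mu
  setT F measurableT mF.
rewrite preimage_setT in h; rewrite -[LHS]h//.
apply: eq_measure_integral; first exact: measurable_rV_reflect.
by move=> ? A mA _; exact: lebesgue_rV_reflect.
Qed.

Lemma integral_rV_reflect (F : 'rV[R]_n -> \bar R) c : measurable_fun setT F ->
  (\int[mu]_z F (c - z)%R = \int[mu]_z F z)%E.
Proof.
move=> mF; rewrite integralE [RHS]integralE; congr (_ - _)%E.
  rewrite -(reflect_pack c (measurable_funepos mF))//.
  by apply: eq_integral => z _; rewrite !funeposE.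
rewrite -(reflect_pack c (measurable_funeneg mF))//.
by apply: eq_integral => z _; rewrite !funenegE.
Qed.

Lemma rint_reflect f c : measurable_fun setT f -> rint (fun z : 'rV[R]_n => f (c - z)) = rint f.
Proof.
move=> mf; rewrite /rint /Rintegral.
by rewrite -(@integral_rV_reflect (EFin \o f) c)//; exact/measurable_EFinP.
Qed.

Lemma summ_reflect f c : summ f -> summ (fun z => f (c - z)).
Proof.
move=> /integrableP[/measurable_EFinP mf foo]; apply/integrableP; split.
  apply/measurable_EFinP.
  by apply: (measurableT_comp mf); exact: measurable_rV_reflect.
have := @integral_rV_reflect (fun z => `|f z|%:E) c.
rewrite /comp /= => ->//; apply/measurable_EFinP.
by apply: measurableT_comp mf.
Qed.

Lemma rint_opp f : measurable_fun setT f -> rint (fun z : 'rV[R]_n => f (- z)) = rint f.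
Proof.
by move=> mf; rewrite -[RHS](rint_reflect 0 mf); congr rint; apply/funext => z; rewrite sub0r.
Qed.

Lemma summ_opp f : summ f -> summ (fun z => f (- z)).
Proof. by move=> /(summ_reflect 0); under eq_fun do rewrite sub0r. Qed.

Lemma measurable_translate f c : measurable_fun setT f ->
  measurable_fun [set: 'rV[R]_n] (fun z : 'rV[R]_n => f (z + c)).
Proof.
move=> mf; apply: (measurableT_comp mf); apply/measurable_fun_rVP => i.
under eq_fun do rewrite mxE.
by apply: measurable_funD => //; exact: measurable_coord_rV.
Qed.

Lemma measurable_reflect_rV f c : measurable_fun setT f ->
  measurable_fun [set: 'rV[R]_n] (fun z : 'rV[R]_n => f (c - z)).
Proof. by move=> mf; apply: (measurableT_comp mf); exact: measurable_rV_reflect. Qed.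

Lemma rint_translate f c : measurable_fun setT f -> rint (fun z : 'rV[R]_n => f (z + c)) = rint f.
Proof.
move=> mf; rewrite -(rint_reflect 0 (measurable_translate c mf)).
rewrite -[RHS](rint_reflect c mf).
by congr rint; apply/funext => z; rewrite sub0r addrC.
Qed.

Lemma summ_translate f c : summ f -> summ (fun z : 'rV[R]_n => f (z + c)).
Proof.
move=> /(summ_reflect c)/summ_opp; apply: eq_integrable => // z _ /=.
by rewrite opprK addrC.
Qed.

Lemma rint_dominated (f_ : nat -> 'rV[R]_n -> R) f g :
  (forall k, measurable_fun setT (f_ k)) -> summ g ->
  (forall k z, `|f_ k z| <= g z) ->
  (forall z, f_ k z @[k --> \oo] --> f z) ->
  summ f /\ rint (f_ k) @[k --> \oo] --> rint f.
Proof.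
move=> mf sg fg ff.
have mF : measurable_fun setT f by apply: measurable_fun_cvg => // z _; exact: ff.
have [||||| sf _ cv] := @dominated_convergence _ _ _ mu setT measurableT
  (fun k => EFin \o f_ k) (EFin \o f) (EFin \o g).
- by move=> k; exact/measurable_EFinP.
- exact/measurable_EFinP.
- by apply: aeW => z _; apply/cvg_EFin; [exact: nearW|exact: ff].
- exact: sg.
- by apply: aeW => z k _ /=; rewrite lee_fin.
split=> //.
have sfk k : summ (f_ k) by apply: le_summ sg.
apply/fine_cvg; rewrite fineK//; exact: integrable_fin_num.
Qed.

End summable_rV.

(** * Integrals of powers of |z| by dyadic decomposition *)

Section dyadic.
Context {R : realType} {n : nat}.
Local Notation mu := (@lebesgue_rV R n).

Lemma measurable_enorm_ball (t : R) : measurable [set z : 'rV[R]_n | enorm z <= t].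
Proof.
rewrite (_ : [set _ | _] = @enorm R n @^-1` `]-oo, t]%classic); last first.
  by apply/seteqP; split=> z /=; rewrite in_itv.
by rewrite -[X in measurable X]setTI; exact: measurable_enorm.
Qed.

Lemma lebesgue_rV_ball_le (t : R) : 0 < t ->
  (mu [set z : 'rV[R]_n | (enorm z <= t)%R] <= ((4 * t) ^+ n)%:E)%E.
Proof.
move=> t0.
(* The half-side is 2 t rather than t because the box is open on the left, while the closed ball
   touches the faces at - t. *)
rewrite (_ : (4 * t) ^+ n = \prod_(i < n) (2 * t - (- (2 * t)))); last first.
  by rewrite prodr_const card_ord; congr (_ ^+ _); ring.
rewrite -(@lebesgue_rV_box R n (fun=> - (2 * t)) (fun=> 2 * t)); last by move=> _; lra.
apply: le_measure; rewrite ?inE; first exact: measurable_enorm_ball.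
  rewrite (_ : [set _ | _] = \bigcap_(i in [set: 'I_n]) (fun x => x 0 i)%R @^-1`
      `](- (2 * t)), (2 * t)]%classic).
    apply: fin_bigcap_measurable => // i _; rewrite -[X in measurable X]setTI.
    exact: measurable_coord_rV.
  by apply/seteqP; split=> x /= h => [i _|i]; move: (h i); rewrite /= in_itv/=; [exact|apply].
move=> z /= zt i; have := coord_le_enorm z i; rewrite ler_norml => /andP[h1 h2].
apply/andP; split; lra.
Qed.

(** f is dominated by the series of c_k times the indicator of the ball of radius t_k, whose measure
    is at most (4 t_k)^n; integrating term by term leaves a geometric series. Balls are used instead
    of shells since no disjointness is involved. *)
Lemma summ_dyadic (f : 'rV[R]_n -> R) (c t : nat -> R) (A q : R) :
  measurable_fun setT f -> (forall z, 0 <= f z) ->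
  (forall k, 0 <= c k) -> (forall k, 0 < t k) -> 0 <= q -> q < 1 ->
  (forall k, c k * (4 * t k) ^+ n <= A * q ^+ k) ->
  (forall z, f z = 0 \/ exists k, enorm z <= t k /\ f z <= c k) ->
  summ f /\ rint f <= A / (1 - q).
Proof.
move=> mf f0 c0 t0 q0 q1 cA fc.
have A0 : 0 <= A.
  by have := cA 0%N; rewrite expr0 mulr1; apply: le_trans; rewrite mulr_ge0// exprn_ge0// mulr_ge0// ltW.
pose F k z : \bar R := (c k * \1_[set z : 'rV[R]_n | enorm z <= t k] z)%:E.
have F0 k z : (0 <= F k z)%E by rewrite lee_fin mulr_ge0.
have mF k : measurable_fun [set: 'rV[R]_n] (F k).
  apply/measurable_EFinP/measurable_funM => //.
  by apply: measurable_indic; exact: measurable_enorm_ball.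
have fF z : ((f z)%:E <= \sum_(0 <= k <oo) F k z)%E.
  have [->|[k [zk fk]]] := fc z; first exact: nneseries_ge0.
  apply: le_trans (nneseries_lim_ge k.+1 _) => //.
  rewrite big_nat_recr//= -[leLHS]add0e; apply: leeD; first exact: sume_ge0.
  by rewrite lee_fin indicE mem_set// mulr1.
have le1 : (\int[mu]_z (f z)%:E <= (A / (1 - q))%:E)%E.
  apply: (@le_trans _ _ (\int[mu]_z (\sum_(0 <= k <oo) F k z))%E).
    apply: ge0_le_integral => //.
    - by move=> z _; rewrite lee_fin.
    - exact/measurable_EFinP.
    - exact: ge0_emeasurable_sum.
  rewrite integral_nneseries//.
  apply: lime_le.
    by apply: is_cvg_nneseries => k _ _; exact: integral_ge0.
  apply: nearW => m.
  have step k : (\int[mu]_z F k z <= (A * q ^+ k)%:E)%E.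
    rewrite /F; under eq_integral do rewrite EFinM.
    rewrite ge0_integralZl//; last 2 first.
    - apply/measurable_EFinP/measurable_indic; exact: measurable_enorm_ball.
    - by rewrite lee_fin.
    rewrite integral_indic//; last exact: measurable_enorm_ball.
    rewrite setIT.
    apply: (@le_trans _ _ ((c k)%:E * ((4 * t k) ^+ n)%:E)%E); last by rewrite lee_fin.
    by apply: lee_wpmul2l; rewrite ?lee_fin//; exact: lebesgue_rV_ball_le.
  apply: (@le_trans _ _ (\sum_(0 <= k < m) (A * q ^+ k)%:E)%E).
    by apply: lee_sum => k _; exact: step.
  rewrite sumEFin lee_fin.
  have -> : \sum_(0 <= k < m) A * q ^+ k = A * (1 - q ^+ m) / (1 - q).
    have := @geometric_seriesE R A q (negbT (lt_eqF q1)).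
    by move=> /(congr1 (fun u => u m)); rewrite /series/=.
  rewrite ler_pM2r ?invr_gt0 ?subr_gt0// ler_piMr// gerBl exprn_ge0//.
have sf : summ f.
  apply/integrableP; split; first exact/measurable_EFinP.
  under eq_integral => z _ do rewrite /= ger0_norm//.
  by apply: le_lt_trans le1 _; rewrite ltry.
split=> //; rewrite -lee_fin /rint /Rintegral fineK//.
exact: integrable_fin_num.
Qed.

Let dyadic_scale (x : R) : 1 <= x -> exists k : nat, 2 ^+ k <= x < 2 ^+ k.+1.
Proof.
move=> x1; have x0 : 0 <= x by lra.
have m0 : (0 < Num.truncn x)%N by rewrite truncn_ge_nat.
have /andP[h1 h2] := trunc_log_bounds (isT : (1 < 2)%N) m0.
exists (trunc_log 2 (Num.truncn x)); apply/andP; split.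
  by rewrite -natrX -truncn_ge_nat.
by rewrite -natrX; apply: lt_le_trans (truncnS_gt x) _; rewrite ler_nat.
Qed.

Lemma measurable_enorm_powR (p : R) :
  measurable_fun [set: 'rV[R]_n] (fun z => enorm z `^ p).
Proof.
by apply: (measurableT_comp (measurable_powR p)); exact: measurable_enorm.
Qed.

Let measurable_near (g rho : R) : measurable_fun [set: 'rV[R]_n]
  (fun z => if 0 < enorm z <= rho then enorm z `^ (g - n%:R) else 0).
Proof.
apply: measurable_fun_ifT => //.
  apply: measurable_and.
    apply: measurable_fun_ltr => //; exact: measurable_enorm.
  apply: measurable_fun_ler => //; exact: measurable_enorm.
exact: measurable_enorm_powR.
Qed.

Let powR2_gt1 (g : R) : 0 < g -> 1 < 2 `^ g.
Proof.
move=> g0; rewrite -[ltLHS](_ : 1 `^ g = 1); last by rewrite powR1.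
by apply: gt0_ltr_powR; rewrite ?nnegrE// ltr1n.
Qed.

(** Shells rho / 2^(k+1) < |z| <= rho / 2^k, with ratio 2^(-g). The constant C is chosen before rho:
    the exact homogeneity rho^g is what is compared with other powers of rho later on. *)
Lemma summ_powR_near (g : R) : 0 < g -> exists2 C, 0 < C & forall rho, 0 < rho ->
  let f (z : 'rV[R]_n) := if 0 < enorm z <= rho then enorm z `^ (g - n%:R) else 0 in
  summ f /\ rint f <= C * rho `^ g.
Proof.
move=> g0; pose q : R := 2 `^ (- g).
have q0 : 0 < q by rewrite powR_gt0.
have q1 : q < 1.
  by rewrite /q powRN invf_lt1 ?powR_gt0// powR2_gt1.
exists (8 ^+ n / (1 - q)); first by rewrite divr_gt0 ?exprn_gt0// subr_gt0.
move=> rho r0 f.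
have p2 k : 0 < 2 ^+ k :> R by rewrite exprn_gt0.
(* On the k-th shell |z|^g is largest at the outer radius and |z|^(-n) at the inner one; the
   mismatch turns 4^n into 8^n. *)
pose c (k : nat) := (rho / 2 ^+ k) `^ g * (rho / 2 ^+ k.+1) ^- n.
rewrite (_ : _ * rho `^ g = (8 ^+ n * rho `^ g) / (1 - q)); last by rewrite mulrAC.
apply: (@summ_dyadic f c (fun k => rho / 2 ^+ k)) => //.
- exact: measurable_near.
- by move=> z; rewrite /f; case: ifP => // _; exact: powR_ge0.
- by move=> k; rewrite mulr_ge0 ?powR_ge0// invr_ge0 exprn_ge0// ltW// divr_gt0.
- by move=> k; rewrite divr_gt0.
- exact: ltW.
- move=> k; rewrite le_eqVlt; apply/orP; left; apply/eqP; rewrite /c.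
  have -> : q ^+ k = (2 ^+ k)^-1 `^ g.
    by rewrite /q -!powR_mulrn ?powR_ge0// -powRrM -powRN -powRrM; congr (_ `^ _); ring.
  rewrite powRM ?(ltW r0)// ?invr_ge0 ?exprn_ge0//.
  have -> : (4 * (rho / 2 ^+ k)) ^+ n = 8 ^+ n * (rho / 2 ^+ k.+1) ^+ n.
    by rewrite -exprMn; congr (_ ^+ _); rewrite exprS; field; rewrite gt_eqF.
  by field; rewrite expf_neq0// gt_eqF// divr_gt0.
- move=> z; rewrite /f; case: ifPn => [/andP[z0 zr]|_]; last by left.
  right; have [|k /andP[k1 k2]] := dyadic_scale (_ : 1 <= rho / enorm z).
    by rewrite ler_pdivlMr// mul1r.
  exists k; move: k1 k2; rewrite ler_pdivlMr// ltr_pdivrMr// => k1 k2; split.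
    by rewrite ler_pdivlMr// mulrC.
  rewrite powRB; last by rewrite (gt_eqF z0) implybT.
  rewrite powR_mulrn ?enorm_ge0// /c /=. apply: ler_pM.
  + exact: powR_ge0.
  + by rewrite invr_ge0 exprn_ge0// ltW.
  + apply: ge0_ler_powR; rewrite ?nnegrE ?divr_ge0 ?enorm_ge0 ?(ltW r0) ?(ltW g0) ?exprn_ge0//.
    by rewrite ler_pdivlMr// mulrC.
  + rewrite lef_pV2 ?posrE ?exprn_gt0 ?divr_gt0//.
    apply: lerXn2r; rewrite ?nnegrE ?divr_ge0 ?enorm_ge0 ?(ltW r0) ?exprn_ge0//.
    by rewrite ler_pdivrMr// mulrC ltW.
Qed.

Lemma summ_powR_far (g r : R) : g < 0 -> 0 < r ->
  summ (fun z : 'rV[R]_n => if r < enorm z then enorm z `^ (g - n%:R) else 0).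
Proof.
move=> g0 r0; pose q : R := 2 `^ g.
have q0 : 0 < q by rewrite powR_gt0.
have q1 : q < 1.
  by rewrite /q -[g]opprK powRN invf_lt1 ?powR_gt0// powR2_gt1// oppr_gt0.
have p2 k : 0 < 2 ^+ k :> R by rewrite exprn_gt0.
(* With g < 0 both factors are largest at the inner radius of the shell, whereas the enclosing ball
   has the outer radius r 2^(k+1). *)
pose c (k : nat) := (r * 2 ^+ k) `^ g * (r * 2 ^+ k) ^- n.
set f := (X in summ X).
suff [] : summ f /\ rint f <= 8 ^+ n * r `^ g / (1 - q) by [].
apply: (@summ_dyadic f c (fun k => r * 2 ^+ k.+1)) => //.
- apply: measurable_fun_ifT => //.
    apply: measurable_fun_ltr => //; exact: measurable_enorm.
  exact: measurable_enorm_powR.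
- by move=> z; rewrite /f; case: ifP => // _; exact: powR_ge0.
- by move=> k; rewrite mulr_ge0 ?powR_ge0// invr_ge0 exprn_ge0// ltW// mulr_gt0.
- by move=> k; rewrite mulr_gt0.
- exact: ltW.
- move=> k; rewrite le_eqVlt; apply/orP; left; apply/eqP; rewrite /c.
  have -> : q ^+ k = (2 ^+ k) `^ g.
    by rewrite /q -powR_mulrn ?powR_ge0// -powRrM mulrC powRrM powR_mulrn.
  rewrite powRM ?(ltW r0)// ?exprn_ge0//.
  have -> : (4 * (r * 2 ^+ k.+1)) ^+ n = 8 ^+ n * (r * 2 ^+ k) ^+ n.
    by rewrite -exprMn; congr (_ ^+ _); rewrite exprS; ring.
  by field; rewrite expf_neq0// gt_eqF// mulr_gt0.
- move=> z; rewrite /f; case: ifPn => [zr|_]; last by left.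
  right; have [|k /andP[k1 k2]] := dyadic_scale (_ : 1 <= enorm z / r).
    by rewrite ler_pdivlMr// mul1r ltW.
  have z0 : 0 < enorm z := lt_trans r0 zr.
  exists k; move: k1 k2; rewrite ler_pdivlMr// ltr_pdivrMr// => k1 k2; split.
    by rewrite mulrC ltW.
  rewrite powRB; last by rewrite (gt_eqF z0) implybT.
  rewrite powR_mulrn ?enorm_ge0// /c /=. apply: ler_pM.
  + exact: powR_ge0.
  + by rewrite invr_ge0 exprn_ge0// ltW.
  + rewrite -[g]opprK powRN [leRHS]powRN lef_pV2 ?posrE ?powR_gt0 ?mulr_gt0//.
    apply: ge0_ler_powR; rewrite ?oppr_ge0 ?nnegrE ?mulr_ge0 ?enorm_ge0 ?(ltW r0) ?(ltW g0) ?exprn_ge0//.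
    by rewrite mulrC.
  + rewrite lef_pV2 ?posrE ?exprn_gt0 ?mulr_gt0//.
    apply: lerXn2r; rewrite ?nnegrE ?mulr_ge0 ?enorm_ge0 ?(ltW r0) ?exprn_ge0//.
    by rewrite mulrC.
Qed.

End dyadic.

(** * Segment averages and integration by parts *)

Section seg_avg_theory.
Context {R : realType}.

(** The integrals over [tau, 1 + tau] and [0, 1] differ by the one over [1, 1 + tau] minus the one
    over [0, tau]; each is evaluated by the mean value theorem for a primitive. *)
Lemma integral_shift (g : R -> R) (tau : R) : continuous g -> 0 <= tau <= 1 ->
  exists c1 c2, [/\ 1 <= c1 <= 1 + tau, 0 <= c2 <= tau &
   \int[@lebesgue_measure R]_(t in `[0, 1]) g (t + tau)
   - \int[@lebesgue_measure R]_(t in `[0, 1]) g t = tau * (g c1 - g c2)].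
Proof.
move=> cg /andP[t0 t1].
(* Starting at -1 and stopping at 3 makes every point that occurs, between 0 and 2, interior. *)
pose A (x : R) : R := \int[@lebesgue_measure R]_(t in `[-1, x]) g t.
have gi : (@lebesgue_measure R).-integrable `[-1, 3] (EFin \o g).
  apply: continuous_compact_integrable; first exact: segment_compact.
  exact: continuous_subspaceT.
have dA (x : R) : x \in `]-1, 3[ -> is_derive x 1 A (g x).
  rewrite in_itv/= => /andP[x1 x3].
  have [d1 d2] := @continuous_FTC1_closed R g (-1) x 3 x3 gi x1 (cg x).
  by apply: DeriveDef; [exact: d1|rewrite -derive1E; exact: d2].
have cA (x : R) : x \in `]-1, 3[ -> {for x, continuous A}.
  by move=> /dA /@ex_derive /derivable1_diffP /differentiable_continuous.
have key (s : R) : 0 <= s <= 1 ->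
    \int[@lebesgue_measure R]_(t in `[0, 1]) g (t + s) = A (1 + s) - A s.
  move=> /andP[s0 s1]; rewrite /Rintegral.
  have aux (x : R) : x \in `[0, 1] -> x + s \in `]-1, 3[.
    by rewrite !in_itv/= => /andP[x0 x1]; apply/andP; split; lra.
  have cs (x : R) : {for x, continuous (fun t : R => t + s)}.
    by apply: cvgD; [exact: cvg_id|exact: cvg_cst].
  have cAs (x : R) : x \in `[0, 1] -> {for x, continuous (A \o (fun t => t + s))}.
    by move=> x01; apply: continuous_comp; [exact: cs|exact/cA/aux].
  have dAs (x : R) : x \in `[0, 1] -> is_derive x 1 (A \o (fun t => t + s)) (g (x + s)).
    move=> x01; have := dA _ (aux _ x01) => dx.
    have := @is_derive1_comp R A (fun t => t + s) x _ _ dx (is_deriveD (is_derive_id x 1) (is_derive_cst s x 1)).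
    by rewrite addr0 mulr1.
  rewrite (@continuous_FTC2 R (fun t => g (t + s)) (A \o (fun t => t + s)) 0 1)//=.
  - by rewrite add0r.
  - apply: continuous_subspaceT => x.
    by apply: (@continuous_comp _ _ _ (fun t => t + s) g); [exact: cs|exact: cg].
  - split.
    + move=> x /subset_itv_oo_cc x01; exact: (@ex_derive _ _ _ _ _ _ _ (dAs x x01)).
    + apply: cvg_at_right_filter; apply: cAs; rewrite in_itv/= lexx ler01//.
    + apply: cvg_at_left_filter; apply: cAs; rewrite in_itv/= lexx ler01//.
  - move=> x x01; rewrite derive1E; exact: (@derive_val _ _ _ _ _ _ _ (dAs x (subset_itv_oo_cc x01))).
have mvt (a b : R) : -1 < a -> a <= b -> b < 3 ->
    exists2 c, a <= c <= b & A b - A a = g c * (b - a).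
  move=> a1 ab b3.
  have sub x : x \in `[a, b] -> x \in `]-1, 3[.
    by rewrite !in_itv/= => /andP[x0 x1]; apply/andP; split; lra.
  have dab x : x \in `]a, b[ -> is_derive x 1 A (g x).
    by move=> /subset_itv_oo_cc /sub; exact: dA.
  have cab : {within `[a, b], continuous A}.
    by apply: continuous_in_subspaceT => x; rewrite inE/= => /sub; exact: cA.
  by have [c] := MVT_segment ab dab cab; rewrite in_itv/=; exists c.
have := key 0; rewrite lexx ler01 !addr0 => /(_ isT).
under eq_Rintegral do rewrite addr0.
move=> ->; rewrite key ?t0//.
have [|||c1 h1 E1] := mvt 1 (1 + tau); try lra.
have [|||c2 h2 E2] := mvt 0 tau; try lra.
exists c1, c2; split=> //.
by rewrite mulrBr; move: E1 E2; rewrite subr0 => E1 E2; lra.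
Qed.

Context {n : nat}.
Implicit Types (u : 'rV[R]_n -> R) (h x y : 'rV[R]_n).

Lemma continuous_line x h : continuous (fun t : R => x + t *: h).
Proof.
by move=> t; apply: cvgD; [exact: cvg_cst|apply: cvgZl; exact: cvg_id].
Qed.

Lemma seg_avg_shift u h y (tau : R) : continuous u -> 0 <= tau <= 1 ->
  exists c1 c2, [/\ 1 <= c1 <= 1 + tau, 0 <= c2 <= tau &
   seg_avg h u (y + tau *: h) - seg_avg h u y =
   tau * (u (y + c1 *: h) - u (y + c2 *: h))].
Proof.
move=> cu t01.
have cg : continuous (fun t : R => u (y + t *: h)).
  by move=> t; apply: continuous_comp; [exact: continuous_line|exact: cu].
have [c1 [c2 [h1 h2 E]]] := integral_shift cg t01.
exists c1, c2; split=> //; rewrite -E; congr (_ - _).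
by apply: eq_Rintegral => t _; rewrite -addrA -scalerDl addrC [tau + t]addrC -addrC.
Qed.

Lemma seg_avg_diff_le u h y (B tau : R) : continuous u -> 0 <= tau <= 1 ->
  (forall x, `|u x| <= B) ->
  `|seg_avg h u (y + tau *: h) - seg_avg h u y| <= 2 * B * tau.
Proof.
move=> cu t01 uB; have [c1 [c2 [_ _ ->]]] := seg_avg_shift h y cu t01.
case/andP: t01 => t0 _.
rewrite normrM (ger0_norm t0) mulrC ler_wpM2r//.
have := ler_normB (u (y + c1 *: h)) (u (y + c2 *: h)).
have := uB (y + c1 *: h); have := uB (y + c2 *: h); lra.
Qed.

(** The two intermediate points of [seg_avg_shift] tend to 1 and 0, so continuity of u suffices.
    Only the steps 1/(k+1) are considered, as the dominated convergence below is sequential. *)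
Lemma seg_avg_diff_cvg u h y : continuous u ->
  (seg_avg h u (y + (k.+1%:R^-1 : R) *: h) - seg_avg h u y) / k.+1%:R^-1
  @[k --> \oo] --> u (y + h) - u y.
Proof.
move=> cu.
have t01 k : 0 <= (k.+1%:R^-1 : R) <= 1.
  by rewrite invr_ge0 ler0n/= invf_le1 ?ler1n.
have /choice[c hc] : forall k, exists c : R * R, [/\ 1 <= c.1 <= 1 + k.+1%:R^-1,
   0 <= c.2 <= k.+1%:R^-1 & seg_avg h u (y + (k.+1%:R^-1 : R) *: h) - seg_avg h u y =
   k.+1%:R^-1 * (u (y + c.1 *: h) - u (y + c.2 *: h))].
  move=> k; have [c1 [c2 H]] := seg_avg_shift h y cu (t01 k).
  by exists (c1, c2).
have cg : continuous (fun t : R => u (y + t *: h)).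
  by move=> t; apply: continuous_comp; [exact: continuous_line|exact: cu].
have c1 : (c k).1 @[k --> \oo] --> (1 : R).
  apply: (@squeeze_cvgr _ _ _ _ (cst 1) (fun k => 1 + k.+1%:R^-1)).
  - by apply: nearW => k; have [] := hc k.
  - exact: cvg_cst.
  - rewrite -[X in _ --> X]addr0; apply: cvgD; [exact: cvg_cst|exact: cvg_harmonic].
have c2 : (c k).2 @[k --> \oo] --> (0 : R).
  apply: (@squeeze_cvgr _ _ _ _ (cst 0) (fun k => k.+1%:R^-1)).
  - by apply: nearW => k; have [] := hc k.
  - exact: cvg_cst.
  - exact: cvg_harmonic.
under eq_cvg => k.
  have [_ _ ->] := hc k.
  rewrite [X in X / _]mulrC mulfK; last by rewrite invr_eq0 pnatr_eq0.
  over.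
have := cvg_comp _ _ c1 (cg 1); rewrite /= scale1r => l1.
have := cvg_comp _ _ c2 (cg 0); rewrite /= scale0r addr0 => l2.
exact: cvgB l1 l2.
Qed.

End seg_avg_theory.

Section parts.
Context {R : realType} {n : nat}.
Implicit Types (u G : 'rV[R]_n -> R) (h x y : 'rV[R]_n).

Let lebesgue01 : @lebesgue_measure R `[0%R, 1%R] = 1%E.
Proof. by rewrite lebesgue_measure_itv/= lte_fin ltr01 oppr0 adde0. Qed.

Lemma integrable_line u x h : continuous u ->
  (@lebesgue_measure R).-integrable `[0, 1] (EFin \o (fun t : R => u (x + t *: h))).
Proof.
move=> cu; apply: continuous_compact_integrable; first exact: segment_compact.
apply: continuous_subspaceT => t.
by apply: (@continuous_comp _ _ _ (fun t : R => x + t *: h) u); [exact: continuous_line|exact: cu].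
Qed.

Lemma seg_avg_cst h (c : R) : seg_avg h (fun=> c) = fun=> c.
Proof.
apply/funext => x; rewrite /seg_avg Rintegral_cst//.
by rewrite [X in fine X]lebesgue01 mulr1.
Qed.

Lemma seg_avg_le u h x (B : R) : continuous u -> (forall x, `|u x| <= B) ->
  `|seg_avg h u x| <= B.
Proof.
move=> cu uB; have iu := integrable_line x h cu.
apply: le_trans (le_normr_Rintegral _ iu) _ => //.
rewrite -[leRHS](_ : seg_avg h (fun=> B) x = B); last by rewrite seg_avg_cst.
apply: le_Rintegral => //; first exact: integrable_norm.
exact: (@integrable_line (fun=> B) x h (@cst_continuous _ _ B)).
Qed.

(** For a positive step t, translation invariance moves the difference quotient from the average to
    G exactly. Then t tends to 0 on both sides by dominated convergence, with majorants 2 B |G| and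
    B H; H is the assumed summable bound on the difference quotients of G. *)
Lemma rint_by_parts u G (G' H : 'rV[R]_n -> R) h (B tau0 : R) :
  continuous u -> (forall x, `|u x| <= B) -> measurable_fun setT (seg_avg h u) ->
  summ G -> summ H -> 0 < tau0 ->
  (forall y tau, 0 < tau <= tau0 -> `|G (y - tau *: h) - G y| <= tau * H y) ->
  (forall y, (G (y - (k.+1%:R^-1 : R) *: h) - G y) / k.+1%:R^-1 @[k --> \oo]
     --> - G' y) ->
  rint (fun y => G y * (u (y + h) - u y)) = - rint (fun y => G' y * seg_avg h u y).
Proof.
move=> cu uB mU sG sH t0 GH GG'; set U := seg_avg h u in mU *.
have B0 : 0 <= B by apply: le_trans (uB 0).
(* Shifting the sequence of steps by k0 brings all of them into the range where H dominates. *)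
have [k0 hk0] : exists k0 : nat, forall k, ((k + k0).+1%:R^-1 : R) <= tau0.
  exists (Num.truncn tau0^-1) => k.
  rewrite -[leRHS]invrK lef_pV2 ?posrE ?invr_gt0 ?ltr0n//.
  by apply: le_trans (ltW (truncnS_gt _)) _; rewrite ler_nat ltnS leq_addl.
pose t (k : nat) : R := (k + k0).+1%:R^-1.
have tp k : 0 < t k by rewrite invr_gt0.
have t1 k : t k <= 1 by rewrite invf_le1 ?ler1n.
pose f k y := G y * ((U (y + t k *: h) - U y) / t k).
pose g k y := ((G (y - t k *: h) - G y) / t k) * U y.
have mG := summ_measurable sG.
have mu_ : measurable_fun [set: 'rV[R]_n] u.
  by apply: continuous_measurable_rV openT _ => x _; exact: cu.
have UB y : `|U y| <= B by exact: seg_avg_le.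
have mf k : measurable_fun setT (f k).
  apply: measurable_funM => //; apply: measurable_funM => //.
  by apply: measurable_funB => //; exact: measurable_translate.
have mg k : measurable_fun setT (g k).
  apply: measurable_funM => //; apply: measurable_funM => //.
  by apply: measurable_funB => //; exact: measurable_translate.
have [_ fl] : summ (fun y => G y * (u (y + h) - u y)) /\
    rint (f k) @[k --> \oo] --> rint (fun y => G y * (u (y + h) - u y)).
  apply: (@rint_dominated _ _ f _ (fun y => 2 * B * `|G y|)) => //.
  - exact/summZ/summ_norm.
  - move=> k y; rewrite normrM mulrC ler_wpM2r// normrM normfV (gtr0_norm (tp k)).
    rewrite ler_pdivrMr//; apply: seg_avg_diff_le => //.
    by rewrite ltW// t1.
  - move=> y; apply: cvgMr.
    by have := @seg_avg_diff_cvg _ _ u h y cu; rewrite -(cvg_shiftn k0).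
have [sg gl] : summ (fun y => - G' y * U y) /\ rint (g k) @[k --> \oo] --> rint (fun y => - G' y * U y).
  apply: (@rint_dominated _ _ g _ (fun y => B * H y)) => //.
  - exact/summZ.
  - move=> k y; rewrite normrM mulrC ler_pM// normrM normfV (gtr0_norm (tp k)).
    by rewrite ler_pdivrMr// mulrC GH// tp hk0.
  - move=> y; apply: cvgMl.
    by have := GG' y; rewrite -(cvg_shiftn k0).
have fg k : rint (f k) = rint (g k).
  have sGU : summ (fun y => U y / t k * G y).
    by apply: (@summM_bounded _ _ _ _ (B / t k)) => //; [exact: measurable_funM|];
      move=> y; rewrite normrM normfV (gtr0_norm (tp k)) ler_pM2r ?invr_gt0.
  have sGU' : summ (fun y => U (y + t k *: h) / t k * G y).
    apply: (@summM_bounded _ _ _ _ (B / t k)) => //.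
      by apply: measurable_funM => //; exact: measurable_translate.
    by move=> y; rewrite normrM normfV (gtr0_norm (tp k)) ler_pM2r ?invr_gt0.
  have sG'U : summ (fun y => U y / t k * G (y - t k *: h)).
    have := summ_translate (- (t k *: h)) sGU'.
    by under eq_fun do rewrite subrK.
  rewrite (_ : f k = fun y => U (y + t k *: h) / t k * G y - U y / t k * G y); last first.
    by apply/funext => y; rewrite /f; ring.
  rewrite (_ : g k = fun y => U y / t k * G (y - t k *: h) - U y / t k * G y); last first.
    by apply/funext => y; rewrite /g; ring.
  rewrite !rintB//; congr (_ - _).
  rewrite -(rint_translate (- (t k *: h)) (summ_measurable sGU')).
  by congr rint; apply/funext => y; rewrite subrK.
rewrite -(funext fg) in gl.
rewrite (@cvg_unique _ (@Rhausdorff R) _ _ _ _ fl gl) -rintN; last first.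
  by move: (summN sg); under eq_fun do rewrite mulNr opprK.
by congr rint; apply/funext => y; rewrite mulNr.
Qed.

(** Integration by parts against the constant function 1, which is its own average. *)
Lemma rint_deriv_eq0 G (G' H : 'rV[R]_n -> R) h (tau0 : R) :
  summ G -> summ H -> 0 < tau0 ->
  (forall y tau, 0 < tau <= tau0 -> `|G (y - tau *: h) - G y| <= tau * H y) ->
  (forall y, (G (y - (k.+1%:R^-1 : R) *: h) - G y) / k.+1%:R^-1 @[k --> \oo]
     --> - G' y) ->
  rint G' = 0.
Proof.
move=> sG sH t0 GH GG'.
have h1 (x : 'rV[R]_n) : `|(1 : R)| <= 1 by rewrite normr1.
have c1 : continuous (fun _ : 'rV[R]_n => 1 : R) by exact: cst_continuous.
have m1 : measurable_fun [set: 'rV[R]_n] (seg_avg h (fun=> (1 : R))).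
  by rewrite seg_avg_cst; exact: measurable_cst.
have := rint_by_parts c1 h1 m1 sG sH t0 GH GG'.
rewrite seg_avg_cst (_ : (fun y => G y * (1 - 1)) = fun=> 0 * 0); last first.
  by apply/funext => y; rewrite subrr !mulr0.
rewrite rintZ; last exact: summ0.
rewrite mul0r (_ : (fun y => G' y * 1) = G'); last by apply/funext => y; rewrite mulr1.
by move=> /eqP; rewrite eq_sym oppr_eq0 => /eqP.
Qed.

(** Since G' has integral 0, a constant may be subtracted from the average. With c its value at the
    base point, the increments weighted by sigma appear. *)
Lemma rint_by_parts_cst u G (G' H : 'rV[R]_n -> R) h (B tau0 c : R) :
  continuous u -> (forall x, `|u x| <= B) -> measurable_fun setT (seg_avg h u) ->
  summ G -> summ H -> summ G' -> 0 < tau0 ->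
  (forall y tau, 0 < tau <= tau0 -> `|G (y - tau *: h) - G y| <= tau * H y) ->
  (forall y, (G (y - (k.+1%:R^-1 : R) *: h) - G y) / k.+1%:R^-1 @[k --> \oo]
     --> - G' y) ->
  rint (fun y => G y * (u (y + h) - u y)) = rint (fun y => G' y * (c - seg_avg h u y)).
Proof.
move=> cu uB mU sG sH sG' t0 GH GG'.
rewrite (rint_by_parts cu uB mU sG sH t0 GH GG').
have sGU : summ (fun y => G' y * seg_avg h u y).
  under eq_fun do rewrite mulrC; apply: (@summM_bounded _ _ _ _ B) => // y.
  exact: seg_avg_le.
rewrite [in RHS](_ : (fun y => _) = fun y => c * G' y - G' y * seg_avg h u y); last first.
  by apply/funext => y; rewrite mulrBr mulrC.
rewrite rintB//; last exact: summZ.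
by rewrite rintZ// (rint_deriv_eq0 sG sH t0 GH GG') mulr0 sub0r.
Qed.

End parts.

Section directional.
Context {R : realType} {n : nat}.
Implicit Types (u G : 'rV[R]_n -> R) (h v x y z : 'rV[R]_n).

Lemma is_derive_line G x v (s d : R) : is_derive (x + s *: v) v G d ->
  is_derive s 1 (fun t : R => G (x + t *: v)) d.
Proof.
move=> [dG dE].
have E : (fun t : R => t^-1 *: (((fun t : R => G (x + t *: v)) \o shift s) (t *: (1 : R))
    - G (x + s *: v))) =
    (fun t : R => t^-1 *: ((G \o shift (x + s *: v)) (t *: v) - G (x + s *: v))).
  apply/funext => t /=; congr (_ *: (G _ - _)).
  by rewrite scalerDl -!scalerA scale1r addrCA.
by split; [rewrite /derivable E|rewrite /derive E].
Qed.

Lemma is_derive_diff_quot G x v d : is_derive x v G d ->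
  (G (x + (k.+1%:R^-1 : R) *: v) - G x) / k.+1%:R^-1 @[k --> \oo] --> d.
Proof.
move=> [dG dE].
have : t^-1 *: ((G \o shift x) (t *: v) - G x) @[t --> 0^'] --> d.
  by rewrite -dE; exact: dG.
move=> /cvg_dnbhs_at_right /cvg_at_rightP /(_ (fun k => k.+1%:R^-1)) cv.
have {cv} : (k.+1%:R^-1)^-1 *: ((G \o shift x) ((k.+1%:R^-1 : R) *: v) - G x) @[k --> \oo] --> d.
  by apply: cv; split=> [k|]; [rewrite invr_gt0|exact: cvg_harmonic].
apply: cvg_trans; apply: near_eq_cvg; apply: nearW => k /=.
by rewrite [x + _]addrC /GRing.scale/= mulrC.
Qed.

Lemma is_derive_reflect (f : 'rV[R]_n -> R) y z v (d : R) :
  is_derive (y - z) (- v) f d -> is_derive z v (fun z => f (y - z)) d.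
Proof.
move=> [d1 d2].
have EE : (fun t : R => t^-1 *: (((fun z => f (y - z)) \o shift z) (t *: v) - f (y - z)))
  = (fun t : R => t^-1 *: ((f \o shift (y - z)) (t *: - v) - f (y - z))).
  by apply/funext => t /=; rewrite opprD addrCA scalerN.
by split; [rewrite /derivable EE|rewrite /derive EE].
Qed.

Lemma derive_gradient u x v : differentiable u x -> 'D_v u x = dotv (gradient u x) v.
Proof.
move=> du; rewrite deriveE// {1}(row_sum_delta v) linear_sum /dotv.
apply: eq_bigr => i _; rewrite linearZ/= mxE -deriveE// mulrC.
by [].
Qed.

Lemma mvt_line G (G' : 'rV[R]_n -> R) x v (s : R) : 0 <= s ->
  (forall t : R, 0 <= t <= s -> is_derive (x + t *: v) v G (G' (x + t *: v))) ->
  exists2 t, 0 <= t <= s & G (x + s *: v) - G x = s * G' (x + t *: v).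
Proof.
move=> s0 dG.
have dg t : 0 <= t <= s -> is_derive t 1 (fun t : R => G (x + t *: v)) (G' (x + t *: v)).
  by move=> ts; apply: is_derive_line; exact: dG.
have d1 t : t \in `]0, s[ -> is_derive t 1 (fun t : R => G (x + t *: v)) (G' (x + t *: v)).
  by rewrite in_itv/= => /andP[/ltW a /ltW b]; apply: dg; rewrite a.
have cg : {within `[0, s], continuous (fun t : R => G (x + t *: v))}.
  apply: continuous_in_subspaceT => t; rewrite inE/= in_itv/= => /dg.
  by move=> /@ex_derive /derivable1_diffP /differentiable_continuous.
have [t] := MVT_segment s0 d1 cg.
by rewrite in_itv/= subr0 scale0r addr0 mulrC; exists t.
Qed.

End directional.

Section parts_kernel.
Context {R : realType} {n : nat}.
Implicit Types (u G : 'rV[R]_n -> R) (h v x y z : 'rV[R]_n).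

(** Model for a kernel truncated at r; the exponent is written relative to -n, so that it is
    summable for g < 0, and g = - 2 s is the case of K. *)
Definition tailw (g r : R) (z : 'rV[R]_n) : R :=
  if r < enorm z then enorm z `^ (g - n%:R) else 0.

Lemma tailw_ge0 g r z : 0 <= tailw g r z.
Proof. by rewrite /tailw; case: ifP => // _; exact: powR_ge0. Qed.

Lemma le_powR_neg (p a b : R) : p <= 0 -> 0 < a -> a <= b -> b `^ p <= a `^ p.
Proof.
move=> p0 a0 ab; rewrite -[p]opprK powRN [leRHS]powRN.
rewrite lef_pV2 ?posrE ?powR_gt0 ?(lt_le_trans a0 ab)//.
by apply: ge0_ler_powR; rewrite ?nnegrE ?oppr_ge0 ?(ltW a0)// (le_trans (ltW a0) ab).
Qed.

(** If |y| > r then |z - y| < |y|/2, so r/2 < |z| <= 3|y|/2. This yields one summable majorant for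
    all small translates of the weight. *)
Lemma tailw_shift g r z y : g < 0 -> 0 < r -> enorm (z - y) <= r / 2 ->
  tailw g r y <= (2 / 3) `^ (g - n%:R) * tailw g (r / 2) z.
Proof.
move=> g0 r0 zy; rewrite {1}/tailw; case: ifPn => [ry|_]; last first.
  by rewrite mulr_ge0 ?powR_ge0 ?tailw_ge0.
have h1 := enorm_sub_le z y; rewrite ler_norml in h1.
move/andP: h1 => [h1 h2].
have zr : r / 2 < enorm z by lra.
rewrite /tailw zr -powRM ?enorm_ge0 ?divr_ge0//.
apply: le_powR_neg; first by have : 0 <= n%:R :> R by []; lra.
  by rewrite mulr_gt0//; lra.
by lra.
Qed.

(** Integration by parts for z -> u(x - z) in the direction - h, with the abstract majorant made
    concrete: the mean value theorem bounds the difference quotients of G by G' at a nearby point,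
    and [tailw_shift] moves that bound back to the original point. *)
Lemma rint_by_parts_kernel u G (G' : 'rV[R]_n -> R) h x (B C g r c : R) :
  continuous u -> (forall x, `|u x| <= B) -> measurable_fun setT (seg_avg h u) ->
  measurable_fun setT G -> g < 0 -> 0 < r ->
  (forall z, is_derive z h G (G' z)) ->
  (forall z, `|G z| <= C * tailw g r z) -> (forall z, `|G' z| <= C * tailw g r z) ->
  summ G' /\
  rint (fun z => G z * (u (x - z + h) - u (x - z))) =
  rint (fun z => G' z * (seg_avg h u (x - z) - c)).
Proof.
move=> cu uB mU mG g0 r0 dG Gle G'le.
have st : summ (tailw g r) by exact: summ_powR_far.
have st2 : summ (tailw g (r / 2)) by apply: summ_powR_far => //; rewrite divr_gt0.
have dq z : (G (z + (k.+1%:R^-1 : R) *: h) - G z) / k.+1%:R^-1 @[k --> \oo] --> G' z.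
  exact: is_derive_diff_quot.
(* Measurability of G' comes from its being a pointwise limit of difference quotients. *)
have mG' : measurable_fun setT G'.
  apply: (@measurable_fun_cvg _ _ _ _ (fun k z => (G (z + (k.+1%:R^-1 : R) *: h) - G z) / k.+1%:R^-1)).
    move=> k; apply: measurable_funM => //; apply: measurable_funB => //.
    exact: measurable_translate.
  by move=> z _; exact: dq.
have sG : summ G by apply: le_summ Gle _ => //; exact: summZ.
have sG' : summ G' by apply: le_summ G'le _ => //; exact: summZ.
split=> //.
pose ut z := u (x - z).
have cut : continuous ut.
  have cr : continuous (fun z : 'rV[R]_n => x - z).
    move=> z; have FF := @nbhs_filter _ z.
    exact: (@cvgB _ _ _ (nbhs z) FF (fun=> x) id x z (cvg_cst _) cvg_id).
  by move=> z; apply: continuous_comp; [exact: cr|exact: cu].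
have utB z : `|ut z| <= B by exact: uB.
have savg z : seg_avg (- h) ut z = seg_avg h u (x - z).
  by apply: eq_Rintegral => t _; rewrite /ut scalerN opprB addrCA [t *: h + _]addrC.
have mut : measurable_fun setT (seg_avg (- h) ut).
  by rewrite (funext savg); exact: measurable_reflect_rV.
pose H z := `|C| * ((2 / 3) `^ (g - n%:R) * tailw g (r / 2) z).
have sH : summ H by apply: summZ; exact: summZ.
have [tau0 t0 ht0] : exists2 tau0 : R, 0 < tau0 & tau0 * enorm h <= r / 2.
  exists (r / 2 / (enorm h + 1)).
    by rewrite !divr_gt0// ltr_wpDl// enorm_ge0.
  rewrite mulrAC ler_pdivrMr; last by rewrite ltr_wpDl// enorm_ge0.
  by rewrite ler_pM2l ?divr_gt0// lerDl.
have GH y tau : 0 < tau <= tau0 -> `|G (y - tau *: - h) - G y| <= tau * H y.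
  move=> /andP[tp tt]; rewrite scalerN opprK.
  have [s /andP[s0 s1] ->] := @mvt_line _ _ G G' y h tau (ltW tp) (fun t _ => dG _).
  rewrite normrM (gtr0_norm tp) ler_pM2l//.
  apply: le_trans (G'le _) _; rewrite /H.
  apply: (@le_trans _ _ (`|C| * tailw g r (y + s *: h))).
    by rewrite ler_wpM2r ?tailw_ge0// ler_norm.
  rewrite ler_wpM2l//; apply: tailw_shift => //.
  rewrite opprD addNKr enormN enormZ (ger0_norm s0).
  by apply: le_trans ht0; rewrite ler_wpM2r ?enorm_ge0// (le_trans s1).
have GG' y : (G (y - (k.+1%:R^-1 : R) *: - h) - G y) / k.+1%:R^-1 @[k --> \oo] --> - - G' y.
  rewrite opprK; apply: cvg_trans (dq y); apply: near_eq_cvg.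
  by apply: nearW => k /=; rewrite scalerN opprK.
have := @rint_by_parts_cst _ _ ut G (fun z => - G' z) H (- h) B tau0 c cut utB mut sG sH (summN sG') t0 GH GG'.
rewrite /ut => E; rewrite (_ : (fun z => G z * _) = (fun y => G y * (u (x - (y - h)) - u (x - y)))); last first.
  by apply/funext => z; rewrite opprB addrCA [h + _]addrC.
rewrite E; congr rint; apply/funext => z.
by rewrite -/ut savg; ring.
Qed.

End parts_kernel.

(** * Hölder regularity *)

Section regularity.
Context {R : realType} {n : nat}.
Implicit Types (u f : 'rV[R]_n -> R) (h v x y z : 'rV[R]_n).

(* For exponents a <= 1 this is the C^(2a) condition at x, in a form stable
   under products and averages. *)
Definition reg_at (a : R) f x (C : R) : Prop := forall z, enorm z <= 1 ->
  `|f (x + z) - f x| <= C * enorm z `^ a /\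
  `|f (x + z) + f (x - z) - 2 * f x| <= C * (enorm z `^ a) ^+ 2.

Definition reg a f : Prop := forall x, exists C, reg_at a f x C.

(** One constant per ball: the average at x involves f along the whole segment from x to x + h. *)
Definition regl a f : Prop := forall r, exists C, forall x, enorm x <= r ->
  reg_at a f x C.

Lemma regl_reg a f : regl a f -> reg a f.
Proof. by move=> h x; have [C hC] := h (enorm x); exists C; exact: hC. Qed.

Lemma reg_continuous a f : 0 < a -> reg a f -> continuous f.
Proof.
move=> a0 rf x; have [C hC] := rf x.
have FF := @nbhs_filter _ x.
apply/(cvgrPdist_lt (FF := FF)) => e e0.
have C1 : 0 < `|C| + 1 by rewrite ltr_wpDl.
pose d := Num.min 1 ((e / (`|C| + 1)) `^ a^-1).
have d0 : 0 < d by rewrite lt_min ltr01 powR_gt0// divr_gt0.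
have := (@cvg_enormP _ _ _ _ FF id x).2 cvg_id d d0.
apply: (@filterS _ _ FF) => y /=; rewrite lt_min => /andP[y1 yd].
have yx1 : enorm (y - x) <= 1 by rewrite enormB ltW.
have [+ _] := hC _ yx1.
rewrite [x + _]addrC subrK distrC => /le_lt_trans; apply.
apply: (@le_lt_trans _ _ (`|C| * enorm (y - x) `^ a)).
  by rewrite ler_wpM2r ?powR_ge0// ler_norm.
apply: (@lt_le_trans _ _ ((`|C| + 1) * (e / (`|C| + 1)))); last first.
  by rewrite mulrC divfK ?gt_eqF.
have : enorm (y - x) `^ a < e / (`|C| + 1).
  rewrite -[ltRHS](_ : ((e / (`|C| + 1)) `^ a^-1) `^ a = _); last first.
    by rewrite -powRrM mulVf ?gt_eqF// powRr1// divr_ge0// ltW.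
  by apply: gt0_ltr_powR; rewrite ?nnegrE ?enorm_ge0 ?powR_ge0// enormB.
move=> h1; apply: (@le_lt_trans _ _ ((`|C| + 1) * enorm (y - x) `^ a)).
  by rewrite ler_wpM2r ?powR_ge0// lerDl.
by rewrite ltr_pM2l.
Qed.

Lemma reg_measurable a f : 0 < a -> reg a f -> measurable_fun setT f.
Proof.
move=> a0 rf; apply: continuous_measurable_rV openT _ => y _.
exact: (reg_continuous a0 rf).
Qed.

Lemma reg_at_le a f x C C' : reg_at a f x C -> C <= C' -> reg_at a f x C'.
Proof.
move=> rf CC z z1; have [h1 h2] := rf z z1; split.
  by apply: le_trans h1 _; rewrite ler_wpM2r ?powR_ge0.
by apply: le_trans h2 _; rewrite ler_wpM2r ?sqr_ge0.
Qed.

Lemma regD a f g : reg a f -> reg a g -> reg a (fun x => f x + g x).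
Proof.
move=> rf rg x; have [C hC] := rf x; have [D hD] := rg x.
exists (C + D) => z z1; have [h1 h2] := hC z z1; have [h3 h4] := hD z z1.
split.
  rewrite opprD addrACA mulrDl; apply: le_trans (ler_normD _ _) _; exact: lerD.
rewrite (_ : _ - _ =
  (f (x + z) + f (x - z) - 2 * f x) + (g (x + z) + g (x - z) - 2 * g x)); last by ring.
rewrite [leRHS]mulrDl; apply: le_trans (ler_normD _ _) _. exact: lerD.
Qed.

Lemma regZ a c f : reg a f -> reg a (fun x => c * f x).
Proof.
move=> rf x; have [C hC] := rf x.
exists (`|c| * C) => z z1; have [h1 h2] := hC z z1; split.
  by rewrite -mulrBr normrM -mulrA ler_wpM2l.
rewrite (_ : _ - _ = c * (f (x + z) + f (x - z) - 2 * f x)); last by ring.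
by rewrite normrM -mulrA ler_wpM2l.
Qed.

Let powR_le1 a z : 0 <= a -> enorm z <= 1 -> enorm z `^ a <= 1.
Proof.
move=> a0 z1; rewrite -[leRHS](_ : 1 `^ a = 1); last by rewrite powR1.
by apply: ge0_ler_powR; rewrite ?nnegrE ?enorm_ge0.
Qed.

Lemma regM a f g : 0 <= a -> reg a f -> reg a g -> reg a (fun x => f x * g x).
Proof.
move=> a0 rf rg x; have [C hC] := rf x; have [D hD] := rg x.
pose F := `|f x|; pose G := `|g x|.
exists (F * `|D| + G * `|C| + 2 * (`|C| * `|D|)) => z z1.
have [f1 f2] := reg_at_le hC (ler_norm C) z1; have [g1 g2] := reg_at_le hD (ler_norm D) z1.
have nz1 : enorm (- z) <= 1 by rewrite enormN.
have [f3 _] := reg_at_le hC (ler_norm C) nz1; have [g3 _] := reg_at_le hD (ler_norm D) nz1.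
rewrite enormN in f3 g3.
have d1 := powR_le1 a0 z1; have d0 := powR_ge0 (enorm z) a.
set d := enorm z `^ a in f1 f2 f3 g1 g2 g3 d0 d1 *.
have F0 : 0 <= F by exact: normr_ge0. have G0 : 0 <= G by exact: normr_ge0.
have CD : 0 <= `|C| * `|D| by rewrite mulr_ge0.
have m1 : `|f (x + z) - f x| * `|g (x + z) - g x| <= `|C| * `|D| * d ^+ 2.
  by rewrite expr2 mulrACA ler_pM.
have m2 : `|f (x - z) - f x| * `|g (x - z) - g x| <= `|C| * `|D| * d ^+ 2.
  by rewrite expr2 mulrACA ler_pM.
have dd : d ^+ 2 <= d by rewrite expr2 ler_piMr.
split.
  rewrite (_ : _ - _ = f x * (g (x + z) - g x) + g x * (f (x + z) - f x)
    + (f (x + z) - f x) * (g (x + z) - g x)); last by ring.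
  apply: le_trans (ler_normD _ _) _; apply: le_trans (lerD (ler_normD _ _) (lexx _)) _.
  rewrite !normrM -/F -/G.
  have t1 : F * `|g (x + z) - g x| <= F * (`|D| * d) by rewrite ler_wpM2l.
  have t2 : G * `|f (x + z) - f x| <= G * (`|C| * d) by rewrite ler_wpM2l.
  have t3 : `|C| * `|D| * d ^+ 2 <= `|C| * `|D| * d by rewrite ler_wpM2l.
  have t4 : 0 <= `|C| * `|D| * d by rewrite mulr_ge0.
  by rewrite !mulrDl -!mulrA; rewrite -!mulrA in m1 t3 t4; lra.
rewrite (_ : _ - _ = f x * (g (x + z) + g (x - z) - 2 * g x)
   + g x * (f (x + z) + f (x - z) - 2 * f x)
   + (f (x + z) - f x) * (g (x + z) - g x)
   + (f (x - z) - f x) * (g (x - z) - g x)); last by ring.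
apply: le_trans (ler_normD _ _) _; apply: le_trans (lerD (ler_normD _ _) (lexx _)) _.
apply: le_trans (lerD (lerD (ler_normD _ _) (lexx _)) (lexx _)) _.
rewrite !normrM -/F -/G.
have t1 : F * `|g (x + z) + g (x - z) - 2 * g x| <= F * (`|D| * d ^+ 2) by rewrite ler_wpM2l.
have t2 : G * `|f (x + z) + f (x - z) - 2 * f x| <= G * (`|C| * d ^+ 2) by rewrite ler_wpM2l.
clear -m1 m2 t1 t2. lra.
Qed.

(** The square of the positive part is C^{1,1} with derivative 2 s_+, while s_+ is merely Lipschitz.
    Hence the later arguments ask for regularity of P^2 and never of P. *)
Lemma pos_part_sqr (s t : R) :
  `|pos_part (s + t) ^+ 2 - pos_part s ^+ 2 - 2 * pos_part s * t| <= t ^+ 2.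
Proof.
rewrite /pos_part; case: (ltP (s + t) 0) => h1; case: (ltP s 0) => h2;
  rewrite ler_norml; apply/andP; split; nra.
Qed.

Lemma reg_pos_sqr a f : 0 <= a -> reg a f -> reg a (fun x => pos_part (f x) ^+ 2).
Proof.
move=> a0 rf x; have [C hC] := rf x.
pose P := pos_part (f x); pose F := `|P|.
exists (2 * F * `|C| + 2 * `|C| ^+ 2) => z z1.
have [f1 f2] := reg_at_le hC (ler_norm C) z1.
have nz1 : enorm (- z) <= 1 by rewrite enormN.
have [f3 _] := reg_at_le hC (ler_norm C) nz1.
rewrite enormN in f3.
have d1 := powR_le1 a0 z1; have d0 := powR_ge0 (enorm z) a.
set d := enorm z `^ a in f1 f2 f3 d0 d1 *.
have F0 : 0 <= F by exact: normr_ge0.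
have dd : d ^+ 2 <= d by rewrite expr2 ler_piMr.
have sq t : `|t| <= `|C| * d -> t ^+ 2 <= `|C| ^+ 2 * d ^+ 2.
  by move=> h; rewrite -exprMn -real_normK ?num_real// ler_sqr ?nnegrE ?mulr_ge0.
have s1 := sq _ f1; have s2 := sq _ f3.
have p1 := pos_part_sqr (f x) (f (x + z) - f x).
have p2 := pos_part_sqr (f x) (f (x - z) - f x).
rewrite ![f x + _]addrC !subrK in p1 p2.
have CC : 0 <= `|C| ^+ 2 by rewrite exprn_ge0.
rewrite -/P in p1 p2 *.
split.
  rewrite (_ : _ - _ = (pos_part (f (x + z)) ^+ 2 - P ^+ 2 - 2 * P * (f (x + z) - f x))
     + 2 * (P * (f (x + z) - f x))); last by ring.
  apply: le_trans (ler_normD _ _) _.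
  rewrite [X in _ + X]normrM normrM -/F (ger0_norm (_ : 0 <= 2))//.
  have t1 : F * `|f (x + z) - f x| <= F * (`|C| * d) by rewrite ler_wpM2l.
  have t3 : `|C| ^+ 2 * d ^+ 2 <= `|C| ^+ 2 * d by rewrite ler_wpM2l.
  have t4 : 0 <= `|C| ^+ 2 * d by rewrite mulr_ge0.
  clear -p1 t1 t3 t4 s1; lra.
rewrite (_ : _ - _ = (pos_part (f (x + z)) ^+ 2 - P ^+ 2 - 2 * P * (f (x + z) - f x))
   + (pos_part (f (x - z)) ^+ 2 - P ^+ 2 - 2 * P * (f (x - z) - f x))
   + 2 * (P * (f (x + z) + f (x - z) - 2 * f x))); last by ring.
apply: le_trans (ler_normD _ _) _; apply: le_trans (lerD (ler_normD _ _) (lexx _)) _.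
rewrite [X in _ + X]normrM normrM -/F (ger0_norm (_ : 0 <= 2))//.
have t1 : F * `|f (x + z) + f (x - z) - 2 * f x| <= F * (`|C| * d ^+ 2) by rewrite ler_wpM2l.
clear -p1 p2 s1 s2 t1; lra.
Qed.

End regularity.

(** * From local Hölder classes to bounds on second differences *)

Section holder_regularity.
Context {R : realType} {n : nat}.
Implicit Types (u f : 'rV[R]_n -> R) (h v x y z : 'rV[R]_n).

Let ball_convex (r : R) x y (t : R) : enorm x <= r -> enorm y <= r -> 0 <= t <= 1 ->
  enorm (y + t *: (x - y)) <= r.
Proof.
move=> xr yr /andP[t0 t1].
rewrite (_ : _ + _ = t *: x + (1 - t) *: y); last first.
  by rewrite scalerBr scalerBl scale1r addrCA.
apply: le_trans (enormD _ _) _; rewrite !enormZ (ger0_norm t0) ger0_norm; last by lra.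
have h1 : t * enorm x <= t * r by rewrite ler_wpM2l.
have h2 : (1 - t) * enorm y <= (1 - t) * r by rewrite ler_wpM2l// subr_ge0.
lra.
Qed.

Lemma differentiable_is_derive u x v : differentiable u x ->
  is_derive x v u (dotv (gradient u x) v).
Proof.
move=> du; split; last exact: derive_gradient.
exact: diff_derivable.
Qed.

Lemma Ckb_loc_bounded (b : R) u : 0 < b -> Ckb_loc 0 b u ->
  forall r, exists M, forall x, enorm x <= r -> `|u x| <= M.
Proof.
move=> b0 ub r; have [C hC] := ub r.
exists (`|u 0| + `|C| * r `^ b) => x xr.
have r0 : 0 <= r by apply: le_trans xr; exact: enorm_ge0.
have := hC x 0 xr; rewrite enorm0 => /(_ r0); rewrite subr0 => h1.
rewrite -[u x](subrK (u 0)) addrC; apply: le_trans (ler_normD _ _) _.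
rewrite lerD2l; apply: le_trans h1 _; apply: (@le_trans _ _ (`|C| * enorm x `^ b)).
  by rewrite ler_wpM2r ?powR_ge0// ler_norm.
by rewrite ler_wpM2l// ge0_ler_powR ?nnegrE ?enorm_ge0// ltW.
Qed.

Lemma gradient_bounded u (b : R) : 0 < b ->
  (forall i, Ckb_loc 0 b ('D_(delta_mx 0 i) u)) ->
  forall r, exists2 M, 0 <= M & forall x, enorm x <= r -> enorm (gradient u x) <= M.
Proof.
move=> b0 hb r.
have /choice[M hM] : forall i, exists M, forall x, enorm x <= r -> `|'D_(delta_mx 0 i) u x| <= M.
  by move=> i; apply: (Ckb_loc_bounded b0 (hb i)).
pose m := \sum_i `|M i|.
have m0 : 0 <= m by apply: sumr_ge0.
exists (Num.sqrt n%:R * m); first by rewrite mulr_ge0 ?sqrtr_ge0.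
move=> x xr; apply: enorm_le_sqrt => // i; rewrite mxE.
apply: le_trans (hM i x xr) _; apply: le_trans (ler_norm _) _.
by rewrite /m (bigD1 i)//= lerDl sumr_ge0.
Qed.

Lemma Ckb_loc_lip u (b : R) : 0 < b -> (forall x, differentiable u x) ->
  (forall i, Ckb_loc 0 b ('D_(delta_mx 0 i) u)) -> Ckb_loc 0 1 u.
Proof.
move=> b0 du hb r; have [M M0 hM] := gradient_bounded b0 hb r.
exists M => x y xr yr; rewrite powRr1 ?enorm_ge0//.
have [|t t01 E] := @mvt_line _ _ u (fun z => dotv (gradient u z) (x - y)) y (x - y) 1 ler01.
  by move=> t _; exact: differentiable_is_derive.
rewrite scale1r [y + (x - y)]addrC subrK mul1r in E; rewrite E.
apply: le_trans (dotv_le _ _) _; rewrite ler_wpM2r ?enorm_ge0//.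
by apply: hM; exact: ball_convex.
Qed.

Lemma Ckb_loc_down k (b : R) u : 0 < b -> Ckb_loc k.+1 b u -> Ckb_loc k 1 u.
Proof.
move=> b0; elim: k u => [|k IH] u [du hb]; first exact: (Ckb_loc_lip b0).
by split=> // i; apply: IH; exact: hb.
Qed.

Lemma Ckb_loc_C11 k (b : R) u : 0 < b -> Ckb_loc k.+2 b u -> Ckb_loc 1 1 u.
Proof.
elim: k b => [|k IH] b b0 hb; first exact: Ckb_loc_down hb.
by apply: (IH 1) => //; exact: Ckb_loc_down hb.
Qed.

Let powR_half (d a b : R) : 0 <= d <= 1 -> 0 < a -> a <= b -> d `^ b <= d `^ a.
Proof.
move=> /andP[]; rewrite le_eqVlt => /predU1P[<- _ a0 ab|d0 d1 a0 ab].
  by rewrite !powR0// gt_eqF// (lt_le_trans a0).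
by apply: ger_powR => //; rewrite d0.
Qed.

Lemma powR_sqr (d a : R) : 0 <= d -> (d `^ a) ^+ 2 = d `^ (2 * a).
Proof. by move=> d0; rewrite -powR_mulrn ?powR_ge0// -powRrM mulrC. Qed.

(** The exponent is halved because second differences have to be of order |z|^(2a), and here the
    triangle inequality gives them only order |z|^b. *)
Lemma Ckb_loc0_regl (b : R) u : 0 < b -> b <= 1 -> Ckb_loc 0 b u -> regl (b / 2) u.
Proof.
move=> b0 b1 ub r; have [C hC] := ub (r + 1); exists (2 * `|C|) => x xr z z1.
have z01 : 0 <= enorm z <= 1 by rewrite enorm_ge0.
have x1 : enorm x <= r + 1 by apply: le_trans xr _; rewrite lerDl.
have xz y : enorm y <= 1 -> enorm (x + y) <= r + 1.
  by move=> y1; apply: le_trans (enormD _ _) _; exact: lerD.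
have key y : enorm y = enorm z -> `|u (x + y) - u x| <= `|C| * enorm z `^ b.
  move=> yz; apply: le_trans (hC _ _ (xz y _) x1) _; first by rewrite yz.
  by rewrite addrAC subrr add0r yz ler_wpM2r ?powR_ge0// ler_norm.
split.
  apply: le_trans (key z erefl) _; apply: (@le_trans _ _ (`|C| * enorm z `^ (b / 2))).
    by rewrite ler_wpM2l// powR_half// ?divr_gt0//; lra.
  by rewrite ler_wpM2r ?powR_ge0//; have := normr_ge0 C; lra.
rewrite powR_sqr ?enorm_ge0// (_ : 2 * (b / 2) = b); last by lra.
have := key z erefl; have := key (- z) (enormN z) => k1 k2.
rewrite (_ : _ - _ = (u (x + z) - u x) + (u (x - z) - u x)); last by ring.
by apply: le_trans (ler_normD _ _) _; rewrite -mulrA; lra.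
Qed.

(** The mean value theorem applied to u(x + y) + u(x - y) along z turns the second difference into a
    difference of gradients at x + t z and x - t z, paired with z: order |z|^(1 + b). *)
Lemma Ckb_loc1_regl (b : R) u : 0 < b -> b <= 1 -> Ckb_loc 1 b u -> regl ((1 + b) / 2) u.
Proof.
move=> b0 b1 [du hb] r; have [C hC] := Ckb_loc_lip b0 du hb (r + 1).
have /choice[D hD] : forall i, exists D, forall x y, enorm x <= r + 1 -> enorm y <= r + 1 ->
    `|'D_(delta_mx 0 i) u x - 'D_(delta_mx 0 i) u y| <= D * enorm (x - y) `^ b.
  by move=> i; exact: hb.
pose m := \sum_i `|D i|.
have m0 : 0 <= m by apply: sumr_ge0.
have s0 : 0 <= Num.sqrt n%:R :> R by exact: sqrtr_ge0.
have C0 := normr_ge0 C.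
have K0 : 0 <= Num.sqrt n%:R * (2 * m) by rewrite mulr_ge0 ?mulr_ge0.
exists (`|C| + Num.sqrt n%:R * (2 * m)) => x xr z z1.
have z01 : 0 <= enorm z <= 1 by rewrite enorm_ge0.
have x1 : enorm x <= r + 1 by apply: le_trans xr _; rewrite lerDl.
have xz y : enorm y <= 1 -> enorm (x + y) <= r + 1.
  by move=> y1; apply: le_trans (enormD _ _) _; exact: lerD.
split.
  apply: le_trans (hC _ _ (xz z z1) x1) _.
  rewrite addrAC subrr add0r; apply: (@le_trans _ _ (`|C| * enorm z `^ 1)).
    by rewrite ler_wpM2r ?powR_ge0// ler_norm.
  apply: (@le_trans _ _ (`|C| * enorm z `^ ((1 + b) / 2))).
    by rewrite ler_wpM2l// powR_half//; lra.
  by rewrite ler_wpM2r ?powR_ge0// lerDl.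
rewrite powR_sqr ?enorm_ge0// (_ : 2 * ((1 + b) / 2) = 1 + b); last by lra.
pose g (y : 'rV[R]_n) := dotv (gradient u (x + y) - gradient u (x - y)) z.
have dG (t : R) : 0 <= t <= 1 ->
  is_derive (0 + t *: z) z (fun y => u (x + y) + u (x - y)) (g (0 + t *: z)).
  move=> _; rewrite add0r /g dotvBl.
  have E1 : is_derive (t *: z) z (fun y => u (x + y)) (dotv (gradient u (x + t *: z)) z).
    have [d1 d2] := differentiable_is_derive z (du (x + t *: z)).
    have E : (fun s : R => s^-1 *: (((fun y => u (x + y)) \o shift (t *: z)) (s *: z) - u (x + t *: z)))
      = (fun s : R => s^-1 *: ((u \o shift (x + t *: z)) (s *: z) - u (x + t *: z))).
      by apply/funext => s /=; rewrite addrCA.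
    by split; [rewrite /derivable E|rewrite /derive E].
  have E2 : is_derive (t *: z) z (fun y => u (x - y)) (- dotv (gradient u (x - t *: z)) z).
    have [d1 d2] := differentiable_is_derive (- z) (du (x - t *: z)).
    rewrite dotvNr in d2.
    have E : (fun s : R => s^-1 *: (((fun y => u (x - y)) \o shift (t *: z)) (s *: z) - u (x - t *: z)))
      = (fun s : R => s^-1 *: ((u \o shift (x - t *: z)) (s *: - z) - u (x - t *: z))).
      by apply/funext => s /=; rewrite opprD addrCA scalerN.
    by split; [rewrite /derivable E|rewrite /derive E].
  exact: is_deriveD.
have [t /andP[t0 t1]] := @mvt_line _ _ _ g 0 z 1 ler01 dG.
rewrite scale1r !add0r !addr0 subr0 mul1r => E.
rewrite (_ : _ - _ = u (x + z) + u (x - z) - (u x + u x)); last by ring.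
rewrite E /g; apply: le_trans (dotv_le _ _) _.
have tz1 : enorm (t *: z) <= 1.
  by rewrite enormZ (ger0_norm t0) mulr_ile1 ?enorm_ge0.
have tz2 : enorm (- (t *: z)) <= 1 by rewrite enormN.
have hg : enorm (gradient u (x + t *: z) - gradient u (x - t *: z))
    <= Num.sqrt n%:R * (m * (2 * enorm z `^ b)).
  apply: enorm_le_sqrt => [|i]; first by rewrite !mulr_ge0 ?powR_ge0.
  rewrite !mxE; apply: le_trans (hD i _ _ (xz _ tz1) (xz _ tz2)) _.
  rewrite opprD opprK addrACA subrr add0r -scalerDl.
  apply: (@le_trans _ _ (m * enorm ((t + t) *: z) `^ b)).
    rewrite ler_wpM2r ?powR_ge0//; apply: le_trans (ler_norm _) _.
    by rewrite /m (bigD1 i)//= lerDl sumr_ge0.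
  rewrite ler_wpM2l// enormZ powRM ?enorm_ge0// ler_wpM2r ?powR_ge0//.
  rewrite ger0_norm; last by lra.
  apply: (@le_trans _ _ (2 `^ b)).
    by apply: ge0_ler_powR; rewrite ?nnegrE//; lra.
  by rewrite -[leRHS]powRr1//; apply: ler_powR => //; rewrite ler1n.
apply: le_trans (ler_wpM2r (enorm_ge0 _) hg) _.
have -> : enorm z `^ (1 + b) = enorm z `^ b * enorm z.
  have [z0|z0] := eqVneq (enorm z) 0.
    by rewrite z0 mulr0 powR0// gt_eqF//; lra.
  by rewrite addrC powRD ?powRr1 ?enorm_ge0// z0 implybT.
have zz : 0 <= enorm z `^ b * enorm z by rewrite mulr_ge0 ?powR_ge0 ?enorm_ge0.
rewrite -[leLHS]add0r [leRHS]mulrDl; apply: lerD; first by rewrite mulr_ge0.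
by rewrite le_eqVlt; apply/orP; left; apply/eqP; ring.
Qed.

(** The point is a > s: it makes |z|^(2a) K(z) integrable at the origin. Two or more derivatives are
    only used through C^{1,1}, that is a = 1, which exceeds s because s < 1. *)
Lemma holder_loc_regl (s eps : R) u : 0 < s -> s < 1 -> 0 < eps ->
  holder_loc (2 * s + eps) u -> exists a, [/\ s < a, a <= 1 & regl a u].
Proof.
move=> s0 s1 e0 [k [b [b0 b1 E]]].
case: k E => [|[|k]] E hk.
- exists (b / 2); split; [lra|lra|exact: Ckb_loc0_regl].
- exists ((1 + b) / 2); split; [lra|lra|exact: Ckb_loc1_regl].
- exists ((1 + 1) / 2); split; [lra|lra|].
  by apply: Ckb_loc1_regl => //; exact: Ckb_loc_C11 hk.
Qed.

End holder_regularity.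

(** * Regularity of averages and difference quotients; essential bounds *)

Section averages.
Context {R : realType} {n : nat}.
Implicit Types (u f : 'rV[R]_n -> R) (h v x y z : 'rV[R]_n).

Lemma reg_translate a f v : reg a f -> reg a (fun x => f (x + v)).
Proof.
move=> rf x; have [C hC] := rf (x + v); exists C => z z1.
by have [h1 h2] := hC z z1; rewrite addrAC [x - z + v]addrAC.
Qed.

Lemma reg_diff_quot a u h : reg a u -> reg a (diff_quot h u).
Proof.
move=> ru.
have E : (fun x => (enorm h)^-1 * (u (x + h) + (-1) * u x)) = diff_quot h u.
  by apply/funext => x; rewrite /diff_quot mulrC mulN1r.
rewrite -E; apply: regZ; apply: regD; [exact: reg_translate|exact: regZ].
Qed.

Lemma seg_avgD f g h x : continuous f -> continuous g ->
  seg_avg h (fun x => f x + g x) x = seg_avg h f x + seg_avg h g x.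
Proof. by move=> cf cg; apply: RintegralD => //; exact: integrable_line. Qed.

Lemma seg_avgZ f c h x : continuous f ->
  seg_avg h (fun x => c * f x) x = c * seg_avg h f x.
Proof. by move=> cf; apply: RintegralZl => //; exact: integrable_line. Qed.

Lemma seg_avg_translate f h x z : seg_avg h f (x + z) = seg_avg h (fun x => f (x + z)) x.
Proof. by apply: eq_Rintegral => t _; rewrite addrAC. Qed.

Lemma seg_avg_le_seg f h x (B : R) : continuous f ->
  (forall t : R, 0 <= t <= 1 -> `|f (x + t *: h)| <= B) -> `|seg_avg h f x| <= B.
Proof.
move=> cf fB; have iu := integrable_line x h cf.
apply: le_trans (le_normr_Rintegral _ iu) _ => //.
rewrite -[leRHS](_ : seg_avg h (fun=> B) x = B); last by rewrite seg_avg_cst.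
apply: le_Rintegral => //; first exact: integrable_norm.
  exact: (@integrable_line _ _ (fun=> B) x h (@cst_continuous _ _ B)).
Qed.

Lemma continuous_translate f z : continuous f -> continuous (fun x => f (x + z)).
Proof.
move=> cf x; have FF := @nbhs_filter _ x.
apply: (@continuous_comp _ _ _ (fun x => x + z) f); last exact: cf.
exact: (@cvgD _ _ _ (nbhs x) FF id (fun=> z) x z cvg_id (cvg_cst _)).
Qed.

Lemma continuous_addf f g : continuous f -> continuous g ->
  continuous (fun x : 'rV[R]_n => f x + g x).
Proof.
move=> cf cg x; have FF := @nbhs_filter _ x.
exact: (@cvgD _ _ _ (nbhs x) FF f g _ _ (cf x) (cg x)).
Qed.

Lemma continuous_scalef c f : continuous f -> continuous (fun x : 'rV[R]_n => c * f x).
Proof.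
move=> cf x; have FF := @nbhs_filter _ x.
exact: (@cvgM _ _ (nbhs x) FF (fun=> c) f _ _ (cvg_cst _) (cf x)).
Qed.

Lemma reg_seg_avg a u h : 0 < a -> regl a u -> reg a (seg_avg h u).
Proof.
move=> a0 ru x; have [C hC] := ru (enorm x + enorm h).
have cu : continuous u := reg_continuous a0 (regl_reg ru).
exists C => z z1.
have line t : 0 <= t <= 1 -> enorm (x + t *: h) <= enorm x + enorm h.
  move=> /andP[t0 t1]; apply: le_trans (enormD _ _) _; rewrite lerD2l enormZ.
  by rewrite (ger0_norm t0) ler_piMl// enorm_ge0.
have c1 := @continuous_translate u z cu; have c2 := @continuous_translate u (- z) cu.
have c3 := @continuous_scalef (-1) u cu; have c4 := @continuous_scalef (-2) u cu.
split.
  rewrite seg_avg_translate -mulN1r -seg_avgZ// -seg_avgD//.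
  apply: seg_avg_le_seg; first exact: continuous_addf.
  move=> t t01; have [h1 _] := hC _ (line t t01) z z1.
  by rewrite mulN1r.
rewrite !seg_avg_translate -mulNr -seg_avgZ// -!seg_avgD//; last exact: continuous_addf.
apply: seg_avg_le_seg; first by apply: continuous_addf => //; exact: continuous_addf.
by move=> t t01; have [_ h2] := hC _ (line t t01) z z1; rewrite mulNr.
Qed.

Lemma lebesgue_rV_ball_gt0 x (e : R) : 0 < e ->
  exists A, [/\ measurable A, (0 < lebesgue_rV n A)%E & A `<=` [set y | enorm (x - y) < e]].
Proof.
move=> e0; pose d := e / (Num.sqrt n%:R + 1).
have s0 : 0 <= Num.sqrt n%:R :> R := sqrtr_ge0 _.
have d0 : 0 < d by rewrite divr_gt0// ltr_wpDl.
exists [set y : 'rV[R]_n | forall i, x 0 i < y 0 i <= x 0 i + d]; split.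
- rewrite (_ : [set _ | _] = \bigcap_(i in [set: 'I_n]) (fun y => y 0 i)%R @^-1`
      `](x 0 i), (x 0 i + d)]%classic).
    apply: fin_bigcap_measurable => // i _; rewrite -[X in measurable X]setTI.
    exact: measurable_coord_rV.
  by apply/seteqP; split=> y /= h => [i _|i]; move: (h i); rewrite /= in_itv/=; [exact|apply].
- rewrite lebesgue_rV_box; last by move=> i; rewrite lerDl ltW.
  by rewrite lte_fin prodr_gt0// => i _; rewrite addrAC subrr add0r.
- move=> y /= hy; apply: (@le_lt_trans _ _ (Num.sqrt n%:R * d)).
    apply: enorm_le_sqrt; first exact: ltW.
    move=> i; rewrite !mxE; have /andP[h1 h2] := hy i.
    by rewrite ler_norml; apply/andP; split; lra.
  rewrite /d mulrC mulrAC ltr_pdivrMr ?ltr_wpDl//.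
  by rewrite ltr_pM2l// ltrDl.
Qed.

(** The set where |u| exceeds an essential bound is open and negligible; if it were nonempty it
    would contain a cube of positive measure. *)
Lemma Linfty_bounded u : continuous u -> Linfty u -> exists B, forall x, `|u x| <= B.
Proof.
move=> cu /andP[_]; rewrite inE /finite_norm /= unlock.
have [A [mA A0 _]] := lebesgue_rV_ball_gt0 0 ltr01.
(* The infinity norm unfolds to an essential supremum only when the whole space has positive
   measure. *)
have T0 : (0 < lebesgue_rV n [set: 'rV[R]_n])%E.
  by apply: lt_le_trans A0 _; apply: le_measure; rewrite ?inE.
rewrite T0 => fin.
have [B hB] : exists B : R, (ess_sup (lebesgue_rV n) (abse \o (EFin \o u)) <= B%:E)%E.
  move: fin; case: ess_sup => [r _|//|_]; first by exists r.
  by exists 0; exact: leNye.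
move/ess_supP : hB => [N [mN N0 hN]].
exists B => x; rewrite leNgt; apply/negP => Bx.
have FF := @nbhs_filter _ x.
have : \forall y \near nbhs x, B < `|u y|.
  have cn : `|u y| @[y --> x] --> `|u x| by apply: cvg_norm; exact: cu.
  exact: (cvgr_gt _ cn _ Bx).
move=> /nbhs_ballP[e /= e0 eB].
have [A' [mA' A'0 sA']] := lebesgue_rV_ball_gt0 x e0.
have : (lebesgue_rV n A' <= lebesgue_rV n N)%E.
  apply: le_measure; rewrite ?inE//.
  move=> y /sA' /= ye; apply: hN => /=.
  rewrite lee_fin; apply/negP; rewrite -ltNge; apply: eB.
  rewrite mx_norm_ball /ball_ /=; apply: le_lt_trans ye; exact: mxnorm_le_enorm.
by rewrite leNgt N0 A'0.
Qed.

End averages.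

(** * Functions of class C^{1,1} *)

Section C11_theory.
Context {R : realType} {n : nat}.
Variables (eta : 'rV[R]_n -> R) (N : R).
Implicit Types (x y z : 'rV[R]_n).

Definition C11_bound : Prop :=
  [/\ forall x, differentiable eta x,
      forall x, `|eta x| <= N,
      forall x, enorm (gradient eta x) <= N &
      forall x y, enorm (gradient eta x - gradient eta y) <= N * enorm (x - y)].

Lemma C11_norm_bound : (0 < n)%N -> C11 eta -> fine (C11_norm eta) <= N -> C11_bound.
Proof.
move=> n0 [de]; rewrite /C11_norm.
set S1 := ereal_sup _; set S2 := ereal_sup _; set S3 := ereal_sup _ => foo fN.
have S10 : (0 <= S1)%E.
  apply: le_trans (ereal_sup_ubound (_ : [set `|eta x|%:E | x in setT] `|eta 0|%:E)).
    by rewrite lee_fin.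
  by exists 0.
have S20 : (0 <= S2)%E.
  apply: le_trans (ereal_sup_ubound (_ : [set (enorm (gradient eta x))%:E | x in setT] (enorm (gradient eta 0))%:E)).
    by rewrite lee_fin enorm_ge0.
  by exists 0.
(* A supremum over an empty set would be -oo; in positive dimension a unit vector and 0 are two
   distinct points. *)
have S30 : (0 <= S3)%E.
  pose e : 'rV[R]_n := delta_mx 0 (Ordinal n0).
  apply: le_trans (ereal_sup_ubound (_ : [set (enorm (gradient eta p.1 - gradient eta p.2)
     / enorm (p.1 - p.2))%:E | p in [set p | p.1 <> p.2]] (enorm (gradient eta e - gradient eta 0)
     / enorm (e - 0))%:E)).
    by rewrite lee_fin divr_ge0 ?enorm_ge0.
  exists (e, 0) => //= /rowP /(_ (Ordinal n0)) /eqP.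
  by rewrite !mxE !eqxx oner_eq0.
have fin : (S1 + S2 + S3)%E \is a fin_num by rewrite ge0_fin_numE// !adde_ge0.
have tot : (S1 + S2 + S3 <= N%:E)%E by rewrite -(fineK fin) lee_fin.
have S1N : (S1 <= N%:E)%E.
  by apply: le_trans tot; rewrite -addeA leeDl// adde_ge0.
have S2N : (S2 <= N%:E)%E.
  by apply: le_trans tot; rewrite addeAC leeDr// adde_ge0.
have S3N : (S3 <= N%:E)%E by apply: le_trans tot; rewrite leeDr// adde_ge0.
split=> //.
- move=> x; rewrite -lee_fin; apply: le_trans S1N; apply: ereal_sup_ubound.
  by exists x.
- move=> x; rewrite -lee_fin; apply: le_trans S2N; apply: ereal_sup_ubound.
  by exists x.
- move=> x y; have [->|/eqP xy] := eqVneq x y.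
    by rewrite !subrr enorm0 mulr0.
  rewrite -ler_pdivrMr; last by rewrite enorm_gt0 subr_eq0; exact/eqP.
  rewrite -lee_fin; apply: le_trans S3N; apply: ereal_sup_ubound.
  by exists (x, y).
Qed.

Hypothesis bd : C11_bound.

Lemma C11_taylor x z : `|eta (x + z) - eta x - dotv (gradient eta x) z| <= N * enorm z ^+ 2.
Proof.
have [de _ _ hL] := bd.
have [t /andP[t0 t1]] := @mvt_line _ _ eta (fun y => dotv (gradient eta y) z) x z 1 ler01
  (fun t _ => differentiable_is_derive z (de (x + t *: z))).
rewrite scale1r mul1r => ->; rewrite -dotvBl.
apply: le_trans (dotv_le _ _) _; rewrite expr2 mulrA ler_wpM2r ?enorm_ge0//.
apply: le_trans (hL _ _) _; rewrite addrAC subrr add0r enormZ (ger0_norm t0).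
rewrite ler_wpM2l; first by [].
  by apply: le_trans (normr_ge0 _) _; have [_ h _ _] := bd; exact: (h 0).
by rewrite ler_piMl// enorm_ge0.
Qed.

Lemma C11_lip x z : `|eta (x + z) - eta x| <= N * enorm z.
Proof.
have [de _ hG _] := bd.
have [t /andP[t0 t1]] := @mvt_line _ _ eta (fun y => dotv (gradient eta y) z) x z 1 ler01
  (fun t _ => differentiable_is_derive z (de (x + t *: z))).
rewrite scale1r mul1r => ->.
by apply: le_trans (dotv_le _ _) _; rewrite ler_wpM2r ?enorm_ge0.
Qed.

Lemma C11_ge0 : 0 <= N.
Proof. by have [_ h _ _] := bd; apply: le_trans (h 0). Qed.

(** Going down the gradient, 0 <= eta(x - t g) <= eta(x) - t |g|^2 + N t^2 |g|^2; the best step is t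
    = 1/(2N). *)
Lemma C11_gradient_sqr x : 0 < N -> (forall x, 0 <= eta x) ->
  enorm (gradient eta x) ^+ 2 <= 4 * N * eta x.
Proof.
move=> N0 e0; set g := gradient eta x.
pose t : R := (2 * N)^-1.
have := C11_taylor x (- t *: g); have := e0 (x + - t *: g).
rewrite dotvZr -enorm_sqr enormZ normrN -/g exprMn real_normK ?num_real//.
rewrite ler_norml => h0 /andP[_ h1].
have E : t * enorm g ^+ 2 - N * (t ^+ 2 * enorm g ^+ 2) = enorm g ^+ 2 / (4 * N).
  by rewrite /t; field; rewrite gt_eqF.
rewrite -ler_pdivrMl; last by rewrite mulr_gt0.
by rewrite mulrC -E; lra.
Qed.

Lemma C11_reg a : 0 < a -> a <= 1 -> reg a eta.
Proof.
move=> a0 a1 x; exists (2 * N) => z z1.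
have d0 := enorm_ge0 z; have N0 := C11_ge0.
have zd : enorm z <= enorm z `^ a.
  move: d0; rewrite le_eqVlt => /predU1P[<-|d0]; first exact: powR_ge0.
  by apply: ger1_powR => //; rewrite d0.
split.
  apply: le_trans (C11_lip x z) _.
  have : N * enorm z <= N * enorm z `^ a by rewrite ler_wpM2l.
  have : 0 <= N * enorm z `^ a by rewrite mulr_ge0 ?powR_ge0.
  lra.
have h1 := C11_taylor x z; have h2 := C11_taylor x (- z).
rewrite dotvNr enormN in h2.
rewrite (_ : _ - _ = (eta (x + z) - eta x - dotv (gradient eta x) z)
  + (eta (x - z) - eta x - - dotv (gradient eta x) z)); last by ring.
apply: le_trans (ler_normD _ _) _.
have : N * enorm z ^+ 2 <= N * (enorm z `^ a) ^+ 2.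
  by rewrite ler_wpM2l// lerXn2r// nnegrE// powR_ge0.
lra.
Qed.

End C11_theory.

(** * Kernels and truncated operators *)

Section kernel_theory.
Context {R : realType} {n : nat}.
Variables (s lam Lam : R) (K : 'rV[R]_n -> \bar R).
Hypotheses (s0 : 0 < s) (kc : kernel_class s lam Lam K).
Implicit Types (u f : 'rV[R]_n -> R) (h v x y z : 'rV[R]_n).

Let k z : R := fine (K z).

Lemma kernel_ge0 z : 0 <= k z.
Proof. by have [h _ _] := kc; rewrite fine_ge0. Qed.

Lemma kernelN z : k (- z) = k z.
Proof. by have [_ h _] := kc; rewrite /k -h. Qed.

Lemma kernelE z : z != 0 -> K z = (k z)%:E.
Proof.
move=> z0; have [h _ /(_ z z0)[_ + _ _]] := kc.
by move=> /le_lt_trans /(_ (ltry _)) ub; rewrite fineK// ge0_fin_numE.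
Qed.

Lemma kernel_bounds z : z != 0 ->
  lam * enorm z `^ (- (2 * s) - n%:R) <= k z <= Lam * enorm z `^ (- (2 * s) - n%:R).
Proof.
move=> z0; have [h _ /(_ z z0)[+ + _ _]] := kc.
by rewrite kernelE// !lee_fin (_ : - n%:R - 2 * s = - (2 * s) - n%:R); [move=> -> ->|ring].
Qed.

Lemma kernel_gradient z v : z != 0 ->
  is_derive z v k (dotv (gradient k z) v) /\
  `|dotv (gradient k z) v| <= Lam / enorm z * k z * enorm v.
Proof.
move=> z0; have [_ _ /(_ z z0)[_ _ dk gk]] := kc.
split; first exact: differentiable_is_derive.
by apply: le_trans (dotv_le _ _) _; rewrite ler_wpM2r ?enorm_ge0.
Qed.

Lemma measurable_kernel : measurable_fun [set z : 'rV[R]_n | z != 0] k.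
Proof.
have o0 : open [set z : 'rV[R]_n | z != 0].
  rewrite (_ : [set _ | _] = ~` [set 0]); last by apply/seteqP; split=> z /= /eqP.
  apply: closed_openC.
  exact: accessible_closed_set1 (hausdorff_accessible (@norm_hausdorff _ _)) _.
apply: continuous_measurable_rV => // z; rewrite inE /= => z0.
by apply: differentiable_continuous; have [_ _ /(_ z z0)[_ _]] := kc.
Qed.

(** For r >= 0 the value of K at 0, about which the class gives no upper bound, is discarded; r = 0
    gives the full kernel off the origin. *)
Definition tker (r : R) z : R := if r < enorm z then k z else 0.

Lemma tker_ge0 r z : 0 <= tker r z.
Proof. by rewrite /tker; case: ifP => // _; exact: kernel_ge0. Qed.

Lemma tkerN r z : tker r (- z) = tker r z.
Proof. by rewrite /tker enormN kernelN. Qed.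

Lemma tker_le r z : 0 <= r -> tker r z <= Lam * tailw (- (2 * s)) r z.
Proof.
move=> r0; rewrite /tker /tailw; case: ifPn => [rz|_]; last by rewrite mulr0.
have z0 : z != 0 by rewrite -enorm_gt0 (le_lt_trans r0).
by have /andP[] := kernel_bounds z0.
Qed.

Lemma measurable_tker r : 0 <= r -> measurable_fun setT (tker r).
Proof.
move=> r0.
rewrite (_ : tker r =
  (fun z => if z != 0 then (if r < enorm z then k z else 0) else 0)); last first.
  apply/funext => z; rewrite /tker; case: (eqVneq z 0) => // ->.
  by rewrite enorm0 ltNge r0.
have mb : measurable_fun [set: 'rV[R]_n] (fun z => z != 0 : bool).
  under eq_fun do rewrite -enorm_gt0.
  by apply: measurable_fun_ltr => //; exact: measurable_enorm.
apply: measurable_fun_if => //.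
rewrite setTI (_ : _ @^-1` _ = [set z | z != 0]); last by apply/seteqP; split.
have m0 : measurable [set z : 'rV[R]_n | z != 0].
  by rewrite -[X in measurable X]setTI; exact: mb.
apply: measurable_fun_if => //.
  by apply: measurable_fun_ltr => //; apply: measurable_funTS; exact: measurable_enorm.
apply: measurable_funS measurable_kernel => //.
Qed.

Lemma summ_tker r : 0 < r -> summ (tker r).
Proof.
move=> r0; apply: (@le_summ _ _ _ (fun z => Lam * tailw (- (2 * s)) r z)).
- by apply: measurable_tker; exact: ltW.
- by move=> z; rewrite ger0_norm ?tker_ge0//; apply: tker_le; exact: ltW.
- by apply: summZ; apply: summ_powR_far => //; rewrite oppr_lt0 mulr_gt0.
Qed.

Definition trunc_op (r : R) f x : R := rint (fun z => (f x - f (x - z)) * tker r z).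

Lemma summ_trunc_op r f x B : 0 < r -> measurable_fun setT f ->
  (forall x, `|f x| <= B) -> summ (fun z => (f x - f (x - z)) * tker r z).
Proof.
move=> r0 mf fB; apply: (@summM_bounded _ _ _ _ (B + B)); first exact: summ_tker.
  by apply: measurable_funB => //; exact: measurable_reflect_rV.
by move=> z; apply: le_trans (ler_normB _ _) _; exact: lerD.
Qed.

Lemma trunc_opE r f x : 0 <= r -> measurable_fun setT f ->
  fine (\int[lebesgue_rV n]_(y in [set y | (r < enorm (x - y))%R])
     ((f x - f y)%:E * K (x - y)%R))%E = trunc_op r f x.
Proof.
move=> r0 mf; rewrite /trunc_op /rint /Rintegral; congr fine.
pose F z := ((f x - f (x - z)) * tker r z)%:E.
have mF : measurable_fun setT F.
  apply/measurable_EFinP; apply: measurable_funM; last exact: measurable_tker.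
  by apply: measurable_funB => //; exact: measurable_reflect_rV.
rewrite -[RHS](integral_rV_reflect x mF) integral_mkcond.
apply: eq_integral => y _; rewrite /F /tker subKr patchE.
case: ifPn => [|/negP h]; last by rewrite ifN ?mulr0//; apply/negP => h'; apply: h; rewrite inE.
rewrite inE /= => ry; rewrite ry EFinM kernelE// -enorm_gt0.
exact: le_lt_trans ry.
Qed.

(** As K is even, averaging over z and - z replaces first by second differences, the form in which
    the singularity at the origin is integrable. *)
Lemma trunc_op_sym r f x B : 0 < r -> measurable_fun setT f ->
  (forall x, `|f x| <= B) ->
  trunc_op r f x = - 2^-1 * rint (fun z => (f (x + z) + f (x - z) - 2 * f x) * tker r z).
Proof.
move=> r0 mf fB; have sf := summ_trunc_op x r0 mf fB.
have := rint_opp (summ_measurable sf); rewrite -/(trunc_op r f x) => E.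
rewrite -[LHS](_ : 2^-1 * (trunc_op r f x + trunc_op r f x) = _); last by field.
have sf' : summ (fun z => (f x - f (x - - z)) * tker r (- z)) := summ_opp sf.
have E2 : (fun z => (f (x + z) + f (x - z) - 2 * f x) * tker r z) =
    (fun z => - ((f x - f (x - - z)) * tker r (- z) + (f x - f (x - z)) * tker r z)).
  by apply/funext => z; rewrite tkerN opprK; ring.
rewrite E2 rintN; last exact: summD.
by rewrite rintD// E mulrNN.
Qed.

(** Dominated convergence for the symmetrized integrand: its majorant is a multiple of |z|^(2a - 2s
    - n) in the unit ball, summable since s < a, and of |z|^(-2s - n) outside. *)
Lemma Lop_cvg f x (a B C : R) : s < a -> measurable_fun setT f ->
  (forall x, `|f x| <= B) -> reg_at a f x C ->
  trunc_op r f x @[r --> 0^'+] --> Lop K f x.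
Proof.
move=> sa mf fB rf.
have B0 : 0 <= B := le_trans (normr_ge0 _) (fB 0).
have Lam0 : 0 <= `|Lam| by [].
pose sd z := f (x + z) + f (x - z) - 2 * f x.
have msd : measurable_fun setT sd.
  apply: measurable_funB; last exact: measurable_cst.
  apply: measurable_funD; last exact: measurable_reflect_rV.
  by under eq_fun do rewrite addrC; exact: measurable_translate.
have sa2 : 0 < 2 * a - 2 * s by rewrite subr_gt0 ltr_pM2l.
have [C1 C10 near1] := @summ_powR_near R n _ sa2.
have [snear _] := near1 1 ltr01.
pose nr z := if 0 < enorm z <= 1 then enorm z `^ (2 * a - 2 * s - n%:R) else 0.
pose bd z := `|C| * `|Lam| * nr z + 4 * B * `|Lam| * tailw (- (2 * s)) 1 z.
have sbd : summ bd.
  apply: summD; apply: summZ; first exact: snear.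
  by apply: summ_powR_far => //; rewrite oppr_lt0 mulr_gt0.
have le_bd r z : 0 <= r -> `|sd z * tker r z| <= bd z.
  move=> r0; rewrite normrM (ger0_norm (tker_ge0 _ _)).
  have [z0|z0] := eqVneq z 0.
    rewrite /tker z0 enorm0 ltNge r0 /= mulr0 /bd.
    by rewrite addr_ge0// mulr_ge0 ?mulr_ge0 ?tailw_ge0// /nr; case: ifP => // _; exact: powR_ge0.
  have ez : 0 < enorm z by rewrite enorm_gt0.
  have kz : tker r z <= `|Lam| * enorm z `^ (- (2 * s) - n%:R).
    rewrite /tker; case: ifP => _; last by rewrite mulr_ge0 ?powR_ge0.
    have /andP[_] := kernel_bounds z0; move=> /le_trans; apply.
    by rewrite ler_wpM2r ?powR_ge0// ler_norm.
  rewrite /bd /nr /tailw ez /=; case: (leP (enorm z) 1) => z1.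
    have [_ h2] := rf z z1.
    rewrite mulr0 addr0.
    have h3 : `|sd z| <= `|C| * (enorm z `^ a) ^+ 2.
      by apply: le_trans h2 _; rewrite ler_wpM2r ?sqr_ge0// ler_norm.
    apply: le_trans (ler_pM (normr_ge0 _) (tker_ge0 _ _) h3 kz) _.
    rewrite powR_sqr ?enorm_ge0// mulrACA -powRD; last by rewrite (gt_eqF ez) implybT.
    by rewrite addrA.
  rewrite mulr0 add0r -mulrA.
  apply: ler_pM => //; first exact: tker_ge0.
  rewrite /sd; have h1 := fB (x + z); have h2 := fB (x - z); have h3 := fB x.
  apply: le_trans (ler_normB _ _) _; apply: le_trans (lerD (ler_normD _ _) (lexx _)) _.
  by rewrite normrM (ger0_norm (_ : 0 <= 2))//; lra.
pose l := - 2^-1 * rint (fun z => sd z * tker 0 z).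
suff cl : trunc_op r f x @[r --> 0^'+] --> l.
  rewrite (_ : Lop K f x = l)//; apply: cvg_lim; first exact: Rhausdorff.
  apply: cvg_trans cl; apply: near_eq_cvg; near=> r.
  by rewrite trunc_opE.
apply/cvg_at_rightP => r [r0 rl].
rewrite (_ : (fun m => _) = (fun m => - 2^-1 * rint (fun z => sd z * tker (r m) z))); last first.
  by apply/funext => m; rewrite (trunc_op_sym x (r0 m) mf fB).
apply: cvgMr.
have mt m : measurable_fun setT (fun z => sd z * tker (r m) z).
  by apply: measurable_funM => //; apply: measurable_tker; exact: ltW.
have lb m z : `|sd z * tker (r m) z| <= bd z by apply: le_bd; exact: ltW.
have pt z : sd z * tker (r m) z @[m --> \oo] --> sd z * tker 0 z.
  apply: cvgMr; have [->|z0] := eqVneq z 0.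
    rewrite {2}/tker enorm0 ltxx (_ : (fun m => _) = cst 0); first exact: cvg_cst.
    by apply/funext => m; rewrite /tker enorm0 ltNge (ltW (r0 m)).
  apply: cvg_near_cst.
  have ez : 0 < enorm z by rewrite enorm_gt0.
  near=> m; rewrite /tker ez ifT//; near: m.
  exact: (cvgr_lt 0 rl _ ez).
by have [] := rint_dominated mt sbd lb pt.
Unshelve. all: by end_near. Qed.

End kernel_theory.

(** * Cut-off functions *)

Section cutoffs.
Context {R : realType} {n : nat}.
Implicit Types (f G : 'rV[R]_n -> R) (h v x y z : 'rV[R]_n).

Lemma is_derive_of_line G z v (d : R) :
  is_derive (0 : R) 1 (fun t : R => G (z + t *: v)) d -> is_derive z v G d.
Proof.
move=> [dG dE].
have E : (fun t : R => t^-1 *: (((fun t : R => G (z + t *: v)) \o shift 0) (t *: (1 : R))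
    - G (z + 0 *: v))) =
    (fun t : R => t^-1 *: ((G \o shift z) (t *: v) - G z)).
  apply/funext => t /=; congr (_ *: (G _ - G _)).
    by rewrite addr0 /GRing.scale/= mulr1 addrC.
  by rewrite scale0r addr0.
rewrite /derivable in dG; rewrite /derive in dE.
by rewrite E in dG dE; split.
Qed.

Lemma is_derive_line0 G z v (d : R) :
  is_derive z v G d -> is_derive (0 : R) 1 (fun t : R => G (z + t *: v)) d.
Proof. by move=> dG; apply: is_derive_line; rewrite scale0r addr0. Qed.

Lemma is_derive_comp_dir (b : R -> R) G z v (e d : R) :
  is_derive (G z) 1 b e -> is_derive z v G d -> is_derive z v (b \o G) (e * d).
Proof.
move=> db dG; apply: is_derive_of_line.
have := is_derive_line0 dG => dl.
have db' : is_derive ((fun t : R => G (z + t *: v)) 0) 1 b e by rewrite scale0r addr0.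
exact: is_derive1_comp.
Qed.

Lemma is_derive_pos_sqr (s : R) :
  is_derive s 1 (fun y : R => pos_part y ^+ 2) (2 * pos_part s).
Proof.
have cv : (fun t : R => t^-1 *: (((fun y : R => pos_part y ^+ 2) \o shift s) (t *: (1 : R))
    - pos_part s ^+ 2)) @ 0^' --> 2 * pos_part s.
  apply/cvgrPdist_lt => e e0; near=> t.
  have t0 : t != 0 by near: t; exact: nbhs_dnbhs_neq.
  have te : `|t| < e.
    near: t; apply: dnbhs0_lt => //.
  rewrite /= /GRing.scale/= mulr1.
  rewrite -(ltr_pM2l (_ : 0 < `|t|)) ?normr_gt0// -normrM mulrBr mulVKf// distrC.
  rewrite [t + s]addrC [t * _]mulrC.
  apply: le_lt_trans (pos_part_sqr s t) _.
  by rewrite -real_normK ?num_real// expr2 ltr_pM2l// normr_gt0.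
by split; [exact: (cvgP _ cv)|exact: (cvg_lim (@Rhausdorff R) cv)].
Unshelve. all: by end_near. Qed.

Lemma is_derive_enorm_sqr z v : is_derive z v (fun z => enorm z ^+ 2) (2 * dotv z v).
Proof.
have cv : (fun t : R => t^-1 *: (((fun z => enorm z ^+ 2) \o shift z) (t *: v)
    - enorm z ^+ 2)) @ 0^' --> 2 * dotv z v.
  have -> : 2 * dotv z v = 2 * dotv z v + 0 * enorm v ^+ 2 by rewrite mul0r addr0.
  apply: cvg_trans (_ : (fun t : R => 2 * dotv z v + t * enorm v ^+ 2) @ 0^' --> _).
    apply: near_eq_cvg; near=> t.
    have t0 : t != 0 by near: t; exact: nbhs_dnbhs_neq.
    rewrite /= /GRing.scale/= !enorm_sqr dotvDl ![dotv _ (_ + _)]dotvC !dotvDl !dotvZl !dotvZr (dotvC v z).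
    by field.
  apply: cvgD; first exact: cvg_cst.
  apply: cvgMl; exact: nbhs_dnbhs.
by split; [exact: (cvgP _ cv)|exact: (cvg_lim (@Rhausdorff R) cv)].
Unshelve. all: by end_near. Qed.

Variable (rho : R).
Hypothesis rho0 : 0 < rho.

(* Both cut-offs are squares of positive parts of polynomials in |z|^2, hence
   C^1 with explicit derivatives, and the derivative of phi is controlled by
   the square root of phi, as the interpolation step requires. *)
Let t z : R := enorm z ^+ 2 / rho ^+ 2.

(** The inner affine function of t is 0 on |z| = rho/2 and 1 on |z| = rho, so chi decreases from 1
    to 0 between these spheres. *)
Definition chi z : R :=
  pos_part (1 - pos_part ((4 * t z - 1) / 3) ^+ 2) ^+ 2.

Definition dchi h z : R :=
  2 * pos_part (1 - pos_part ((4 * t z - 1) / 3) ^+ 2)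
  * (- (2 * pos_part ((4 * t z - 1) / 3) * (4 / 3 * (2 * dotv z h / rho ^+ 2)))).

(** The quadratic vanishes on |z| = rho/4 and |z| = rho/2. On the annulus between them chi = 1, and
    a kernel truncated at r <= rho/4 is unchanged. *)
Definition phi z : R := pos_part ((t z - 1 / 16) * (1 / 4 - t z)) ^+ 2.

Definition dphi h z : R :=
  2 * pos_part ((t z - 1 / 16) * (1 / 4 - t z))
  * ((5 / 16 - 2 * t z) * (2 * dotv z h / rho ^+ 2)).

Let dt h z : is_derive z h t (2 * dotv z h / rho ^+ 2).
Proof.
have d := is_derive_enorm_sqr z h.
have := @is_deriveZ _ _ _ (fun z => enorm z ^+ 2) (rho ^+ 2)^-1 z h _ d.
rewrite (_ : _ \*: _ = t); last by apply/funext => y; rewrite /t /= mulrC.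
by rewrite /GRing.scale/= mulrC.
Qed.

Let affine (a b x : R) : is_derive x 1 (fun y : R => a * y + b) a.
Proof.
have := is_deriveD (is_deriveZ a (is_derive_id x 1)) (is_derive_cst b x 1).
by rewrite addr0 /GRing.scale/= mulr1.
Qed.

Lemma is_derive_chi h z : is_derive z h chi (dchi h z).
Proof.
have d1 : is_derive z h (fun z => (4 * t z - 1) / 3) (4 / 3 * (2 * dotv z h / rho ^+ 2)).
  have := is_derive_comp_dir (affine (4 / 3) (- (1 / 3)) (t z)) (dt h z).
  by rewrite (_ : _ \o _ = (fun z => (4 * t z - 1) / 3))//; apply/funext => y /=; field.
have d2 := is_derive_comp_dir (is_derive_pos_sqr _) d1.
have d3 := is_derive_comp_dir (affine (-1) 1 _) d2.
have d4 := is_derive_comp_dir (is_derive_pos_sqr _) d3.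
rewrite mulN1r in d4.
have E : -1 * (pos_part ((4 * t z - 1) / 3)) ^+ 2 + 1 = 1 - pos_part ((4 * t z - 1) / 3) ^+ 2 by ring.
rewrite /= E in d4; rewrite /dchi.
rewrite (_ : chi = (fun y : R => pos_part y ^+ 2) \o
  ((fun y : R => -1 * y + 1) \o ((fun y : R => pos_part y ^+ 2) \o (fun z => (4 * t z - 1) / 3))))//.
by apply/funext => y /=; rewrite /chi mulN1r addrC.
Qed.

Lemma is_derive_phi h z : is_derive z h phi (dphi h z).
Proof.
have d1 := is_derive_comp_dir (affine 1 (- (1 / 16)) (t z)) (dt h z).
have d2 := is_derive_comp_dir (affine (-1) (1 / 4) (t z)) (dt h z).
have d3 := is_deriveM d1 d2.
have d4 := is_derive_comp_dir (is_derive_pos_sqr _) d3.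
rewrite (_ : phi = (fun y : R => pos_part y ^+ 2) \o
  (((fun y : R => 1 * y - 1 / 16) \o t) * ((fun y : R => -1 * y + 1 / 4) \o t))); last first.
  by apply/funext => y; rewrite /phi !fctE /=; congr (pos_part _ ^+ 2); ring.
apply: is_derive_eq.
rewrite /dphi /= /GRing.scale/= !fctE /=.
rewrite (_ : (1 * t z - 1 / 16) * (-1 * t z + 1 / 4) = (t z - 1 / 16) * (1 / 4 - t z)); last by ring.
by congr (_ * _); field; rewrite gt_eqF.
Qed.

End cutoffs.

Section cutoff_bounds.
Context {R : realType} {n : nat}.
Variable (rho : R).
Hypothesis rho0 : 0 < rho.
Implicit Types (h v x y z : 'rV[R]_n).

Let t z : R := enorm z ^+ 2 / rho ^+ 2.

Let rho2 : 0 < rho ^+ 2. Proof. by rewrite exprn_gt0. Qed.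

Let t_le z (c : R) : 0 <= c -> enorm z <= c * rho -> t z <= c ^+ 2.
Proof.
move=> c0 h; rewrite /t ler_pdivrMr// -exprMn lerXn2r// nnegrE ?enorm_ge0//.
by rewrite mulr_ge0// ltW.
Qed.

Let t_ge z (c : R) : 0 <= c -> c * rho <= enorm z -> c ^+ 2 <= t z.
Proof.
move=> c0 h; rewrite /t ler_pdivlMr// -exprMn lerXn2r// nnegrE ?enorm_ge0//.
by rewrite mulr_ge0// ltW.
Qed.

Let pos_ge0 (s : R) : 0 <= pos_part s.
Proof. by rewrite /pos_part le_max lexx orbT. Qed.

Let pos_eq0 (s : R) : s <= 0 -> pos_part s = 0.
Proof. by move=> s0; rewrite /pos_part max_r. Qed.

Let pos_id (s : R) : 0 <= s -> pos_part s = s.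
Proof. by move=> s0; rewrite /pos_part max_l. Qed.

Let pos_le1 (s : R) : s <= 1 -> pos_part s <= 1.
Proof. by move=> s1; rewrite /pos_part ge_max s1 ler01. Qed.

Lemma chi_ge0 z : 0 <= chi rho z. Proof. exact: sqr_ge0. Qed.

Lemma chi_le1 z : chi rho z <= 1.
Proof.
rewrite /chi exprn_ile1// pos_le1// gerBl; exact: sqr_ge0.
Qed.

Lemma chi_eq1 z : enorm z <= rho / 2 -> chi rho z = 1.
Proof.
move=> h; have := t_le (_ : 0 <= 1 / 2) (_ : enorm z <= 1 / 2 * rho).
rewrite /chi -/(t z) => /(_ _ _) t4.
have {}t4 : t z <= (1 / 2) ^+ 2 by apply: t4; lra.
rewrite [X in 1 - X](_ : _ = 0) ?subr0; last first.
  rewrite [pos_part _]pos_eq0 ?expr0n// ; rewrite expr2 in t4; lra.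
by rewrite pos_id// expr1n.
Qed.

Lemma chi_eq0 z : rho <= enorm z -> chi rho z = 0.
Proof.
move=> h; have t1 : 1 ^+ 2 <= t z by apply: t_ge => //; rewrite mul1r.
rewrite /chi -/(t z) [X in X ^+ 2]pos_eq0 ?expr0n// subr_le0.
rewrite expr1n in t1.
have h1 : 1 <= pos_part ((4 * t z - 1) / 3) by rewrite pos_id; lra.
by rewrite exprn_ege1.
Qed.

Lemma dchi_eq0 h z : enorm z <= rho / 2 -> dchi rho h z = 0.
Proof.
move=> hz; have t4 : t z <= (1 / 2) ^+ 2 by apply: t_le; lra.
rewrite /dchi -/(t z) [pos_part ((4 * t z - 1) / 3)]pos_eq0; last first.
  by rewrite expr2 in t4; lra.
by rewrite mulr0 mul0r oppr0 mulr0.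
Qed.

Lemma dchi_le h z : `|dchi rho h z| * enorm z <= 11 * enorm h.
Proof.
have h0 := enorm_ge0 h.
have [zr|zr] := leP rho (enorm z).
  have t1 : 1 ^+ 2 <= t z by apply: t_ge => //; rewrite mul1r.
  rewrite expr1n in t1.
  rewrite /dchi -/(t z) [X in 2 * X * _]pos_eq0; last first.
    rewrite subr_le0 exprn_ege1// pos_id; lra.
  by rewrite mulr0 mul0r normr0 mul0r mulr_ge0.
have t1 : t z <= 1 ^+ 2 by apply: t_le; [|rewrite mul1r ltW].
rewrite expr1n in t1.
rewrite /dchi -/(t z); set p1 := pos_part (1 - _); set p2 := pos_part _.
have p10 : 0 <= p1 by exact: pos_ge0.
have p20 : 0 <= p2 by exact: pos_ge0.
have p11 : p1 <= 1 by rewrite /p1 pos_le1// gerBl; exact: sqr_ge0.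
have p21 : p2 <= 1 by rewrite /p2 pos_le1//; lra.
(* 32/3 collects the numerical factors 2, 2, 4/3 and 2 of [dchi]; the statement rounds it up to 11.
   It is kept opaque for the arithmetic. *)
have [c c0 cE] : exists2 c : R, 0 <= c & c = 32 / 3 by exists (32 / 3) => //; lra.
have i0 : 0 <= (rho ^+ 2)^-1 by rewrite invr_ge0 ltW.
rewrite (_ : 2 * p1 * - _ = - (p1 * p2 * c * (dotv z h / rho ^+ 2))); last first.
  by rewrite cE; field; rewrite gt_eqF.
rewrite normrN !normrM (ger0_norm p10) (ger0_norm p20) (ger0_norm c0) (ger0_norm i0).
have pp : p1 * p2 <= 1 by rewrite mulr_ile1.
have pp0 : 0 <= p1 * p2 by rewrite mulr_ge0.
have dz := dotv_le z h.
have key : `|dotv z h| / rho ^+ 2 * enorm z <= enorm h.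
  rewrite mulrAC ler_pdivrMr//.
  apply: (@le_trans _ _ (enorm z * enorm h * enorm z)).
    by rewrite ler_wpM2r ?enorm_ge0.
  rewrite [enorm z * enorm h]mulrC -mulrA ler_wpM2l// -expr2 lerXn2r ?nnegrE ?enorm_ge0// ltW//.
have key0 : 0 <= `|dotv z h| / rho ^+ 2 * enorm z.
  by rewrite mulr_ge0 ?enorm_ge0// divr_ge0// ltW.
rewrite -[leLHS]mulrA -[p1 * p2 * _ * _]mulrA.
apply: (@le_trans _ _ (1 * (c * enorm h))); last by rewrite cE; lra.
by apply: ler_pM => //; [exact: mulr_ge0|exact: ler_wpM2l].
Qed.

Let q z := (t z - 1 / 16) * (1 / 4 - t z).

Lemma phi_ge0 z : 0 <= phi rho z. Proof. exact: sqr_ge0. Qed.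

Let q_le1 z : q z <= 1.
Proof. rewrite /q; nra. Qed.

Lemma phi_le1 z : phi rho z <= 1.
Proof. by rewrite /phi exprn_ile1// pos_le1//; exact: q_le1. Qed.

Lemma phi_supp z h : ~~ (rho / 4 < enorm z < rho / 2) ->
  phi rho z = 0 /\ dphi rho h z = 0.
Proof.
rewrite negb_and -!leNgt => /orP hz.
suff q0 : q z <= 0.
  by rewrite /phi /dphi -/(t z) -/(q z) pos_eq0// expr0n /= mulr0 mul0r.
case: hz => hz.
  have : t z <= (1 / 4) ^+ 2 by apply: t_le; lra.
  rewrite expr2 /q => h1; apply: mulr_le0_ge0; lra.
have : (1 / 2) ^+ 2 <= t z by apply: t_ge; lra.
rewrite expr2 /q => h1; apply: mulr_ge0_le0; lra.
Qed.

Lemma dphi_le h z : exists p : R, [/\ 0 <= p, phi rho z = p ^+ 2 &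
  `|dphi rho h z| <= p * enorm h / rho].
Proof.
exists (pos_part (q z)); split=> //.
have [hz|hz] := boolP (rho / 4 < enorm z < rho / 2); last first.
  have [_ ->] := phi_supp h hz.
  by rewrite normr0 divr_ge0 ?mulr_ge0 ?enorm_ge0// ltW.
case/andP: hz => z1 z2.
have t1 : t z <= (1 / 2) ^+ 2 by apply: t_le; lra.
have t2 : (1 / 4) ^+ 2 <= t z by apply: t_ge; lra.
rewrite expr2 in t1; rewrite expr2 in t2.
rewrite /dphi -/(t z) -/(q z) !normrM (ger0_norm (pos_ge0 _)).
have i0 : 0 <= (rho ^+ 2)^-1 by rewrite invr_ge0 ltW.
have n2 : 0 <= 2 :> R by [].
rewrite (ger0_norm i0) !(ger0_norm n2).
have dz : `|dotv z h| <= rho / 2 * enorm h.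
  by apply: le_trans (dotv_le _ _) _; rewrite ler_wpM2r ?enorm_ge0// ltW.
have b1 : `|5 / 16 - 2 * t z| <= 1 / 2 by rewrite ler_norml; apply/andP; split; lra.
have b2 : 2 * `|dotv z h| / rho ^+ 2 <= enorm h / rho.
  rewrite ler_pdivrMr// [leRHS](_ : _ = rho * enorm h); first by lra.
  by field; rewrite gt_eqF.
have b20 : 0 <= 2 * `|dotv z h| / rho ^+ 2 by rewrite divr_ge0 ?mulr_ge0// ltW.
have key := ler_pM (normr_ge0 _) b20 b1 b2.
have := ler_wpM2l (pos_ge0 (q z)) key; lra.
Qed.

(** This is the shell 5 rho/16 <= |z| <= 7 rho/16 inside the annulus; the two factors are at least
    9/256 and 15/256, rounded down to 1/30 and 1/20. *)
Lemma phi_lower z : 25 / 256 <= enorm z ^+ 2 / rho ^+ 2 <= 49 / 256 ->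
  (1 / 30 * (1 / 20)) ^+ 2 <= phi rho z.
Proof.
rewrite -/(t z) => /andP[t1 t2]; rewrite /phi -/(t z) -/(q z).
have q1 : 1 / 30 * (1 / 20) <= q z by rewrite /q; apply: ler_pM; lra.
have q0 : 0 <= q z by lra.
by rewrite pos_id// lerXn2r// nnegrE; lra.
Qed.

Let measurable_pos_sqr (f : 'rV[R]_n -> R) : measurable_fun setT f ->
  measurable_fun setT (fun z => pos_part (f z) ^+ 2).
Proof.
move=> mf; apply: measurable_funX; rewrite /pos_part.
by apply: measurable_maxr.
Qed.

Let measurable_t : measurable_fun [set: 'rV[R]_n] t.
Proof.
by apply: measurable_funM => //; apply: measurable_funX; exact: measurable_enorm.
Qed.

Lemma measurable_chi : measurable_fun [set: 'rV[R]_n] (chi rho).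
Proof.
apply: measurable_pos_sqr; apply: measurable_funB => //; apply: measurable_pos_sqr.
apply: measurable_funM => //; apply: measurable_funB => //.
by apply: measurable_funM => //; exact: measurable_t.
Qed.

Lemma measurable_phi : measurable_fun [set: 'rV[R]_n] (phi rho).
Proof.
apply: measurable_pos_sqr.
by apply: measurable_funM => //; apply: measurable_funB => //; exact: measurable_t.
Qed.

End cutoff_bounds.

(** * Bounded measurable multipliers *)

Section bounded_measurable.
Context {R : realType} {n : nat}.
Implicit Types (f g : 'rV[R]_n -> R) (x : 'rV[R]_n).

Definition bm f : Prop :=
  measurable_fun setT f /\ exists M, forall z, `|f z| <= M.

Lemma bm_cst (c : R) : bm (fun=> c).
Proof. by split; [exact: measurable_cst|exists `|c|]. Qed.

Lemma bmD f g : bm f -> bm g -> bm (fun z => f z + g z).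
Proof.
move=> [mf [M fM]] [mg [L gL]]; split; first exact: measurable_funD.
by exists (M + L) => z; apply: le_trans (ler_normD _ _) _; exact: lerD.
Qed.

Lemma bmM f g : bm f -> bm g -> bm (fun z => f z * g z).
Proof.
move=> [mf [M fM]] [mg [L gL]]; split; first exact: measurable_funM.
by exists (M * L) => z; rewrite normrM; exact: ler_pM.
Qed.

Lemma bmB f g : bm f -> bm g -> bm (fun z => f z - g z).
Proof.
move=> [mf [M fM]] [mg [L gL]]; split; first exact: measurable_funB.
by exists (M + L) => z; apply: le_trans (ler_normB _ _) _; exact: lerD.
Qed.

Lemma bmX f k : bm f -> bm (fun z => f z ^+ k).
Proof.
move=> [mf [M fM]]; split; first exact: measurable_funX.
by exists (M ^+ k) => z; rewrite normrX; apply: lerXn2r; rewrite ?nnegrE// (le_trans _ (fM z)).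
Qed.

Lemma bm_pos f : bm f -> bm (fun z => pos_part (f z)).
Proof.
move=> [mf [M fM]]; split; first exact: measurable_maxr.
exists M => z; apply: le_trans (fM z); rewrite /pos_part.
by case: (leP 0 (f z)) => // h; rewrite normr0.
Qed.

Lemma bm_diff_quot f h M : measurable_fun setT f -> (forall z, `|f z| <= M) ->
  bm (diff_quot h f).
Proof.
move=> mf fM; split.
  by apply: measurable_funM => //; apply: measurable_funB => //; exact: measurable_translate.
exists ((M + M) * (enorm h)^-1) => y.
rewrite normrM [X in _ * X]ger0_norm ?invr_ge0 ?enorm_ge0//.
rewrite ler_wpM2r ?invr_ge0 ?enorm_ge0//.
by apply: le_trans (ler_normB _ _) _; exact: lerD.
Qed.

Lemma bm_C11 f N : C11_bound f N -> bm f.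
Proof.
move=> [df fN _ _]; split; last by exists N.
apply: continuous_measurable_rV openT _ => y _.
exact: differentiable_continuous.
Qed.

Lemma bm_reflect f x : bm f -> bm (fun z => f (x - z)).
Proof. by move=> [mf [M fM]]; split; [exact: measurable_reflect_rV|exists M]. Qed.

Lemma summ_bm f g : bm f -> summ g -> summ (fun z => f z * g z).
Proof. by move=> [mf [M fM]] sg; exact: (summM_bounded sg mf fM). Qed.

End bounded_measurable.

(* In both lemmas T = eta x, e = eta (x - z), a = P x, P = P (x - z) and
   S = (P - w) (x - z); in the second one G and rr are the first-order and the
   remainder terms of the Taylor expansion of eta. *)
Section pointwise.
Context {R : realType}.

(** The right side minus the left side equals (T a - e P)^2 + 2 T e a S. *)
Lemma far_pointwise (T e a P S : R) : 0 <= T -> 0 <= e -> 0 <= a * S ->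
  - T ^+ 2 * (P - a) ^+ 2 - 2 * T ^+ 2 * (a * S) + (T ^+ 2 - e ^+ 2) * P ^+ 2
  <= 2 * T * a * ((T - e) * (P - S)).
Proof.
move=> T0 e0 aS.
have h : 0 <= T * e * (a * S) by apply: mulr_ge0 => //; exact: mulr_ge0.
have := sqr_ge0 (T * a - e * P); lra.
Qed.

(** Write e = T + q and P = a + d, and use T^2 - e^2 <= - 2 T q. The smallness of c gives |q| <=
    T/8, so the d^2 term costs a quarter of T^2 d^2; the cross term costs another quarter by Young's
    inequality, plus 144 N^2 T zeta^2 a^2. In the a^2 term G is kept exactly, since it will
    integrate to 0, and the remainder adds 2, whence 146. *)
Lemma near_pointwise (T e a P S G rr tau zeta c N : R) :
  T = tau ^+ 2 -> 0 <= tau -> 0 <= zeta -> 0 <= c -> 1 <= N -> 24 * N * c <= 1 ->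
  zeta <= c * tau -> e = T - G + rr -> `|G| <= 2 * N * tau * zeta ->
  `|rr| <= N * zeta ^+ 2 -> 0 <= a * S ->
  - T ^+ 2 * (P - a) ^+ 2 - 2 * T ^+ 2 * (a * S) + (T ^+ 2 - e ^+ 2) * P ^+ 2
  <= - (T ^+ 2 / 2) * ((P - a) ^+ 2 + a * S) + 2 * T * G * a ^+ 2
     + 146 * N ^+ 2 * T * zeta ^+ 2 * a ^+ 2.
Proof.
move=> TE tau0 z0 c0 N1 Nc zc eE GL rL aS.
have N0 : 0 <= N by lra.
have c1 : c <= 1 by nra.
have zt : zeta <= tau by apply: le_trans zc _; rewrite ler_piMl.
have T0 : 0 <= T by rewrite TE sqr_ge0.
set d := P - a; have -> : P = a + d by rewrite /d; ring.
pose q := rr - G.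
have qL : `|q| <= 3 * N * (tau * zeta).
  apply: le_trans (ler_normB _ _) _.
  have : N * zeta ^+ 2 <= N * (tau * zeta) by rewrite ler_wpM2l// expr2 ler_wpM2r.
  lra.
have qT : `|q| <= T / 8.
  apply: le_trans qL _.
  have h1 : tau * zeta <= c * T.
    by rewrite TE expr2 mulrCA ler_wpM2l.
  have : 3 * N * (tau * zeta) <= 3 * N * (c * T) by rewrite ler_wpM2l// mulr_ge0.
  have : N * c * T <= 24^-1 * T by rewrite ler_wpM2r//; lra.
  lra.
have eq : e = T + q by rewrite eE /q; ring.
have b1 : (T ^+ 2 - e ^+ 2) * (a + d) ^+ 2 <= - 2 * T * q * (a + d) ^+ 2.
  by rewrite ler_wpM2r ?sqr_ge0// eq; have := sqr_ge0 q; lra.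
have b2 : - 2 * T * q * d ^+ 2 <= T ^+ 2 * d ^+ 2 / 4.
  have h1 : - q <= T / 8 by have := ler_norm (- q); rewrite normrN; lra.
  have := ler_wpM2l (mulr_ge0 T0 (sqr_ge0 d)) h1; lra.
have b3 : - 4 * T * q * a * d <= T ^+ 2 * d ^+ 2 / 4 + 144 * N ^+ 2 * T * zeta ^+ 2 * a ^+ 2.
  pose X := 12 * N * (tau * zeta).
  have X0 : 0 <= X by rewrite /X !mulr_ge0.
  have q4 : `|4 * q| <= X by rewrite normrM ger0_norm// /X; lra.
  have h1 : - (4 * q * (a * d)) <= X * `|a * d|.
    apply: le_trans (ler_norm _) _; rewrite normrN normrM; exact: ler_wpM2r.
  have h2 : - 4 * T * q * a * d <= T * (X * `|a * d|).
    by have := ler_wpM2l T0 h1; lra.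
  apply: le_trans h2 _.
  have E : `|a * d| = `|a| * `|d| by rewrite normrM.
  have da : d ^+ 2 = `|d| ^+ 2 by rewrite real_normK ?num_real.
  have aa : a ^+ 2 = `|a| ^+ 2 by rewrite real_normK ?num_real.
  rewrite E da aa; have XX : 144 * N ^+ 2 * T * zeta ^+ 2 * `|a| ^+ 2 = (X * `|a|) ^+ 2.
    by rewrite /X TE; ring.
  rewrite XX; have := sqr_ge0 (T * `|d| / 2 - X * `|a|); lra.
have b4 : - 2 * T * q * a ^+ 2 <= 2 * T * G * a ^+ 2 + 2 * N ^+ 2 * T * zeta ^+ 2 * a ^+ 2.
  have h1 : - q <= G + N ^+ 2 * zeta ^+ 2.
    have h2 : N * zeta ^+ 2 <= N ^+ 2 * zeta ^+ 2.
      by rewrite ler_wpM2r ?sqr_ge0// expr2 ler_peMl.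
    have := ler_norm (- rr); rewrite normrN /q; lra.
  have := ler_wpM2l (mulr_ge0 T0 (sqr_ge0 a)) h1; lra.
have TS : 0 <= T ^+ 2 * (a * S) by rewrite mulr_ge0 ?sqr_ge0.
lra.
Qed.

End pointwise.

(** * Lower bound on the integral of the annular bump *)

Section bump_mass.
Context {R : realType} {n : nat}.
Variable (rho : R).
Hypotheses (rho0 : 0 < rho) (n0 : (0 < n)%N).

(** The lower bound of [phi_lower] times the volume, in units of rho^n, of a cube in the shell: its
    coordinates range from 5/16 to 7/16 of rho / sqrt n, so its side is rho / (8 sqrt n). *)
Definition bump_const : R := (1 / 30 * (1 / 20)) ^+ 2 * (8 * Num.sqrt n%:R) ^- n.

Let sn0 : 0 < Num.sqrt n%:R :> R. Proof. by rewrite sqrtr_gt0 ltr0n. Qed.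

Lemma bump_const_gt0 : 0 < bump_const.
Proof.
apply: mulr_gt0; first by apply: exprn_gt0; lra.
by rewrite invr_gt0; apply: exprn_gt0; apply: mulr_gt0.
Qed.

Let box := [set z : 'rV[R]_n |
  forall i, 5 / 16 * (rho / Num.sqrt n%:R) < z 0 i <= 7 / 16 * (rho / Num.sqrt n%:R)].

Let measurable_box : measurable box.
Proof.
rewrite (_ : box = \bigcap_(i in [set: 'I_n]) (fun y : 'rV[R]_n => y 0 i)%R @^-1`
    `](5 / 16 * (rho / Num.sqrt n%:R)), (7 / 16 * (rho / Num.sqrt n%:R))]%classic).
  apply: fin_bigcap_measurable => // i _; rewrite -[X in measurable X]setTI.
  exact: measurable_coord_rV.
by apply/seteqP; split=> y /= h => [i _|i]; move: (h i); rewrite /= in_itv/=; [exact|apply].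
Qed.

Let box_measure : lebesgue_rV n box = ((rho / (8 * Num.sqrt n%:R)) ^+ n)%:E.
Proof.
have r0 : 0 < rho / Num.sqrt n%:R by rewrite divr_gt0.
rewrite /box (@lebesgue_rV_box R n (fun=> 5 / 16 * (rho / Num.sqrt n%:R))
  (fun=> 7 / 16 * (rho / Num.sqrt n%:R))); last by move=> _; lra.
congr EFin; rewrite prodr_const card_ord; congr (_ ^+ _).
by field; rewrite gt_eqF.
Qed.

Lemma rint_phi_ge : summ (@phi R n rho) -> bump_const * rho ^+ n <= rint (@phi R n rho).
Proof.
move=> sphi.
have r0 : 0 < rho / Num.sqrt n%:R by rewrite divr_gt0.
have sbox : summ (fun z => \1_box z).
  apply/integrableP; split; first exact/measurable_EFinP/measurable_indic.
  under eq_integral => z _ do rewrite /= ger0_norm//.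
  rewrite integral_indic// setIT; by rewrite [X in (X < _)%E]box_measure ltry.
have rbox : rint (fun z => \1_box z) = (rho / (8 * Num.sqrt n%:R)) ^+ n.
  rewrite /rint /Rintegral integral_indic// setIT.
  by rewrite [X in fine X]box_measure.
rewrite (_ : bump_const * rho ^+ n =
  (1 / 30 * (1 / 20)) ^+ 2 * rint (fun z => \1_box z)); last first.
  rewrite rbox /bump_const; move: ((1 / 30 * (1 / 20)) ^+ 2) => c.
  by rewrite expr_div_n -mulrA [_ * rho ^+ n]mulrC.
rewrite -rintZ//; apply: le_rint => //; first exact: summZ.
move=> z; rewrite indicE; have [zb|_] := boolP (z \in box); last by rewrite mulr0 phi_ge0.
rewrite mulr1; rewrite inE in zb.
have E2 : (rho / Num.sqrt n%:R) ^+ 2 * n%:R = rho ^+ 2.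
  rewrite exprMn exprVn sqr_sqrtr ?ler0n// divfK//.
  by rewrite pnatr_eq0 -lt0n.
have sumE (c : R) : c ^+ 2 * rho ^+ 2 = \sum_(i < n) (c * (rho / Num.sqrt n%:R)) ^+ 2.
  rewrite sumr_const card_ord -[RHS]mulr_natr -E2. ring.
have rho2 : 0 < rho ^+ 2 by rewrite exprn_gt0.
apply: phi_lower => //; rewrite ler_pdivlMr// ler_pdivrMr// enorm_sqr /dotv.
rewrite (_ : 25 / 256 = (5 / 16) ^+ 2); last by field.
rewrite (_ : 49 / 256 = (7 / 16) ^+ 2); last by field.
rewrite !sumE; apply/andP; split; apply: ler_sum => i _; rewrite -expr2;
  have /andP[h1 h2] := zb i; apply: lerXn2r; rewrite ?nnegrE; lra.
Qed.

End bump_mass.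

(** * The inequality for the truncated operators *)

Section weights.
Context {R : realType} {n : nat}.
Variable (s : R).
Hypotheses (s0 : 0 < s) (s1 : s < 1).

(** The Lévy weight min(|z|,1)^2 |z|^(-2s-n), whose finite integral plays the part of a far-field
    constant independent of rho. *)
Definition jweight (z : 'rV[R]_n) : R :=
  Num.min (enorm z) 1 ^+ 2 * enorm z `^ (- (2 * s) - n%:R).

Lemma jweight_ge0 z : 0 <= jweight z.
Proof. by rewrite mulr_ge0 ?sqr_ge0 ?powR_ge0. Qed.

Lemma summ_jweight : summ jweight.
Proof.
have g0 : 0 < 2 - 2 * s by move: s1; lra.
have [C C0 /(_ 1 ltr01) [s2 _]] := @summ_powR_near R n _ g0.
have st : summ (@tailw R n (- (2 * s)) 1).
  by apply: summ_powR_far => //; rewrite oppr_lt0 mulr_gt0.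
apply: le_summ (summD s2 st).
  apply: measurable_funM; last exact: measurable_enorm_powR.
  by apply: measurable_funX; apply: measurable_minr => //; exact: measurable_enorm.
move=> z; rewrite ger0_norm ?jweight_ge0// /jweight /tailw.
have [zz|zz] := eqVneq z 0.
  rewrite zz enorm0 ltxx /= (_ : Num.min 0 1 = 0 :> R) ?min_l// expr0n /= mul0r.
  by rewrite ltNge ler01 /= addr0.
have ez : 0 < enorm z by rewrite enorm_gt0.
rewrite ez /=; have [z1|z1] := leP (enorm z) 1.
  rewrite addr0 (_ : 2 - 2 * s - n%:R = 2 + (- (2 * s) - n%:R)); last by ring.
  rewrite [leRHS]powRD; last by rewrite (gt_eqF ez) implybT.
  by rewrite powR_mulrn ?enorm_ge0.
by rewrite expr1n mul1r add0r.
Qed.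

End weights.

Section core.
Context {R : realType} {n : nat}.
Variables (s lam Lam : R) (K : 'rV[R]_n -> \bar R).
Hypotheses (s0 : 0 < s) (s1 : s < 1) (kc : kernel_class s lam Lam K).
Hypotheses (lam0 : 0 < lam) (Lam0 : 0 <= Lam).
Variables (eta : 'rV[R]_n -> R) (N : R).
Hypotheses (etaC : C11_bound eta N) (N1 : 1 <= N) (eta0 : forall x, 0 <= eta x).
Variables (u : 'rV[R]_n -> R) (h : 'rV[R]_n) (Bu : R).
Hypotheses (cu : continuous u) (uB : forall x, `|u x| <= Bu) (h0 : h != 0).
Let w := diff_quot h u.
Let U := seg_avg h u.
Hypothesis mU : measurable_fun setT U.
Variables (P : 'rV[R]_n -> R) (x : 'rV[R]_n).
Let a := P x.
Hypotheses (bP : bm P) (aS : forall y, 0 <= a * (P y - w y)).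
Let T := eta x.
Variables (tau c : R).
(* At the scale rho = c sqrt (eta x) the function eta is still comparable to
   eta x, because |grad eta|^2 <= 4 N eta. *)
Hypotheses (TE : T = tau ^+ 2) (tau0 : 0 < tau) (c0 : 0 < c) (Nc : 24 * N * c <= 1).
Let rho := c * tau.
Let k z : R := fine (K z).
Let g := gradient eta x.
Implicit Types (y z : 'rV[R]_n).

Let rho0 : 0 < rho. Proof. exact: mulr_gt0. Qed.
Let N0 : 0 < N. Proof. by apply: lt_le_trans N1. Qed.
Let T0 : 0 < T. Proof. by rewrite TE exprn_gt0. Qed.
Let h_gt0 : 0 < enorm h. Proof. by rewrite enorm_gt0. Qed.

Let Q z := (P (x - z) - a) ^+ 2 + a * (P (x - z) - w (x - z)).
Let dU z := U (x - z) - U x.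
Let E z := - T ^+ 2 * (P (x - z) - a) ^+ 2 - 2 * T ^+ 2 * (a * (P (x - z) - w (x - z)))
  + (T ^+ 2 - eta (x - z) ^+ 2) * P (x - z) ^+ 2.

Let Q_ge0 z : 0 <= Q z.
Proof. by rewrite addr_ge0 ?sqr_ge0. Qed.

Let gradient_le : enorm g <= 2 * N * tau.
Proof.
rewrite -ler_sqr ?nnegrE ?enorm_ge0//; last by rewrite !mulr_ge0// ltW.
apply: le_trans (C11_gradient_sqr etaC x N0 eta0) _; rewrite -/T TE.
have : N * tau ^+ 2 <= N ^+ 2 * tau ^+ 2 by rewrite ler_wpM2r ?sqr_ge0// expr2 ler_peMl// ltW.
lra.
Qed.

(** A convex combination of the near and the far bound, the former being available wherever chi is
    nonzero. A sharp split at |z| = rho would not do: the weight of the far part has to be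
    differentiable to be integrated by parts. *)
Let E_le z : E z <= chi rho z * (- (T ^+ 2 / 2) * Q z + 2 * T * dotv g z * a ^+ 2
    + 146 * N ^+ 2 * T * enorm z ^+ 2 * a ^+ 2)
  + 2 * T * a * ((1 - chi rho z) * (T - eta (x - z)) * w (x - z)).
Proof.
have far := @far_pointwise R T (eta (x - z)) a (P (x - z)) (P (x - z) - w (x - z))
  (ltW T0) (eta0 _) (aS _).
rewrite -/(E z) subKr in far.
have c1 := chi_le1 rho z; have c2 := chi_ge0 rho z.
have [zr|zr] := leP rho (enorm z).
  by rewrite (chi_eq0 rho0 zr) mul0r add0r subr0 mul1r.
have near : E z <= - (T ^+ 2 / 2) * Q z + 2 * T * dotv g z * a ^+ 2
    + 146 * N ^+ 2 * T * enorm z ^+ 2 * a ^+ 2.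
  apply: (@near_pointwise _ T (eta (x - z)) a _ _ (dotv g z)
    (eta (x - z) - T + dotv g z) tau (enorm z) c N) => //.
  - exact: ltW.
  - exact: enorm_ge0.
  - exact: ltW.
  - exact: ltW.
  - ring.
  - by apply: le_trans (dotv_le _ _) _; rewrite ler_wpM2r ?enorm_ge0.
  - by have := C11_taylor etaC x (- z); rewrite dotvNr enormN opprK.
have h1 := ler_wpM2l c2 near.
have c3 : 0 <= 1 - chi rho z by rewrite subr_ge0.
have h2 := ler_wpM2l c3 far.
lra.
Qed.

Let bw : bm w.
Proof.
apply: bm_diff_quot uB.
by apply: continuous_measurable_rV openT _ => y _; exact: cu.
Qed.

Let bU : bm U.
Proof. by split=> //; exists Bu => y; exact: seg_avg_le. Qed.

Let beta : bm eta. Proof. exact: bm_C11 etaC. Qed.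

Let bQ : bm Q.
Proof.
apply: bmD; first by apply: bmX; apply: bmB (bm_reflect _ bP) (bm_cst _).
by apply: bmM (bm_cst _) _; apply: bmB (bm_reflect _ bP) (bm_reflect _ bw).
Qed.

Let bdU : bm dU.
Proof. by apply: bmB (bm_reflect _ bU) (bm_cst _). Qed.

Let bE : bm E.
Proof.
apply: bmD; last first.
  apply: bmM; last by apply: bmX; exact: bm_reflect.
  by apply: bmB (bm_cst _) _; apply: bmX; exact: bm_reflect.
apply: bmB.
  by apply: bmM (bm_cst _) _; apply: bmX; apply: bmB (bm_reflect _ bP) (bm_cst _).
apply: bmM (bm_cst _) _; apply: bmM (bm_cst _) _.
by apply: bmB (bm_reflect _ bP) (bm_reflect _ bw).
Qed.

Let bchi : bm (@chi R n rho).
Proof.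
split; first exact: measurable_chi.
by exists 1 => z; rewrite ger0_norm ?chi_le1 ?chi_ge0.
Qed.

Let G z := (1 - chi rho z) * (T - eta (x - z)) * k z.

(** The origin is set apart because k is differentiable only away from it; G vanishes on a
    neighbourhood of it. *)
Let G' z := if z == 0 then 0 else
  (- dchi rho h z * (T - eta (x - z)) + (1 - chi rho z) * dotv (gradient eta (x - z)) h) * k z
  + (1 - chi rho z) * (T - eta (x - z)) * dotv (gradient k z) h.

(** The far weight vanishes where chi = 1, hence does not see the truncation: one integration by
    parts serves all r <= rho/2. *)
Let G_trunc r z : r <= rho / 2 -> (1 - chi rho z) * (T - eta (x - z)) * tker K r z = G z.
Proof.
move=> rr; rewrite /G /tker; case: ifPn => // ; rewrite -leNgt => zr.
by rewrite chi_eq1// ?subrr ?mul0r ?mulr0// (le_trans zr).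
Qed.

Let G_eq0 z : enorm z <= rho / 2 -> G z = 0.
Proof. by move=> hz; rewrite /G chi_eq1// subrr !mul0r. Qed.

Let G'_eq0 z : enorm z <= rho / 2 -> G' z = 0.
Proof.
move=> hz; rewrite /G'; case: eqP => // _.
by rewrite chi_eq1// subrr dchi_eq0// oppr0 !(mul0r, addr0).
Qed.

Let dG z : is_derive z h G (G' z).
Proof.
have [z0|z0] := eqVneq z 0.
  have cv : (fun t : R => t^-1 *: ((G \o shift z) (t *: h) - G z)) @ 0^' --> G' z.
    rewrite G'_eq0; last by rewrite z0 enorm0 divr_ge0// ltW.
    apply: cvg_near_cst; near=> t.
    rewrite z0 /= addr0 !G_eq0 ?subrr ?scaler0 ?enorm0 ?divr_ge0 ?(ltW rho0)//.
    rewrite enormZ -ler_pdivlMr//; near: t; apply: dnbhs0_le; rewrite !divr_gt0//.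
  by split; [exact: (cvgP _ cv)|exact: (cvg_lim (@Rhausdorff R) cv)].
have dchi := is_derive_chi rho h z.
have [dk _] := kernel_gradient kc h z0.
have [de _ _ _] := etaC.
have deta : is_derive z h (fun z => eta (x - z)) (dotv (gradient eta (x - z)) (- h)).
  by apply: is_derive_reflect; exact: differentiable_is_derive.
have d1 := is_deriveB (is_derive_cst (1 : R) z h) dchi.
have d2 := is_deriveB (is_derive_cst T z h) deta.
have d3 := is_deriveM (is_deriveM d1 d2) dk.
apply: is_derive_eq d3 _.
rewrite /G' (negbTE z0) !fctE /= /GRing.scale/= dotvNr !sub0r opprK /k.
ring.
Unshelve. all: by end_near. Qed.

(** For |z| > rho/2 one has tau < 2|z|/c, so 2 N tau + N |z| is at most (4 N/c + N)|z|, and c <= 1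
    gives 5 N/c. In [Bc], 12 is 11 from the derivative of chi plus 1 from that of eta, and [Lam]
    comes from the gradient of the kernel. *)
Let L := 5 * N / c.
Let Bc := L * (12 + Lam).
Let m z : R := Num.min (enorm z) 1.

Let c1 : c <= 1.
Proof.
have : 24 * c <= 24 * N * c by rewrite -mulrA ler_pM2l// ler_peMl// ltW.
by move: Nc; lra.
Qed.

Let m_ge0 z : 0 <= m z.
Proof. by rewrite le_min enorm_ge0 ler01. Qed.

Let NL : N <= L.
Proof. by rewrite /L ler_pdivlMr//; have := ler_wpM2l (ltW N0) c1; move: N0; lra. Qed.

Let L0 : 0 < L. Proof. exact: lt_le_trans NL. Qed.

Let Bc0 : 0 < Bc. Proof. by rewrite mulr_gt0// ltr_pwDl. Qed.

Let tau_le z : rho / 2 < enorm z -> 2 * N * tau + N * enorm z <= L * enorm z.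
Proof.
rewrite /rho => hz.
have h1 : c * tau <= 2 * enorm z by lra.
rewrite /L -(ler_pM2l c0) (_ : c * (5 * N / c * enorm z) = 5 * N * enorm z); last first.
  by field; rewrite gt_eqF.
have h2 := ler_wpM2l (ltW N0) h1.
have h3 : N * enorm z * c <= N * enorm z by rewrite ler_piMr// mulr_ge0 ?enorm_ge0// ltW.
lra.
Qed.

(** The linear Taylor term, of size tau |z|, is already quadratic in |z| on this range by [tau_le];
    for |z| > 1 the Lipschitz bound takes over. *)
Let eta_le z : rho / 2 < enorm z -> `|T - eta (x - z)| <= L * m z * enorm z.
Proof.
move=> hz; rewrite distrC /T.
have h1 := C11_lip etaC x (- z); rewrite enormN in h1.
have h2 := C11_taylor etaC x (- z); rewrite enormN dotvNr opprK in h2.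
have e0 := enorm_ge0 z.
rewrite /m; case: (leP (enorm z) 1) => z1; last first.
  by rewrite mulr1; apply: le_trans h1 _; rewrite ler_wpM2r.
rewrite -mulrA.
have h3 : `|dotv g z| <= 2 * N * tau * enorm z.
  by apply: le_trans (dotv_le _ _) _; rewrite ler_wpM2r.
rewrite -[eta (x - z) - eta x](addrK (dotv g z)).
apply: le_trans (ler_normB _ _) _.
have h4 := ler_wpM2r e0 (tau_le hz).
lra.
Qed.

Let deta_le z : rho / 2 < enorm z ->
  `|dotv (gradient eta (x - z)) h| <= L * m z * enorm h.
Proof.
move=> hz; apply: le_trans (dotv_le _ _) _; rewrite ler_wpM2r ?enorm_ge0//.
have [_ _ gN gL] := etaC.
rewrite /m; case: (leP (enorm z) 1) => z1.
  have h1 := gL (x - z) x; rewrite addrAC subrr sub0r enormN in h1.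
  rewrite -[gradient eta (x - z)](subrK g).
  apply: le_trans (enormD _ _) _.
  have := tau_le hz; have := gradient_le; rewrite /g in h1 *; lra.
by rewrite mulr1; apply: le_trans (gN _) NL.
Qed.

Let G'_le z : `|G' z| <= enorm h * Bc * m z * tker K (rho / 2) z.
Proof.
have [hz|hz] := leP (enorm z) (rho / 2).
  rewrite G'_eq0// normr0 mulr_ge0 ?(tker_ge0 kc)// mulr_ge0// mulr_ge0 ?enorm_ge0//.
  exact: ltW.
have ez : 0 < enorm z by apply: le_lt_trans hz; rewrite divr_ge0// ltW.
have z0 : z != 0 by rewrite -enorm_gt0.
rewrite /tker hz /G' (negbTE z0) -/(k z).
have k0 : 0 <= k z := kernel_ge0 kc z.
have [_ dk] := kernel_gradient kc h z0.
have e1 := eta_le hz; have e2 := deta_le hz.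
have d1 := dchi_le rho0 h z.
have c2 := chi_le1 rho z; have c3 := chi_ge0 rho z.
have m0 := m_ge0 z; have hh := enorm_ge0 h.
have x1 : `|1 - chi rho z| <= 1 by rewrite ger0_norm; lra.
have t1 : `|- dchi rho h z * (T - eta (x - z))| <= 11 * (L * m z * enorm h).
  rewrite normrM normrN.
  apply: le_trans (ler_wpM2l (normr_ge0 _) e1) _.
  have Lm : 0 <= L * m z by rewrite mulr_ge0// ltW.
  have := ler_wpM2l Lm d1; lra.
have t2 : `|(1 - chi rho z) * dotv (gradient eta (x - z)) h| <= L * m z * enorm h.
  rewrite normrM -[leRHS]mul1r; exact: ler_pM.
have t3 : `|(1 - chi rho z) * (T - eta (x - z)) * dotv (gradient k z) h|
    <= L * m z * Lam * k z * enorm h.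
  rewrite -mulrA normrM -[leRHS]mul1r; apply: ler_pM => //.
  rewrite normrM; apply: le_trans (ler_pM (normr_ge0 _) (normr_ge0 _) e1 dk) _.
  rewrite le_eqVlt; apply/orP; left; apply/eqP; rewrite -/(k z).
  by field; rewrite gt_eqF.
apply: le_trans (ler_normD _ _) _; rewrite normrM (ger0_norm k0).
have t4 := ler_wpM2r k0 (le_trans (ler_normD _ _) (lerD t1 t2)).
apply: le_trans (lerD t4 t3) _.
rewrite le_eqVlt; apply/orP; left; apply/eqP; rewrite /Bc; ring.
Qed.

Let G_le z : `|G z| <= 2 * N * tker K (rho / 2) z.
Proof.
have [hz|hz] := leP (enorm z) (rho / 2).
  by rewrite G_eq0// normr0 mulr_ge0 ?(tker_ge0 kc)// mulr_ge0// ltW.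
rewrite /G /tker hz -/(k z) !normrM (ger0_norm (kernel_ge0 kc z)).
rewrite ler_wpM2r ?(kernel_ge0 kc)//.
have c2 := chi_le1 rho z; have c3 := chi_ge0 rho z.
have x1 : `|1 - chi rho z| <= 1 by rewrite ger0_norm; lra.
have [_ eN _ _] := etaC.
have e1 : `|T - eta (x - z)| <= 2 * N.
  by apply: le_trans (ler_normB _ _) _; have := eN x; have := eN (x - z); rewrite /T; lra.
by rewrite -[leRHS]mul1r; apply: ler_pM.
Qed.

Let mker r : 0 <= r -> measurable_fun setT (tker K r).
Proof. exact: (measurable_tker kc). Qed.

Let rho2 : 0 < rho / 2. Proof. by rewrite divr_gt0. Qed.

Let rint_Gw : summ G' /\
  rint (fun z => G z * w (x - z)) = (enorm h)^-1 * rint (fun z => G' z * dU z).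
Proof.
have mG : measurable_fun setT G.
  rewrite (_ : G = fun z => (1 - chi rho z) * (T - eta (x - z)) * tker K (rho / 2) z).
    apply: measurable_funM; last by apply: mker; exact: ltW.
    by have [] := bmM (bmB (bm_cst 1) bchi) (bmB (bm_cst T) (bm_reflect x beta)).
  by apply/funext => z; rewrite G_trunc.
pose C := 2 * N * Lam + enorm h * Bc * Lam.
have N20 : 0 <= 2 * N by rewrite mulr_ge0// ltW.
have hB0 : 0 <= enorm h * Bc by rewrite mulr_ge0 ?enorm_ge0// ltW.
have tl z : tker K (rho / 2) z <= Lam * tailw (- (2 * s)) (rho / 2) z.
  by apply: (tker_le kc); exact: ltW.
have tw z : 0 <= Lam * tailw (- (2 * s)) (rho / 2) z by rewrite mulr_ge0 ?tailw_ge0.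
have Gl z : `|G z| <= C * tailw (- (2 * s)) (rho / 2) z.
  apply: le_trans (G_le z) _; apply: le_trans (ler_wpM2l N20 (tl z)) _.
  by have := mulr_ge0 hB0 (tw z); rewrite /C; lra.
have G'l z : `|G' z| <= C * tailw (- (2 * s)) (rho / 2) z.
  apply: le_trans (G'_le z) _.
  have m1 : m z <= 1 by rewrite /m ge_min lexx orbT.
  have h1 : enorm h * Bc * m z <= enorm h * Bc by rewrite ler_piMr.
  apply: le_trans (ler_wpM2r (tker_ge0 kc _ _) h1) _.
  apply: le_trans (ler_wpM2l hB0 (tl z)) _.
  by have := mulr_ge0 N20 (tw z); rewrite /C; lra.
have s20 : - (2 * s) < 0 by rewrite oppr_lt0 mulr_gt0.
have [sG' E1] := rint_by_parts_kernel x (U x) cu uB mU mG s20 rho2 dG Gl G'l.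
split=> //; rewrite -E1 -rintZ.
  by congr rint; apply/funext => z; rewrite /w /diff_quot; ring.
have sG : summ G.
  by apply: (le_summ mG Gl); apply: summZ; exact: summ_powR_far.
have := summ_bm (bmM (bm_cst (enorm h)) (bm_reflect x bw)) sG.
apply: eq_integrable => // z _; rewrite /= /w /diff_quot; congr EFin.
by field; rewrite gt_eqF.
Qed.

Let J := rint (@jweight R n s).

Let dU_ge0 r : 0 <= rint (fun z => dU z ^+ 2 * tker K r z).
Proof. by apply: rint_ge0 => z; rewrite mulr_ge0 ?sqr_ge0 ?(tker_ge0 kc). Qed.

Let far_int r : 0 < r -> r <= rho / 2 ->
  2 * T * a * rint (fun z => G z * w (x - z)) <=
  T ^+ 2 * a ^+ 2 * (Lam * J) + Bc ^+ 2 * rint (fun z => dU z ^+ 2 * tker K r z).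
Proof.
move=> r0 rr; have [sG' ->] := rint_Gw.
have sGU : summ (fun z => G' z * dU z).
  by have := summ_bm bdU sG'; apply: eq_integrable => // z _ /=; rewrite mulrC.
have sj := summ_jweight (n := n) s0 s1.
have sd : summ (fun z => dU z ^+ 2 * tker K r z).
  by apply: summ_bm; [exact: bmX|exact: (summ_tker s0 kc)].
have sJ : summ (fun z => T ^+ 2 * a ^+ 2 * (Lam * jweight s z)) := summZ _ (summZ _ sj).
have sD : summ (fun z => Bc ^+ 2 * (dU z ^+ 2 * tker K r z)) := summZ _ sd.
rewrite [leLHS]mulrA -(rintZ _ sGU) -(rintZ (Bc ^+ 2) sd).
rewrite (_ : Lam * J = rint (fun z => Lam * jweight s z)); last by rewrite rintZ.
rewrite -(rintZ _ (summZ Lam sj)) -rintD//.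
apply: le_rint; [exact: summZ|exact: summD|].
move=> z.
have g1 := G'_le z.
have m0 := m_ge0 z.
have k1 : tker K (rho / 2) z <= tker K r z.
  rewrite /tker; case: ifPn => [hz|_]; first by rewrite ifT// (le_lt_trans rr).
  exact: (tker_ge0 kc).
have k0 : 0 <= tker K (rho / 2) z := tker_ge0 kc _ _.
have mk : m z ^+ 2 * tker K (rho / 2) z <= Lam * jweight s z.
  rewrite /jweight mulrCA ler_wpM2l ?sqr_ge0//.
  apply: le_trans (tker_le kc _ (ltW rho2)) _; rewrite ler_wpM2l//.
  by rewrite /tailw; case: ifPn => // _; exact: powR_ge0.
apply: (@le_trans _ _ (2 * (T * `|a| * m z) * (Bc * `|dU z|) * tker K (rho / 2) z)).
  apply: le_trans (ler_norm _) _; rewrite normrM [`|G' z * _|]normrM.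
  rewrite [`|2 * T * a / _|]normrM [`|2 * T * a|]normrM.
  rewrite (ger0_norm (_ : 0 <= 2 * T)); last by rewrite mulr_ge0// ltW.
  rewrite (ger0_norm (_ : 0 <= (enorm h)^-1)) ?invr_ge0 ?enorm_ge0//.
  have q0 : 0 <= 2 * T * `|a| / enorm h.
    by rewrite divr_ge0 ?enorm_ge0// mulr_ge0// mulr_ge0// ltW.
  apply: le_trans (ler_wpM2l q0 (ler_wpM2r (normr_ge0 (dU z)) g1)) _.
  by rewrite le_eqVlt; apply/orP; left; apply/eqP; field; rewrite gt_eqF.
have da : dU z ^+ 2 = `|dU z| ^+ 2 by rewrite real_normK ?num_real.
have aa : a ^+ 2 = `|a| ^+ 2 by rewrite real_normK ?num_real.
(* The factor m stays with a, making that half summable against the untruncated weight uniformly in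
   r and rho. *)
have amgm : 2 * (T * `|a| * m z) * (Bc * `|dU z|) <=
   T ^+ 2 * a ^+ 2 * m z ^+ 2 + Bc ^+ 2 * dU z ^+ 2.
  by rewrite da aa; have := sqr_ge0 (T * `|a| * m z - Bc * `|dU z|); lra.
apply: le_trans (ler_wpM2r k0 amgm) _.
have Ta : 0 <= T ^+ 2 * a ^+ 2 by rewrite mulr_ge0 ?sqr_ge0.
have h1 := ler_wpM2l Ta mk.
have Bd : 0 <= Bc ^+ 2 * dU z ^+ 2 by rewrite mulr_ge0 ?sqr_ge0.
have h2 := ler_wpM2l Bd k1.
lra.
Qed.

(** The constant of [summ_powR_near] for the exponent 2 - 2 s. It is a parameter because c is chosen
    in terms of it. *)
Variable C1 : R.
Hypothesis nearC : forall r : R, 0 < r ->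
  let f (z : 'rV[R]_n) :=
    if 0 < enorm z <= r then enorm z `^ (2 - 2 * s - n%:R) else 0 in
  summ f /\ rint f <= C1 * r `^ (2 - 2 * s).

Let summ_bm_tker (f : 'rV[R]_n -> R) (r : R) : bm f -> 0 < r -> summ (fun z => f z * tker K r z).
Proof. by move=> bf r0; apply: summ_bm => //; exact: (summ_tker s0 kc). Qed.

(** One bound covers the two unbounded multipliers [dotv g z] and [enorm z ^+ 2], which count only
    where chi is nonzero. *)
Let chi_tker (f : 'rV[R]_n -> R) (r : R) :
  (forall z, `|f z| <= N * 2 * tau * rho + rho ^+ 2 \/ rho <= enorm z) ->
  measurable_fun setT f -> 0 < r -> summ (fun z => chi rho z * f z * tker K r z).
Proof.
move=> fb mf r0; apply: summ_bm_tker => //; split.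
  by apply: measurable_funM => //; exact: measurable_chi.
exists (N * 2 * tau * rho + rho ^+ 2) => z.
have M0 : 0 <= N * 2 * tau * rho + rho ^+ 2.
  by rewrite addr_ge0 ?sqr_ge0// !mulr_ge0// ltW.
have [fz|fz] := fb z; last by rewrite chi_eq0// mul0r normr0.
rewrite normrM (ger0_norm (chi_ge0 _ _)) -[leRHS]mul1r.
by apply: ler_pM => //; [exact: chi_ge0|exact: chi_le1].
Qed.

Let summ_chi_lin (r : R) : 0 < r -> summ (fun z => chi rho z * dotv g z * tker K r z).
Proof.
move=> r0; apply: chi_tker => //.
  move=> z; have [zr|zr] := leP rho (enorm z); [by right|left].
  apply: le_trans (dotv_le _ _) _.
  apply: (@le_trans _ _ (2 * N * tau * rho)).
    by apply: ler_pM; rewrite ?enorm_ge0// ltW.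
  by have := sqr_ge0 rho; lra.
rewrite /dotv; apply: measurable_sum => i; apply: measurable_funM => //.
exact: measurable_coord_rV.
Qed.

Let summ_chi_sqr (r : R) : 0 < r -> summ (fun z => chi rho z * enorm z ^+ 2 * tker K r z).
Proof.
move=> r0; apply: chi_tker => //.
  move=> z; have [zr|zr] := leP rho (enorm z); [by right|left].
  rewrite ger0_norm ?sqr_ge0//.
  have : enorm z ^+ 2 <= rho ^+ 2 by apply: lerXn2r; rewrite ?nnegrE ?enorm_ge0// ltW.
  have : 0 <= N * 2 * tau * rho by rewrite !mulr_ge0// ltW.
  lra.
by apply: measurable_funX; exact: measurable_enorm.
Qed.

Let summ_chiQ (r : R) : 0 < r -> summ (fun z => chi rho z * Q z * tker K r z).
Proof. by move=> r0; apply: summ_bm_tker => //; exact: bmM. Qed.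

(** The cancellation is essential: for s >= 1/2 the absolute value of the linear term has no bound
    uniform in r. *)
Let odd_int (r : R) : 0 < r -> rint (fun z => chi rho z * dotv g z * tker K r z) = 0.
Proof.
move=> r0; have sf := summ_chi_lin r0.
have := rint_opp (summ_measurable sf).
rewrite (_ : (fun z => _) = (fun z => - (chi rho z * dotv g z * tker K r z))); last first.
  apply/funext => z; rewrite (tkerN kc) dotvNr.
  by rewrite (_ : chi rho (- z) = chi rho z); [ring|rewrite /chi enormN].
by rewrite rintN// => E1; lra.
Qed.

Let near_int (r : R) : 0 < r ->
  rint (fun z => chi rho z * enorm z ^+ 2 * tker K r z) <= Lam * (C1 * rho `^ (2 - 2 * s)).
Proof.
move=> r0; have [sf fC] := nearC rho0.
apply: le_trans (ler_wpM2l Lam0 fC); rewrite -rintZ//.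
apply: le_rint; [exact: summ_chi_sqr|exact: summZ|] => z.
have [zz|zz] := eqVneq z 0.
  by rewrite zz enorm0 expr0n /= mulr0 mul0r ltxx mulr0.
have ez : 0 < enorm z by rewrite enorm_gt0.
rewrite ez /=; have [zr|zr] := leP (enorm z) rho; last first.
  by rewrite chi_eq0 ?(ltW zr)// !mul0r mulr0.
have /andP[_ kL] := kernel_bounds kc zz.
have tk : tker K r z <= Lam * enorm z `^ (- (2 * s) - n%:R).
  by rewrite /tker; case: ifP => // _; rewrite mulr_ge0 ?powR_ge0.
have e2 : enorm z `^ (2 - 2 * s - n%:R) = enorm z ^+ 2 * enorm z `^ (- (2 * s) - n%:R).
  rewrite (_ : 2 - 2 * s - n%:R = 2 + (- (2 * s) - n%:R)); last by ring.
  by rewrite powRD ?powR_mulrn ?enorm_ge0// (gt_eqF ez) implybT.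
have e0 := sqr_ge0 (enorm z); have k0 := tker_ge0 kc r z.
apply: le_trans (ler_wpM2r k0 (_ : _ <= enorm z ^+ 2)) _.
  by rewrite ler_piMl ?chi_le1.
have := ler_wpM2l e0 tk; rewrite e2 mulrCA; exact.
Qed.

Let QN (r : R) := rint (fun z => chi rho z * Q z * tker K r z).
Let MU (r : R) := rint (fun z => dU z ^+ 2 * tker K r z).

Let QN_ge0 (r : R) : 0 <= QN r.
Proof.
by apply: rint_ge0 => z; rewrite mulr_ge0 ?(tker_ge0 kc)// mulr_ge0 ?chi_ge0.
Qed.

Let upper (r : R) : 0 < r -> r <= rho / 2 -> rint (fun z => E z * tker K r z) <=
  - (T ^+ 2 / 2) * QN r + 146 * N ^+ 2 * T * a ^+ 2 * (Lam * (C1 * rho `^ (2 - 2 * s)))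
  + T ^+ 2 * a ^+ 2 * (Lam * J) + Bc ^+ 2 * MU r.
Proof.
move=> r0 rr.
have f1 := summZ (- (T ^+ 2 / 2)) (summ_chiQ r0).
have f2 := summZ (2 * T * a ^+ 2) (summ_chi_lin r0).
have f3 := summZ (146 * N ^+ 2 * T * a ^+ 2) (summ_chi_sqr r0).
have [sG' _] := rint_Gw.
have sGw : summ (fun z => G z * w (x - z)).
  have := summ_bm (bmM (bmM (bmB (bm_cst 1) bchi) (bmB (bm_cst T) (bm_reflect x beta)))
    (bm_reflect x bw)) (summ_tker s0 kc r0).
  by apply: eq_integrable => // z _ /=; rewrite -(G_trunc z rr); congr EFin; ring.
have f4 := summZ (2 * T * a) sGw.
have n2 : 0 <= 146 * N ^+ 2 * T * a ^+ 2.
  apply: mulr_ge0; last exact: sqr_ge0.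
  apply: mulr_ge0; last exact: ltW.
  by apply: mulr_ge0; [exact: ler0n|exact: sqr_ge0].
have b3 := ler_wpM2l n2 (near_int r0).
have b4 := far_int r0 rr.
have b2 := odd_int r0.
apply: (@le_trans _ _ (- (T ^+ 2 / 2) * QN r
   + 2 * T * a ^+ 2 * rint (fun z => chi rho z * dotv g z * tker K r z)
   + 146 * N ^+ 2 * T * a ^+ 2 * rint (fun z => chi rho z * enorm z ^+ 2 * tker K r z)
   + 2 * T * a * rint (fun z => G z * w (x - z)))); last first.
  by rewrite b2 mulr0 addr0 /MU; lra.
rewrite /QN -(rintZ _ (summ_chiQ r0)) -(rintZ _ (summ_chi_lin r0)).
rewrite -(rintZ _ (summ_chi_sqr r0)) -(rintZ _ sGw).
have f12 := summD f1 f2; have f123 := summD f12 f3.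
rewrite -(rintD f1 f2) -(rintD f12 f3) -(rintD f123 f4).
apply: le_rint; [exact: summ_bm_tker|exact: summD|].
move=> z; apply: le_trans (ler_wpM2r (tker_ge0 kc r z) (E_le z)) _.
rewrite -(G_trunc z rr) le_eqVlt; apply/orP; left; apply/eqP; ring.
Qed.

Hypothesis n0 : (0 < n)%N.

Let bc : R := @bump_const R n.

Let bc0 : 0 < bc. Proof. exact: bump_const_gt0. Qed.

Let p := - (2 * s) - n%:R.

Let p0 : p <= 0.
Proof.
have : 0 <= n%:R :> R by [].
by move: s0; rewrite /p; lra.
Qed.

Let lp0 : 0 < lam * rho `^ p. Proof. by rewrite mulr_gt0// powR_gt0. Qed.

(** The only use of the lower bound on K: on the annulus K is at least lam rho^(-2s-n), so integrals
    against phi are bounded by integrals against the kernel. *)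
Let supp_tker (r : R) z : 0 < r -> r <= rho / 4 -> rho / 4 < enorm z < rho / 2 ->
  1 <= (lam * rho `^ p)^-1 * tker K r z.
Proof.
move=> r0 rr /andP[z1 z2].
have ez : 0 < enorm z by apply: le_lt_trans z1; rewrite divr_ge0// ltW.
have zz : z != 0 by rewrite -enorm_gt0.
rewrite mulrC ler_pdivlMr// mul1r /tker (le_lt_trans rr z1).
have /andP[kl _] := kernel_bounds kc zz.
apply: le_trans kl; rewrite ler_pM2l//; apply: le_powR_neg => //.
by have := ltW rho0; lra.
Qed.

Let interp (r : R) : 0 < r -> r <= rho / 4 ->
  a ^+ 2 * (bc * lam) * rho `^ (- (2 * s)) <= 2 * (QN r + MU r / rho ^+ 2).
Proof.
move=> r0 rr; pose Cp := (lam * rho `^ p)^-1.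
have Cp0 : 0 < Cp by rewrite invr_gt0.
have phi_tker z : phi rho z <= Cp * tker K r z.
  have [hz|hz] := boolP (rho / 4 < enorm z < rho / 2).
    by apply: le_trans (phi_le1 rho z) _; exact: supp_tker.
  by have [-> _] := phi_supp rho0 h hz; rewrite mulr_ge0 ?(tker_ge0 kc)// ltW.
have sphi : summ (@phi R n rho).
  apply: le_summ (summZ Cp (summ_tker s0 kc r0)); first exact: measurable_phi.
  by move=> z; rewrite ger0_norm ?phi_ge0.
have tail_ge z : rho / 4 < enorm z < rho / 2 ->
    1 <= (rho `^ p)^-1 * tailw (- (2 * s)) (rho / 4) z.
  move=> /andP[z1 z2]; have rp : 0 < rho `^ p by rewrite powR_gt0.
  rewrite mulrC ler_pdivlMr// mul1r /tailw z1; apply: le_powR_neg => //.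
    by apply: le_lt_trans z1; rewrite divr_ge0// ltW.
  by have := ltW rho0; lra.
have rp0 : 0 <= (rho `^ p)^-1 by rewrite invr_ge0 powR_ge0.
have hr0 : 0 <= enorm h / rho by rewrite divr_ge0 ?enorm_ge0// ltW.
pose C := (rho `^ p)^-1 + enorm h / rho * (rho `^ p)^-1.
have Cl : (rho `^ p)^-1 <= C by rewrite lerDl mulr_ge0.
have phil z : `|phi rho z| <= C * tailw (- (2 * s)) (rho / 4) z.
  have [hz|hz] := boolP (rho / 4 < enorm z < rho / 2).
    rewrite ger0_norm ?phi_ge0//; apply: le_trans (phi_le1 rho z) _.
    by apply: le_trans (tail_ge z hz) _; rewrite ler_wpM2r ?tailw_ge0.
  have [-> _] := phi_supp rho0 h hz; rewrite normr0 mulr_ge0 ?tailw_ge0//.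
  exact: le_trans Cl.
have dphil z : `|dphi rho h z| <= C * tailw (- (2 * s)) (rho / 4) z.
  have [hz|hz] := boolP (rho / 4 < enorm z < rho / 2).
    have [q [q0 qE qd]] := dphi_le rho0 h z.
    have q1 : q <= 1.
      by have := phi_le1 rho z; rewrite qE -[X in _ <= X](expr1n _ 2) ler_pXn2r ?nnegrE.
    apply: le_trans qd _; rewrite -mulrA.
    apply: (@le_trans _ _ (enorm h / rho)); first by rewrite ler_piMl.
    apply: (@le_trans _ _ (enorm h / rho * ((rho `^ p)^-1 * tailw (- (2 * s)) (rho / 4) z))).
      by rewrite ler_peMr// tail_ge.
    by rewrite mulrA ler_wpM2r ?tailw_ge0// lerDr.
  have [_ ->] := phi_supp rho0 h hz; rewrite normr0 mulr_ge0 ?tailw_ge0//.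
  exact: le_trans Cl.
have s20 : - (2 * s) < 0 by rewrite oppr_lt0 mulr_gt0.
have mphi := @measurable_phi R n rho.
have rho4 : 0 < rho / 4 by rewrite divr_gt0.
have [sd Eibp] := rint_by_parts_kernel x (U x) cu uB mU mphi s20 rho4
  (is_derive_phi rho0 h) phil dphil.
have sphiQ : summ (fun z => Q z * phi rho z) by exact: summ_bm.
have sphiw : summ (fun z => w (x - z) * phi rho z).
  by apply: summ_bm => //; exact: bm_reflect.
have sdU : summ (fun z => dU z * dphi rho h z) by exact: summ_bm.
have sM : summ (fun z => dU z ^+ 2 * tker K r z) by apply: summ_bm_tker => //; exact: bmX.
have sQ := summ_chiQ r0.
have Ew : rint (fun z => w (x - z) * phi rho z) =
    (enorm h)^-1 * rint (fun z => dU z * dphi rho h z).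
  rewrite (_ : (fun z => w (x - z) * phi rho z) =
     (fun z => (enorm h)^-1 * (phi rho z * (u (x - z + h) - u (x - z))))); last first.
    by apply/funext => z; rewrite /w /diff_quot; ring.
  rewrite rintZ; last first.
    have := summZ (enorm h) sphiw; apply: eq_integrable => // z _ /=.
    by rewrite /w /diff_quot; congr EFin; field; rewrite gt_eqF.
  by rewrite Eibp; congr (_ * rint _); apply/funext => z; rewrite mulrC.
(* Young's inequality with the root p of phi from [dphi_le] attached to a, so that one half is again
   a multiple of a^2 phi. *)
have dbound : a * rint (fun z => w (x - z) * phi rho z) <=
    a ^+ 2 / 4 * rint (@phi R n rho) + Cp / rho ^+ 2 * MU r.
  rewrite Ew mulrA -(rintZ _ sdU) -(rintZ _ sphi) /MU -(rintZ _ sM).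
  rewrite -rintD; [|exact: summZ|exact: summZ].
  apply: le_rint; [exact: summZ|by apply: summD; exact: summZ|] => z.
  have [hz|hz] := boolP (rho / 4 < enorm z < rho / 2); last first.
    have [-> ->] := phi_supp rho0 h hz; rewrite !mulr0 add0r.
    apply: mulr_ge0; first by rewrite divr_ge0 ?sqr_ge0 ?(ltW Cp0).
    by rewrite mulr_ge0 ?sqr_ge0 ?(tker_ge0 kc).
  have [q [q0 qE qd]] := dphi_le rho0 h z.
  have k1 := supp_tker r0 rr hz; rewrite -/Cp in k1.
  have da : dU z ^+ 2 = `|dU z| ^+ 2 by rewrite real_normK ?num_real.
  have aa : a ^+ 2 = `|a| ^+ 2 by rewrite real_normK ?num_real.
  apply: (@le_trans _ _ (`|a| * q * (`|dU z| / rho))).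
    apply: le_trans (ler_norm _) _.
    rewrite normrM [`|a / _|]normrM [`|dU z * _|]normrM.
    rewrite (ger0_norm (_ : 0 <= (enorm h)^-1)) ?invr_ge0 ?enorm_ge0//.
    have t0 : 0 <= `|a| / enorm h * `|dU z| by rewrite mulr_ge0// divr_ge0 ?enorm_ge0.
    rewrite [leLHS]mulrA; apply: le_trans (ler_wpM2l t0 qd) _.
    rewrite le_eqVlt; apply/orP; left; apply/eqP; field.
    by rewrite !gt_eqF.
  apply: (@le_trans _ _ (a ^+ 2 / 4 * phi rho z + (`|dU z| / rho) ^+ 2)).
    by rewrite qE aa; have := sqr_ge0 (`|a| * q / 2 - `|dU z| / rho); lra.
  rewrite lerD2l expr_div_n -da.
  have d0 : 0 <= dU z ^+ 2 / rho ^+ 2 by rewrite divr_ge0 ?sqr_ge0.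
  have := ler_wpM2l d0 k1; rewrite mulr1 => h1; apply: le_trans h1 _.
  by rewrite le_eqVlt; apply/orP; left; apply/eqP; ring.
have qbound : rint (fun z => Q z * phi rho z) <= Cp * QN r.
  rewrite /QN -rintZ//; apply: le_rint => //; first exact: summZ.
  move=> z; have [hz|hz] := boolP (rho / 4 < enorm z < rho / 2).
    have k1 := supp_tker r0 rr hz; rewrite -/Cp in k1.
    have -> : chi rho z = 1 by case/andP: hz => _ /ltW; exact: chi_eq1.
    by have := ler_wpM2l (Q_ge0 z) (le_trans (phi_le1 rho z) k1); lra.
  have [-> _] := phi_supp rho0 h hz; rewrite mulr0.
  by rewrite mulr_ge0 ?(ltW Cp0)// mulr_ge0 ?(tker_ge0 kc)// mulr_ge0 ?chi_ge0.
have main : a ^+ 2 * rint (@phi R n rho) <= a ^+ 2 / 4 * rint (@phi R n rho)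
    + rint (fun z => Q z * phi rho z) + a * rint (fun z => w (x - z) * phi rho z).
  rewrite -!rintZ// -rintD//; last exact: summZ.
  rewrite -rintD; [|by apply: summD => //; exact: summZ|exact: summZ].
  apply: le_rint; [exact: summZ|by apply: summD; [apply: summD => //|]; exact: summZ|] => z.
  have f0 := phi_ge0 rho z.
  (* With d = P(x - z) - a, the right side minus the left side is the square of a/2 + d. *)
  have k1 : a ^+ 2 <= a ^+ 2 / 4 + Q z + a * w (x - z).
    by rewrite /Q; have := sqr_ge0 (a / 2 + (P (x - z) - a)); lra.
  by have := ler_wpM2r f0 k1; lra.
have low : bc * rho ^+ n <= rint (@phi R n rho) := rint_phi_ge rho0 n0 sphi.
have a2 : 0 <= a ^+ 2 by exact: sqr_ge0.
have low2 := ler_wpM2l a2 low.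
(* [main] and [dbound] each leave a quarter of a^2 on the right; absorbing both costs the factor
   2. *)
have fin : a ^+ 2 * (bc * rho ^+ n) <= 2 * Cp * (QN r + MU r / rho ^+ 2).
  rewrite [leRHS](_ : _ = 2 * (Cp * QN r + Cp / rho ^+ 2 * MU r)); last by ring.
  lra.
have lr := ltW lp0.
have := ler_wpM2l lr fin.
rewrite [X in _ <= X](_ : _ = 2 * (QN r + MU r / rho ^+ 2)); last first.
  rewrite /Cp; move: (gt_eqF lp0); move: (lam * rho `^ p) => y y0; field.
  by rewrite y0 gt_eqF.
apply: le_trans.
rewrite (_ : rho `^ (- (2 * s)) = rho `^ p * rho ^+ n).
  by rewrite le_eqVlt; apply/orP; left; apply/eqP; ring.
rewrite -powR_mulrn ?(ltW rho0)// -powRD; last by rewrite (gt_eqF rho0) implybT.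
by rewrite /p subrK.
Qed.

Let A0 := 4 * Lam / (bc * lam).

(* Combining upper and interp, the coefficient of a^2 is at most half of what
   the term - (T^2 / 2) QN can pay for, by the smallness of c. *)
Lemma core_inequality (sigma r : R) : rho <= 1 ->
  A0 * (146 * N ^+ 2 * C1 * c ^+ 2) <= 1 / 2 -> A0 * (J * rho `^ (2 * s)) <= 1 / 2 ->
  1 / c ^+ 4 + Bc ^+ 2 <= sigma -> 0 < r -> r <= rho / 4 ->
  rint (fun z => E z * tker K r z) <= sigma * MU r.
Proof.
move=> rho1 hA1 hA2 hs r0 rr.
have rr2 : r <= rho / 2 by have := ltW rho0; lra.
have h1 := upper r0 rr2; have h2 := interp r0 rr.
have M0 : 0 <= MU r := dU_ge0 r.
have Q0 := QN_ge0 r.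
pose y := rho `^ (2 * s).
have y0 : 0 < y by rewrite powR_gt0.
have e1 : rho `^ (- (2 * s)) = y^-1 by rewrite powRN.
have e2 : rho `^ (2 - 2 * s) = rho ^+ 2 / y.
  rewrite powRD ?powR_mulrn ?(ltW rho0)// ?powRN//.
  by rewrite (gt_eqF rho0) implybT.
rewrite e1 in h2; rewrite e2 in h1.
have b0 : 0 < bc * lam by rewrite mulr_gt0.
pose X := QN r + MU r / rho ^+ 2.
have X0 : 0 <= X by rewrite addr_ge0// divr_ge0 ?sqr_ge0.
have a2 : a ^+ 2 <= 2 * y / (bc * lam) * X.
  rewrite -(ler_pM2r b0) -(ler_pM2r (_ : 0 < y^-1)) ?invr_gt0//.
  apply: le_trans h2 _; rewrite -/X le_eqVlt; apply/orP; left; apply/eqP; field.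
  by rewrite !gt_eqF.
have C10 : 0 <= C1.
  have [_ /(le_trans (rint_ge0 _))] := nearC rho0.
  have rp : 0 < rho `^ (2 - 2 * s) by rewrite powR_gt0.
  by rewrite pmulr_lge0//; apply => z; case: ifP => // _; exact: powR_ge0.
have J0 : 0 <= J by apply: rint_ge0 => z; exact: jweight_ge0.
pose F := Lam * (146 * N ^+ 2 * T * (C1 * (rho ^+ 2 / y)) + T ^+ 2 * J).
have F0 : 0 <= F.
  rewrite mulr_ge0// addr_ge0//; last by rewrite mulr_ge0 ?sqr_ge0.
  apply: mulr_ge0; last by rewrite mulr_ge0// divr_ge0 ?sqr_ge0// ltW.
  by rewrite mulr_ge0 ?(ltW T0)// mulr_ge0 ?sqr_ge0.
have h3 := ler_wpM2r F0 a2.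
have TE2 : T = rho ^+ 2 / c ^+ 2.
  by rewrite TE /rho exprMn; field; rewrite gt_eqF.
have h4 : 2 * y / (bc * lam) * X * F <= rho ^+ 4 / c ^+ 4 / 2 * X.
  have -> : 2 * y / (bc * lam) * X * F =
     rho ^+ 4 / c ^+ 4 / 2 * X * (A0 * (146 * N ^+ 2 * C1 * c ^+ 2) + A0 * (J * y)).
    rewrite /F /A0 TE2; field.
    have := bc0 => bb.
    by rewrite !gt_eqF.
  rewrite ler_piMr//; last by rewrite -/y in hA2; lra.
  by rewrite mulr_ge0// divr_ge0// divr_ge0// exprn_ge0// ltW.
(* As T = rho^2 / c^2, the QN part matches exactly the negative term of [upper]; the MU part carries
   rho^2 / (2 c^4), at most 1 / c^4 because rho <= 1. *)
have h5 : rho ^+ 4 / c ^+ 4 / 2 * X <= T ^+ 2 / 2 * QN r + 1 / c ^+ 4 * MU r.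
  have -> : rho ^+ 4 / c ^+ 4 / 2 * X = T ^+ 2 / 2 * QN r + (rho ^+ 2 / 2) * (1 / c ^+ 4 * MU r).
    by rewrite /X TE2; field; rewrite !gt_eqF.
  rewrite lerD2l ler_piMl//.
    by rewrite mulr_ge0// divr_ge0// exprn_ge0// ltW.
  have : rho ^+ 2 <= 1 by rewrite exprn_ile1// ltW.
  lra.
apply: le_trans h1 _.
have h6 := ler_wpM2r M0 hs.
have E1 : 146 * N ^+ 2 * T * a ^+ 2 * (Lam * (C1 * (rho ^+ 2 / y))) + T ^+ 2 * a ^+ 2 * (Lam * J)
   = a ^+ 2 * F by rewrite /F; ring.
lra.
Qed.

End core.

(** * Choice of the constants and passage to the limit *)

Section constants.
Context {R : realType}.

(** C1 is fixed first and c is then the least of three thresholds, one per smallness condition. The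
    last condition has c N in place of rho because sqrt (eta x) <= N bounds rho uniformly in x. *)
Lemma core_constants n (s q N : R) : (0 < n)%N -> 0 < s -> s < 1 -> 0 <= q -> 1 <= N ->
  exists C1 c : R, [/\ 0 < c, 24 * N * c <= 1,
    forall r : R, 0 < r ->
      let f (z : 'rV[R]_n) :=
        if 0 < enorm z <= r then enorm z `^ (2 - 2 * s - n%:R) else 0 in
      summ f /\ rint f <= C1 * r `^ (2 - 2 * s),
    4 * q / @bump_const R n * (146 * N ^+ 2 * C1 * c ^+ 2) <= 1 / 2 &
    4 * q / @bump_const R n * (rint (@jweight R n s) * (c * N) `^ (2 * s)) <= 1 / 2].
Proof.
move=> n0 s0 s1 q0 N1.
have N0 : 0 < N by apply: lt_le_trans N1.
have g0 : 0 < 2 - 2 * s by lra.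
have [C1 C10 nearC] := @summ_powR_near R n _ g0.
have b0 : 0 < @bump_const R n by exact: bump_const_gt0.
have A0 : 0 <= 4 * q / @bump_const R n by rewrite divr_ge0 ?mulr_ge0// ltW.
have J0 : 0 <= rint (@jweight R n s) by apply: rint_ge0 => z; exact: jweight_ge0.
pose M1 := 4 * q / @bump_const R n * (146 * N ^+ 2 * C1).
pose M2 := 4 * q / @bump_const R n * rint (@jweight R n s).
have M10 : 0 <= M1.
  apply: mulr_ge0 => //; apply: mulr_ge0; last exact: ltW.
  by apply: mulr_ge0; [exact: ler0n|exact: sqr_ge0].
have M20 : 0 <= M2 by exact: mulr_ge0.
pose b := (2 * (M2 + 1))^-1.
have bp : 0 < b by rewrite invr_gt0; lra.
pose c1 := (24 * N)^-1; pose c2 := (2 * (M1 + 1))^-1; pose c3 := b `^ (2 * s)^-1 / N.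
have c1p : 0 < c1 by rewrite invr_gt0 mulr_gt0.
have c2p : 0 < c2 by rewrite invr_gt0; lra.
have c3p : 0 < c3 by rewrite divr_gt0// powR_gt0.
pose c := Num.min c1 (Num.min c2 c3).
have cp : 0 < c by rewrite !lt_min c1p c2p.
have cc1 : c <= c1 by rewrite ge_min lexx.
have cc2 : c <= c2 by rewrite !ge_min lexx orbT.
have cc3 : c <= c3 by rewrite !ge_min lexx !orbT.
exists C1, c; split=> //.
- have h : 0 < 24 * N by rewrite mulr_gt0.
  by have := ler_wpM2l (ltW h) cc1; rewrite /c1 mulfV ?gt_eqF.
- rewrite [leLHS](_ : _ = M1 * c ^+ 2); last by rewrite /M1; ring.
  have h2 : 2 * (M1 + 1) * c <= 1.
    have h : 0 < 2 * (M1 + 1) by lra.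
    by have := ler_wpM2l (ltW h) cc2; rewrite /c2 mulfV ?gt_eqF.
  have h3 := mulr_ge0 M10 (ltW cp).
  have c1' : c <= 1 by lra.
  have : M1 * c ^+ 2 <= M1 * c by rewrite ler_wpM2l// expr2 ler_piMl// ltW.
  lra.
- rewrite mulrA -/M2.
  have h1 : (c * N) `^ (2 * s) <= b.
    have s2 : 0 < 2 * s by rewrite mulr_gt0.
    have h : c * N <= b `^ (2 * s)^-1 by rewrite -ler_pdivlMr.
    have := ge0_ler_powR (ltW s2) _ _ h.
    rewrite !nnegrE -powRrM mulVf ?gt_eqF// powRr1 ?(ltW bp)//; apply.
      by rewrite mulr_ge0// ltW.
    exact: powR_ge0.
  have h2 := ler_wpM2l M20 h1.
  have h3 : 2 * (M2 + 1) * b = 1 by rewrite mulfV// gt_eqF//; lra.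
  lra.
Qed.

End constants.

(** * From truncated kernels to the operator *)

Section square_inequality.
Context {R : realType} {n : nat}.
Variables (s lam Lam : R) (K : 'rV[R]_n -> \bar R).
Hypotheses (s0 : 0 < s) (kc : kernel_class s lam Lam K).
Variables (eta : 'rV[R]_n -> R) (N : R).
Hypotheses (etaC : C11_bound eta N).
Variables (u : 'rV[R]_n -> R) (h : 'rV[R]_n) (Bu al : R).
Hypotheses (sal : s < al) (al1 : al <= 1) (ru : regl al u) (uB : forall x, `|u x| <= Bu).
Let w := diff_quot h u.
Let U := seg_avg h u.
Variables (P : 'rV[R]_n -> R) (x : 'rV[R]_n) (sigma : R).
Hypotheses (bP : bm P) (rP : reg al (fun y => P y ^+ 2)) (Pw : P x * w x = P x ^+ 2).

Let al0 : 0 < al. Proof. exact: lt_trans sal. Qed.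

(** For each r the truncated left side is the truncated right side plus the integral assumed to be
    nonpositive, an identity resting only on P w = P^2 at x. All three principal values exist, so
    the inequality passes to the limit. *)
Lemma Lop_square_le :
  (\forall r \near 0^'+, rint (fun z => (- eta x ^+ 2 * (P (x - z) - P x) ^+ 2
     - 2 * eta x ^+ 2 * (P x * (P (x - z) - w (x - z)))
     + (eta x ^+ 2 - eta (x - z) ^+ 2) * P (x - z) ^+ 2) * tker K r z)
    <= sigma * rint (fun z => (U (x - z) - U x) ^+ 2 * tker K r z)) ->
  Lop K (fun y => eta y ^+ 2 * P y ^+ 2 + sigma * U y ^+ 2) x
  <= 2 * eta x ^+ 2 * Lop K w x * P x + 2 * sigma * Lop K U x * U x.
Proof.
move=> near_le; set F := fun y => _.
have rw : reg al w by exact: reg_diff_quot (regl_reg ru).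
have rU : reg al U by exact: reg_seg_avg.
have re : reg al eta by exact: C11_reg etaC _ al0 al1.
have mu_ : measurable_fun setT u := reg_measurable al0 (regl_reg ru).
have bU : bm U.
  split; first exact: reg_measurable al0 rU.
  by exists Bu => y; apply: seg_avg_le => //; exact: reg_continuous al0 (regl_reg ru).
have be : bm eta := bm_C11 etaC.
have bw : bm w := bm_diff_quot h mu_ uB.
have bF : bm F.
  apply: bmD; apply: bmM; [exact: bmX|exact: bmX|exact: bm_cst|exact: bmX].
have rF : reg al F.
  apply: regD; last by apply: regZ; under eq_fun do rewrite expr2; apply: regM => //; exact: ltW.
  apply: regM => //; first exact: ltW.
  by under eq_fun do rewrite expr2; apply: regM => //; exact: ltW.
have cv f : bm f -> reg al f -> trunc_op K r f x @[r --> 0^'+] --> Lop K f x.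
  move=> [mf [B fB]] rf; have [C fC] := rf x.
  exact: (Lop_cvg s0 kc sal mf fB fC).
have cR : 2 * eta x ^+ 2 * trunc_op K r w x * P x + 2 * sigma * trunc_op K r U x * U x
    @[r --> 0^'+] --> 2 * eta x ^+ 2 * Lop K w x * P x + 2 * sigma * Lop K U x * U x.
  by apply: cvgD; apply: cvgM (cvg_cst _); apply: cvgM (cvg_cst _) _; exact: cv.
apply: (ler_cvg_to (cv F bF rF) cR); near=> r.
have r0 : 0 < r by [].
have st := summ_tker s0 kc r0.
have sF f : bm f -> summ (fun z => (f x - f (x - z)) * tker K r z).
  by move=> bf; apply: summ_bm => //; apply: bmB (bm_cst _) (bm_reflect _ bf).
pose E z := - eta x ^+ 2 * (P (x - z) - P x) ^+ 2
     - 2 * eta x ^+ 2 * (P x * (P (x - z) - w (x - z)))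
     + (eta x ^+ 2 - eta (x - z) ^+ 2) * P (x - z) ^+ 2.
have sE : summ (fun z => E z * tker K r z).
  apply: summ_bm => //; apply: bmD; first apply: bmB.
  - by apply: bmM (bm_cst _) _; apply: bmX; apply: bmB (bm_reflect _ bP) (bm_cst _).
  - apply: bmM (bm_cst _) _; apply: bmM (bm_cst _) _.
    by apply: bmB (bm_reflect _ bP) (bm_reflect _ bw).
  apply: bmM; last by apply: bmX; exact: bm_reflect.
  by apply: bmB (bm_cst _) _; apply: bmX; exact: bm_reflect.
have sD : summ (fun z => (U (x - z) - U x) ^+ 2 * tker K r z).
  by apply: summ_bm => //; apply: bmX; apply: bmB (bm_reflect _ bU) (bm_cst _).
pose A := 2 * eta x ^+ 2 * P x; pose B := 2 * sigma * U x.
have -> : trunc_op K r F x = A * trunc_op K r w x + B * trunc_op K r U x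
    + (rint (fun z => E z * tker K r z)
       - sigma * rint (fun z => (U (x - z) - U x) ^+ 2 * tker K r z)).
  rewrite -(rintZ _ (sF _ bw)) -(rintZ _ (sF _ bU)) -(rintZ _ sD).
  have s1 := summD (summZ A (sF _ bw)) (summZ B (sF _ bU)).
  have s2 := summB sE (summZ sigma sD).
  rewrite -(rintD (summZ A (sF _ bw)) (summZ B (sF _ bU))) -(rintB sE (summZ sigma sD)).
  rewrite -(rintD s1 s2); congr rint; apply/funext => z.
  have T2 : eta x ^+ 2 * (P x * w x) = eta x ^+ 2 * P x ^+ 2 by rewrite Pw.
  have := congr1 ( *%R^~ (tker K r z)) T2 => /=.
  by rewrite /F /E /A /B; move: (w x) (w _) (U x) (U _) (P x) (P _) => a1 a2 a3 a4 a5 a6; lra.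
have : rint (fun z => E z * tker K r z)
    <= sigma * rint (fun z => (U (x - z) - U x) ^+ 2 * tker K r z).
  by near: r.
by rewrite /A /B; lra.
Unshelve. all: by end_near. Qed.

End square_inequality.

(** The side conditions follow the existential, so that choice can turn the threshold into a total
    function of n, s, q, m and N; out of range its value is 1. *)
Lemma sigma0_exists {R : realType} (n : nat) (s q m N : R) : exists sigma0 : R, 0 < sigma0 /\
  ((0 < n)%N -> 0 < s -> s < 1 -> 1 <= N ->
  forall (lam Lam : R) (K : 'rV[R]_n -> \bar R), kernel_class s lam Lam K ->
    0 < lam -> lam <= Lam -> q = Lam / lam -> lam <= m ->
  forall eta : 'rV[R]_n -> R, C11_bound eta N -> (forall x, 0 <= eta x) ->
  forall (u : 'rV[R]_n -> R) (h : 'rV[R]_n) (Bu : R),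
    continuous u -> (forall x, `|u x| <= Bu) -> h != 0 ->
    measurable_fun setT (seg_avg h u) ->
  forall (P : 'rV[R]_n -> R) (x : 'rV[R]_n) (sigma : R), bm P ->
    (forall y, 0 <= P x * (P y - diff_quot h u y)) -> sigma0 <= sigma ->
  \forall r \near 0^'+, rint (fun z => (- eta x ^+ 2 * (P (x - z) - P x) ^+ 2
     - 2 * eta x ^+ 2 * (P x * (P (x - z) - diff_quot h u (x - z)))
     + (eta x ^+ 2 - eta (x - z) ^+ 2) * P (x - z) ^+ 2) * tker K r z)
    <= sigma * rint (fun z => (seg_avg h u (x - z) - seg_avg h u x) ^+ 2 * tker K r z)).
Proof.
have [H|H] := asboolP [/\ (0 < n)%N, 0 < s, s < 1, 1 <= N & 0 <= q]; last first.
  exists 1; split=> // n0 s0 s1 N1 lam Lam K kc l0 lL qE.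
  by case: H; split=> //; rewrite qE divr_ge0 ?ltW// (lt_le_trans l0).
have [n0 s0 s1 N1 q0] := H.
have [C1 [c [c0 Nc nearC hA1 hA2]]] := core_constants n0 s0 s1 q0 N1.
have N0 : 0 < N by apply: lt_le_trans N1.
(* Since Lam = q lam and lam <= m, the product q |m| bounds [Lam] in the constant [Bc]. *)
exists (1 / c ^+ 4 + (5 * N / c * (12 + q * `|m|)) ^+ 2); split.
  by rewrite ltr_pwDl ?sqr_ge0// divr_gt0// exprn_gt0.
move=> _ _ _ _ lam Lam K kc l0 lL qE lm eta etaC eta0 u h Bu cu uB h0 mU P x sigma bP aS hs.
have L0 : 0 < Lam by exact: lt_le_trans lL.
have sg0 : 0 <= sigma.
  by apply: le_trans hs; rewrite addr_ge0 ?sqr_ge0// divr_ge0// exprn_ge0// ltW.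
have D0 r : 0 <= rint (fun z => (seg_avg h u (x - z) - seg_avg h u x) ^+ 2 * tker K r z).
  by apply: rint_ge0 => z; rewrite mulr_ge0 ?sqr_ge0 ?(tker_ge0 kc).
have [ex|ex] := eqVneq (eta x) 0.
  near=> r; apply: le_trans (mulr_ge0 sg0 (D0 r)).
  have r0 : 0 < r by [].
  have be : bm eta := bm_C11 etaC.
  have sf : summ (fun z => eta (x - z) ^+ 2 * P (x - z) ^+ 2 * tker K r z).
    apply: summ_bm (summ_tker s0 kc r0).
    by apply: bmM; apply: bmX; exact: bm_reflect.
  rewrite [X in rint X](_ : _ =
    fun z => - (eta (x - z) ^+ 2 * P (x - z) ^+ 2 * tker K r z)); last first.
    by apply/funext => z; rewrite ex; ring.
  rewrite rintN// oppr_le0; apply: rint_ge0 => z.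
  by rewrite mulr_ge0 ?(tker_ge0 kc)// mulr_ge0 ?sqr_ge0.
have T0 : 0 < eta x by rewrite lt_neqAle eq_sym ex eta0.
pose tau := Num.sqrt (eta x).
have tau0 : 0 < tau by rewrite sqrtr_gt0.
have TE : eta x = tau ^+ 2 by rewrite sqr_sqrtr// ltW.
have tauN : tau <= N.
  have [_ eN _ _] := etaC.
  rewrite -ler_sqr ?nnegrE ?(ltW tau0) ?(ltW N0)// -TE.
  by apply: le_trans (ler_norm _) _; apply: le_trans (eN x) _; rewrite expr2 ler_peMl// ltW.
have ctN : c * tau <= c * N by rewrite ler_pM2l.
have LE : Lam = q * lam by rewrite qE divfK// gt_eqF.
have AE y : 4 * Lam / (y * lam) = 4 * q / y.
  by rewrite qE; have [->|y0] := eqVneq y 0; [rewrite mul0r !invr0 !mulr0|field; rewrite y0 gt_eqF].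
near=> r; apply: (core_inequality s0 s1 kc l0 (ltW L0) etaC N1 eta0 cu uB h0 mU bP aS TE tau0 c0
  Nc nearC n0) => //.
- by lra.
- by rewrite AE.
- rewrite AE; apply: le_trans hA2; apply: ler_wpM2l.
    by rewrite divr_ge0 ?mulr_ge0// ltW// bump_const_gt0.
  apply: ler_wpM2l; first by apply: rint_ge0 => z; exact: jweight_ge0.
  by apply: ge0_ler_powR => //; rewrite ?nnegrE ?mulr_ge0// ltW.
- apply: le_trans hs; rewrite lerD2l.
  have Nc0 : 0 <= 5 * N / c by rewrite divr_ge0 ?mulr_ge0// ltW.
  have Lm : Lam <= q * `|m|.
    by rewrite LE ler_wpM2l//; apply: le_trans lm (ler_norm _).
  have L12 : 0 <= 12 + Lam by rewrite addr_ge0// ltW.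
  apply: lerXn2r; rewrite ?nnegrE; [exact: mulr_ge0|apply: mulr_ge0 => //|].
    by lra.
  by apply: ler_wpM2l => //; rewrite lerD2l.
- near: r; apply: nbhs_right_le.
  by rewrite divr_gt0// mulr_gt0.
Unshelve. all: by end_near. Qed.

(* The argument Num.max 1 lam of sigma0 is 1 when lam <= 1; for large lam some
   dependence on it is unavoidable, see the remark at kernel_class. *)
Theorem proposition1p9 (R : realType) :
  exists sigma0 : nat -> R -> R -> R -> R -> R,
    (forall n s rho m N, 0 < sigma0 n s rho m N) /\
    forall (n : nat) (s0 s lam Lam eps : R) (K : 'rV[R]_n -> \bar R)
        (eta : 'rV[R]_n -> R) (h : 'rV[R]_n),
      (0 < n)%N -> 0 < s0 -> s0 < s -> s < 1 -> 0 < lam -> lam <= Lam ->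
      0 < eps -> kernel_class s lam Lam K ->
      C11 eta -> (forall x, 0 <= eta x) ->
      h != 0 -> enorm h <= 1 / 8 ->
      forall sigma : R,
        sigma0 n s (Lam / lam) (Num.max 1 lam) (fine (C11_norm eta)) <= sigma ->
      forall u v : 'rV[R]_n -> R,
        holder_loc (2 * s + eps) u -> Linfty u ->
        holder_loc (2 * s + eps) v -> Linfty v ->
        (forall x,
           Lop K (fun y => eta y ^+ 2 * diff_quot h u y ^+ 2
                           + sigma * seg_avg h u y ^+ 2) x
           <= 2 * eta x ^+ 2 * Lop K (diff_quot h u) x * diff_quot h u x
              + 2 * sigma * Lop K (seg_avg h u) x * seg_avg h u x) /\
        (forall x,
           Lop K (fun y => eta y ^+ 2 * pos_part (diff_quot h v y) ^+ 2
                           + sigma * seg_avg h v y ^+ 2) x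
           <= 2 * eta x ^+ 2 * Lop K (diff_quot h v) x * pos_part (diff_quot h v x)
              + 2 * sigma * Lop K (seg_avg h v) x * seg_avg h v x).
Proof.
have /choice[f hf] : forall p : nat * (R * (R * (R * R))), exists sigma0, _ :=
  fun p => @sigma0_exists R p.1 p.2.1 p.2.2.1 p.2.2.2.1 (Num.max 1 p.2.2.2.2).
exists (fun n s q m N => f (n, (s, (q, (m, N))))).
split=> [n s q m N|]; first by have [] := hf (n, (s, (q, (m, N)))).
move=> n t s lam Lam eps K eta h n0 t0 ts s1 l0 lL e0 kc etaC eta0 h0 _ sigma hs.
(* The estimates require N >= 1; any number above the norm is an admissible bound. *)
set N := Num.max 1 (fine (C11_norm eta)).
have N1 : 1 <= N by rewrite le_max lexx.
have etaN : C11_bound eta N by apply: C11_norm_bound => //; rewrite le_max lexx orbT.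
have s0 : 0 < s by exact: lt_trans ts.
have [_ /= near_le] := hf (n, (s, (Lam / lam, (Num.max 1 lam, fine (C11_norm eta))))).
have lm : lam <= Num.max 1 lam by rewrite le_max lexx orbT.
have {}near_le := near_le n0 s0 s1 N1 lam Lam K kc l0 lL erefl lm eta etaN eta0.
have prep u : holder_loc (2 * s + eps) u -> Linfty u -> exists al Bu,
    [/\ s < al, al <= 1, regl al u & forall x, `|u x| <= Bu] /\
    [/\ continuous u, measurable_fun setT (seg_avg h u),
        reg al (diff_quot h u) & bm (diff_quot h u)].
  move=> hu Lu; have [al [sal al1 ru]] := holder_loc_regl s0 s1 e0 hu.
  have al0 : 0 < al by exact: lt_trans sal.
  have cu := reg_continuous al0 (regl_reg ru).
  have [Bu uB] := Linfty_bounded cu Lu.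
  exists al, Bu; split=> //; split=> //.
  - exact: reg_measurable al0 (reg_seg_avg h al0 ru).
  - exact: reg_diff_quot (regl_reg ru).
  - exact: bm_diff_quot (reg_measurable al0 (regl_reg ru)) uB.
move=> u v hu Lu hv Lv; split=> x.
  have [al [Bu [[sal al1 ru uB] [cu mU rw bw]]]] := prep u hu Lu.
  apply: (Lop_square_le s0 kc etaN sal al1 ru uB bw); last first.
  - by apply: (near_le u h Bu) => // y; rewrite subrr mulr0.
  - by rewrite expr2.
  - by under eq_fun do rewrite expr2; apply: regM => //; exact: ltW (lt_trans s0 sal).
have [al [Bu [[sal al1 ru uB] [cu mU rw bw]]]] := prep v hv Lv.
apply: (Lop_square_le s0 kc etaN sal al1 ru uB (bm_pos bw)).
- by apply: reg_pos_sqr => //; exact: ltW (lt_trans s0 sal).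
- by rewrite /pos_part expr2; case: (leP (diff_quot h v x) 0) => // _; rewrite !mul0r.
apply: (near_le v h Bu cu uB h0 mU (fun y => pos_part (diff_quot h v y)) x sigma (bm_pos bw)) => //.
move=> y; rewrite mulr_ge0 ?le_max ?lexx ?orbT//.
by rewrite subr_ge0 le_max lexx.
Qed.
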